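(* For every $\alpha>0$ there exist a bounded pseudoconvex domain $D\subset\mathbb C^3$ with $C^\infty$-smooth boundary, a point $P\in\partial D$, and a decreasing sequence $(\delta_\nu)_\nu$ of positive numbers with $\delta_\nu\to0$ and $P_{\delta_\nu}:=P-\delta_\nu n\in D$ for all $\nu$, such that $$\kappa_D(P_{\delta_\nu};n)\le\frac{1}{\delta_\nu(-\log\delta_\nu)^{\alpha}}\quad\text{for all }\nu,$$ where $n$ denotes the unit outward normal vector to $\partial D$ at $P$.
   Context: For a domain $D\subset\mathbb C^m$, $z\in D$ and $X\in\mathbb C^m$, the Kobayashi–Royden (pseudo)metric is $\kappa_D(z;X):=\inf\{\alpha>0:\ \text{there is } f\in\mathcal O(\mathbb D,D)\text{ with } f(0)=z,\ \alpha f'(0)=X\}$, where $\mathbb D$ is the open unit disc in $\mathbb C$ and $\mathcal O(\mathbb D,D)$ is the set of holomorphic maps $\mathbb D\to D$. *)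

(* Defs.v *)
From Stdlib Require Import Reals Lra.
Open Scope R_scope.

Definition C : Type := (R * R)%type.
Definition C0 : C := (0, 0).
Definition Cadd (a b : C) : C := (fst a + fst b, snd a + snd b).
Definition Csub (a b : C) : C := (fst a - fst b, snd a - snd b).
Definition Cmul (a b : C) : C :=
  (fst a * fst b - snd a * snd b, fst a * snd b + snd a * fst b).
Definition Cconj (a : C) : C := (fst a, - snd a).
Definition Cnorm (a : C) : R := sqrt (fst a ^ 2 + snd a ^ 2).
Definition Csum3 (f : nat -> C) : C := Cadd (f 0%nat) (Cadd (f 1%nat) (f 2%nat)).

Definition C3 : Type := (C * C * C)%type.
Definition comp (v : C3) (j : nat) : C :=
  match v with (a, b, c) =>
    match j with 0%nat => a | 1%nat => b | _ => c end end.
Definition V3add (v w : C3) : C3 :=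
  (Cadd (comp v 0) (comp w 0), Cadd (comp v 1) (comp w 1), Cadd (comp v 2) (comp w 2)).
Definition V3sub (v w : C3) : C3 :=
  (Csub (comp v 0) (comp w 0), Csub (comp v 1) (comp w 1), Csub (comp v 2) (comp w 2)).
Definition V3cscal (a : C) (v : C3) : C3 :=
  (Cmul a (comp v 0), Cmul a (comp v 1), Cmul a (comp v 2)).
Definition V3rscal (t : R) (v : C3) : C3 := V3cscal (t, 0) v.
Definition V3norm (v : C3) : R :=
  sqrt (Cnorm (comp v 0) ^ 2 + Cnorm (comp v 1) ^ 2 + Cnorm (comp v 2) ^ 2).

(** Real coordinates of C^3 = R^6: index 2k is Re z_k = x_k, index 2k+1 is Im z_k = y_k. *)
Definition basis (j : nat) : C3 :=
  match j with
  | 0%nat => ((1, 0), C0, C0)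
  | 1%nat => ((0, 1), C0, C0)
  | 2%nat => (C0, (1, 0), C0)
  | 3%nat => (C0, (0, 1), C0)
  | 4%nat => (C0, C0, (1, 0))
  | 5%nat => (C0, C0, (0, 1))
  | _ => (C0, C0, C0)
  end.

Definition open_set (U : C3 -> Prop) : Prop :=
  forall z, U z -> exists e, 0 < e /\ forall w, V3norm (V3sub w z) < e -> U w.
Definition connected_set (D : C3 -> Prop) : Prop :=
  forall U V : C3 -> Prop, open_set U -> open_set V ->
    (forall z, D z -> U z \/ V z) ->
    (forall z, D z -> U z -> V z -> False) ->
    (exists z, D z /\ U z) -> (exists z, D z /\ V z) -> False.
Definition is_domain (D : C3 -> Prop) : Prop :=
  (exists z, D z) /\ open_set D /\ connected_set D.
Definition bounded_set (D : C3 -> Prop) : Prop :=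
  exists M, forall z, D z -> V3norm z <= M.
Definition boundary_point (D : C3 -> Prop) (P : C3) : Prop :=
  ~ D P /\ forall e, 0 < e -> exists z, D z /\ V3norm (V3sub z P) < e.

Definition continuous3 (f : C3 -> R) : Prop :=
  forall z e, 0 < e -> exists d, 0 < d /\
    forall w, V3norm (V3sub w z) < d -> Rabs (f w - f z) < e.
Definition has_partial (f : C3 -> R) (j : nat) (z : C3) (l : R) : Prop :=
  derivable_pt_lim (fun t => f (V3add z (V3rscal t (basis j)))) 0 l.
Fixpoint Ck (k : nat) (f : C3 -> R) : Prop :=
  match k with
  | O => continuous3 f
  | S k' => forall j, (j < 6)%nat ->
      exists g : C3 -> R, (forall z, has_partial f j z (g z)) /\ Ck k' g
  end.
Definition Cinf (f : C3 -> R) : Prop := forall k, Ck k f.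
Definition has_second_partial (f : C3 -> R) (j k : nat) (z : C3) (l : R) : Prop :=
  exists g : C3 -> R, (forall y, has_partial f k y (g y)) /\ has_partial g j z l.

Definition defining_function (D : C3 -> Prop) (r : C3 -> R) : Prop :=
  Cinf r /\ (forall z, D z <-> r z < 0) /\
  (forall z, boundary_point D z ->
     exists j l, (j < 6)%nat /\ has_partial r j z l /\ l <> 0).
Definition smooth_boundary (D : C3 -> Prop) : Prop :=
  exists r, defining_function D r.

Definition dz (d1 : nat -> R) (j : nat) : C :=
  (d1 (2 * j)%nat / 2, - d1 (2 * j + 1)%nat / 2).
Definition dzdzbar (d2 : nat -> nat -> R) (j k : nat) : C :=
  ((d2 (2 * j)%nat (2 * k)%nat + d2 (2 * j + 1)%nat (2 * k + 1)%nat) / 4,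
   (d2 (2 * j)%nat (2 * k + 1)%nat - d2 (2 * j + 1)%nat (2 * k)%nat) / 4).
Definition levi_nonneg_on_boundary (D : C3 -> Prop) (r : C3 -> R) : Prop :=
  forall z, boundary_point D z ->
  forall (d1 : nat -> R) (d2 : nat -> nat -> R),
    (forall j, (j < 6)%nat -> has_partial r j z (d1 j)) ->
    (forall j k, (j < 6)%nat -> (k < 6)%nat -> has_second_partial r j k z (d2 j k)) ->
    forall w : C3,
      Csum3 (fun j => Cmul (dz d1 j) (comp w j)) = C0 ->
      0 <= fst (Csum3 (fun j => Csum3 (fun k =>
                 Cmul (dzdzbar d2 j k) (Cmul (comp w j) (Cconj (comp w k)))))).
Definition pseudoconvex (D : C3 -> Prop) : Prop :=
  exists r, defining_function D r /\ levi_nonneg_on_boundary D r.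

Definition unit_outward_normal (D : C3 -> Prop) (P n : C3) : Prop :=
  exists (r : C3 -> R) (d1 : nat -> R),
    defining_function D r /\
    (forall j, (j < 6)%nat -> has_partial r j P (d1 j)) /\
    let g := sqrt (d1 0%nat ^ 2 + d1 1%nat ^ 2 + d1 2%nat ^ 2 + d1 3%nat ^ 2
                   + d1 4%nat ^ 2 + d1 5%nat ^ 2) in
    n = V3rscal (/ g) ((d1 0%nat, d1 1%nat), (d1 2%nat, d1 3%nat), (d1 4%nat, d1 5%nat)).

Definition C3deriv (f : C -> C3) (zeta : C) (v : C3) : Prop :=
  forall e, 0 < e -> exists d, 0 < d /\ forall h : C, Cnorm h < d ->
    V3norm (V3sub (V3sub (f (Cadd zeta h)) (f zeta)) (V3cscal h v)) <= e * Cnorm h.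
Definition holo_disc_into (f : C -> C3) (D : C3 -> Prop) : Prop :=
  forall zeta, Cnorm zeta < 1 -> D (f zeta) /\ exists v, C3deriv f zeta v.

(** kappa_D(z; X) <= c, with kappa_D(z;X) = inf { a > 0 | exists f in O(disc,D),
    f(0) = z, a f'(0) = X } (unfolded: every c + e exceeds some admissible a). *)
Definition kobayashi_le (D : C3 -> Prop) (z X : C3) (c : R) : Prop :=
  forall e, 0 < e -> exists (a : R) (f : C -> C3) (v : C3),
    0 < a /\ a < c + e /\ holo_disc_into f D /\ f C0 = z /\
    C3deriv f C0 v /\ V3rscal a v = X.

(* Main.v *)
(** The domain is [{Re w + |w|^2 + phi(z) + chi(|z|^2) < 0}] with [phi] plurisubharmonic on
    [C^2], and the discs have the form [(s^2, s^3)] in [z], so that the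
    tangential part has vanishing first derivative at the centre.  Off the centre [s] is the
    meromorphic function [z2 / z1] on the cusp [z2^2 = z1^3], and a plurisubharmonic [Psi] can
    imitate [- Re (z2 / z1)] on the cusp: cut this function off to [0] near the origin, where
    the loss of plurisubharmonicity is repaired by a penalty vanishing on the cusp and by a
    function of [|z1|^2] of logarithmic growth.  Hence [Psi (s^2, s^3) <= o(M) - Re s] for
    [|s| <= M], which leaves room for a disc whose [w]-component [- delta + c s] has derivative
    [c M] much larger than [delta = c o(M)].  Finally [phi] is a sum of copies [c_k Psi] rescaled
    by [(l_k^2 z1, l_k^3 z2)]; these rescalings preserve the cusp, and since only powers of [M]
    and [l_k] are lost, [delta] may be exponentially small in them, which makes [phi] smooth. *)
From Stdlib Require Import Reals Lra Lia Psatz FunctionalExtensionality ClassicalEpsilon Compare_dec PSeries_reg Ranalysis5.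
From Coquelicot Require Import Coquelicot.
Require Import Defs.
Open Scope R_scope.

(** A tangential part that is even in [s], such as [(s^2, 0)], would fail. There
    [phi <= delta - c * Re s] at [s] and at [-s] gives [phi <= delta - c * |Re s|], and since [phi]
    is subharmonic along the disc and vanishes at its centre, [c] would be at most a multiple of
    [delta]. The cusp is parametrised injectively although the derivative vanishes at [0], and
    [- Re s] is harmonic, so the mean value inequality no longer obstructs. Quantitatively,
    [M = mu^2] and the loss [o(M)] is [B * mu]. With [mu] a multiple of [ell^N] and a coefficient of
    size [exp (- ell) / ell^N], the centre lies at depth [delta = exp (- ell)] and the normal
    derivative is [delta * ell^N]. As [ell = - log delta], every [N > alpha] suffices. The k-th disc
    meets all copies in the sum. The earlier ones vanish along it, because [Psi] is [0] on the cusp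
    near the origin; the later ones are suppressed by coefficients chosen after [ell k]. *)

(** * Smooth functions of polynomial growth *)

(** The line and [C^3] are both instances, so closure under sums and products is proved once and
    compositions [h (f z)] can mix the two. The weight [wt] is the yardstick for polynomial
    growth. *)
Record space := Space {
  pt :> Type;
  dst : pt -> pt -> R;
  shf : pt -> nat -> R -> pt;
  wt : pt -> R;
  ndir : nat;
  shf0 : forall x j, shf x j 0 = x;
  wt_ge1 : forall x, 1 <= wt x }.

Definition cont {X : space} (f : X -> R) : Prop :=
  forall x e, 0 < e -> exists d, 0 < d /\
    forall y, dst X y x < d -> Rabs (f y - f x) < e.
Definition poly_bd {X : space} (f : X -> R) : Prop :=
  exists A m, 0 <= A /\ forall x, Rabs (f x) <= A * wt X x ^ m.
Definition has_der {X : space} (f : X -> R) (j : nat) (x : X) (l : R) : Prop :=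
  derivable_pt_lim (fun t => f (shf X x j t)) 0 l.
(** Growth is recorded together with smoothness because rescaled copies are summed on all of [C^3]:
    for a function of polynomial growth, a dilation by [l] costs only a power of [l]. *)
Fixpoint Sm {X : space} (k : nat) (f : X -> R) : Prop :=
  (cont f /\ poly_bd f) /\
  match k with
  | O => True
  | S k' => forall j, (j < ndir X)%nat ->
      exists g : X -> R, (forall x, has_der f j x (g x)) /\ Sm k' g
  end.

Section Closure.
Context {X : space}.
Implicit Types f g : X -> R.

Lemma wt_pow_ge1 (x : X) m : 1 <= wt X x ^ m.
Proof. apply pow_R1_Rle, wt_ge1. Qed.

Lemma cont_plus f g : cont f -> cont g -> cont (fun x => f x + g x).
Proof.
  intros Hf Hg x e He.
  destruct (Hf x (e / 2)) as [d1 [Hd1 H1]]; [lra|].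
  destruct (Hg x (e / 2)) as [d2 [Hd2 H2]]; [lra|].
  exists (Rmin d1 d2); split; [now apply Rmin_pos|]; intros y Hy.
  assert (Hy1 := H1 y (Rlt_le_trans _ _ _ Hy (Rmin_l _ _))).
  assert (Hy2 := H2 y (Rlt_le_trans _ _ _ Hy (Rmin_r _ _))).
  replace (f y + g y - (f x + g x)) with ((f y - f x) + (g y - g x)) by ring.
  eapply Rle_lt_trans; [apply Rabs_triang|lra].
Qed.

Lemma cont_comp (h : R -> R) f :
  (forall y, continuity_pt h y) -> cont f -> cont (fun x => h (f x)).
Proof.
  intros Hh Hf x e He.
  destruct (Hh (f x) e He) as [d1 [Hd1 H1]].
  destruct (Hf x d1 Hd1) as [d [Hd H2]].
  exists d; split; [easy|]; intros y Hy.
  destruct (Req_dec (f x) (f y)) as [E|E].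
  - rewrite E, Rminus_diag, Rabs_R0; lra.
  - apply (H1 (f y)); split; [split; [exact I|exact E]|]. now apply H2.
Qed.

Lemma cont_const (c : R) : cont (fun _ : X => c).
Proof. intros x e He; exists 1; split; [lra|]; intros; rewrite Rminus_diag, Rabs_R0; lra. Qed.

Lemma cont_scal (c : R) f : cont f -> cont (fun x => c * f x).
Proof. intros Hf; apply (cont_comp (fun y => c * y)); [intros y; reg|exact Hf]. Qed.

(** Polarisation reduces products to sums and to composition with the square. *)
Lemma cont_mult f g : cont f -> cont g -> cont (fun x => f x * g x).
Proof.
  intros Hf Hg.
  assert (E : (fun x : X => f x * g x) =
    fun x => /2 * (Rsqr (f x + g x) + (-1) * (Rsqr (f x) + Rsqr (g x)))).
  { apply functional_extensionality; intros; unfold Rsqr; field. }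
  rewrite E.
  assert (Hs : forall y, continuity_pt Rsqr y) by (intros y; reg).
  apply cont_scal, cont_plus; [|apply cont_scal, cont_plus];
    apply (cont_comp Rsqr); auto; now apply cont_plus.
Qed.

Lemma poly_bd_const (c : R) : poly_bd (fun _ : X => c).
Proof. exists (Rabs c), 0%nat; split; [apply Rabs_pos|]; intros; simpl; lra. Qed.

Lemma poly_bd_plus f g : poly_bd f -> poly_bd g -> poly_bd (fun x => f x + g x).
Proof.
  intros [A [m [HA H]]] [B [n [HB G]]].
  exists (A + B), (m + n)%nat; split; [lra|]; intros x.
  specialize (H x); specialize (G x).
  assert (H1 := wt_pow_ge1 x m); assert (H2 := wt_pow_ge1 x n).
  rewrite pow_add.
  assert (H3 := Rabs_triang (f x) (g x)).
  assert (A * wt X x ^ m <= A * (wt X x ^ m * wt X x ^ n)) by (apply Rmult_le_compat_l; nra).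
  assert (B * wt X x ^ n <= B * (wt X x ^ m * wt X x ^ n)) by (apply Rmult_le_compat_l; nra).
  lra.
Qed.

Lemma poly_bd_mult f g : poly_bd f -> poly_bd g -> poly_bd (fun x => f x * g x).
Proof.
  intros [A [m [HA H]]] [B [n [HB G]]].
  exists (A * B), (m + n)%nat; split; [nra|]; intros x.
  rewrite Rabs_mult, pow_add.
  replace (A * B * (wt X x ^ m * wt X x ^ n))
    with ((A * wt X x ^ m) * (B * wt X x ^ n)) by ring.
  apply Rmult_le_compat; auto using Rabs_pos.
Qed.

Lemma has_der_plus f g j x l l' :
  has_der f j x l -> has_der g j x l' -> has_der (fun y => f y + g y) j x (l + l').
Proof. intros H G; exact (derivable_pt_lim_plus _ _ _ _ _ H G). Qed.

Lemma has_der_mult f g j x l l' :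
  has_der f j x l -> has_der g j x l' ->
  has_der (fun y => f y * g y) j x (l * g x + f x * l').
Proof.
  intros H G; assert (K := derivable_pt_lim_mult _ _ _ _ _ H G).
  cbv beta in K; rewrite shf0 in K; exact K.
Qed.

Lemma has_der_const (c : R) j (x : X) : has_der (fun _ => c) j x 0.
Proof. apply derivable_pt_lim_const. Qed.

Lemma has_der_comp (h : R -> R) f j x l l' :
  derivable_pt_lim h (f x) l' -> has_der f j x l -> has_der (fun y => h (f y)) j x (l' * l).
Proof.
  intros Hh Hf; apply (derivable_pt_lim_comp (fun t => f (shf X x j t)) h); auto.
  now rewrite shf0.
Qed.

Lemma has_der_unique f j x l l' : has_der f j x l -> has_der f j x l' -> l = l'.
Proof. apply uniqueness_limite. Qed.

Lemma Sm_0 k f : Sm k f -> cont f /\ poly_bd f.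
Proof. destruct k; simpl; tauto. Qed.

Lemma Sm_pred k : forall f, Sm (S k) f -> Sm k f.
Proof.
  induction k as [|k IH]; intros f H; [split; [exact (Sm_0 _ _ H)|exact I]|].
  destruct H as [H0 H]; split; [exact H0|]; intros j Hj.
  destruct (H j Hj) as [g [Hg Hs]]; exists g; split; auto.
Qed.

Lemma Sm_const (c : R) k : Sm k (fun _ : X => c).
Proof.
  revert c; induction k as [|k IH]; intros c; (split; [split; [apply cont_const|apply poly_bd_const]|]);
    [exact I|].
  intros j Hj; exists (fun _ => 0); split; [intros; apply has_der_const|apply IH].
Qed.

Lemma Sm_plus k : forall f g, Sm k f -> Sm k g -> Sm k (fun x => f x + g x).
Proof.
  induction k as [|k IH]; intros f g [[Cf Bf] Hf] [[Cg Bg] Hg];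
    (split; [split; [now apply cont_plus|now apply poly_bd_plus]|]); [exact I|].
  intros j Hj; destruct (Hf j Hj) as [f' [Df Sf]]; destruct (Hg j Hj) as [g' [Dg Sg]].
  exists (fun x => f' x + g' x); split; [intros; now apply has_der_plus|auto].
Qed.

Lemma Sm_mult k : forall f g, Sm k f -> Sm k g -> Sm k (fun x => f x * g x).
Proof.
  induction k as [|k IH]; intros f g Sf0 Sg0; assert (Sf1 := Sf0); assert (Sg1 := Sg0);
    destruct Sf0 as [[Cf Bf] Hf]; destruct Sg0 as [[Cg Bg] Hg];
    (split; [split; [now apply cont_mult|now apply poly_bd_mult]|]); [exact I|].
  intros j Hj; destruct (Hf j Hj) as [f' [Df Sf]]; destruct (Hg j Hj) as [g' [Dg Sg]].
  exists (fun x => f' x * g x + f x * g' x); split; [intros; now apply has_der_mult|].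
  apply Sm_pred in Sf1, Sg1; apply Sm_plus; auto.
Qed.

Lemma Sm_scal k (c : R) f : Sm k f -> Sm k (fun x => c * f x).
Proof. intros H; apply Sm_mult; [apply Sm_const|exact H]. Qed.

(** [Sm] only asserts that some derivative is regular; uniqueness of limits transfers this to a
    derivative given by a formula. *)
Lemma Sm_der k f j (g : X -> R) :
  Sm (S k) f -> (j < ndir X)%nat -> (forall x, has_der f j x (g x)) -> Sm k g.
Proof.
  intros [_ H] Hj Hg; destruct (H j Hj) as [g' [Hg' Hs]].
  replace g with g'; [exact Hs|]; apply functional_extensionality; intros x.
  exact (has_der_unique _ _ _ _ _ (Hg' x) (Hg x)).
Qed.

Lemma Sm_intro k f (g : nat -> X -> R) :
  cont f -> poly_bd f -> (forall j x, (j < ndir X)%nat -> has_der f j x (g j x)) ->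
  (forall j, (j < ndir X)%nat -> Sm k (g j)) -> Sm (S k) f.
Proof. intros Hc Hb Hd Hs; split; [auto|]; intros j Hj; exists (g j); auto. Qed.
End Closure.

Definition line : space.
Proof.
  refine (Space R (fun y x => Rabs (y - x)) (fun x _ t => x + t) (fun x => 1 + x ^ 2) 1 _ _).
  - intros; apply Rplus_0_r.
  - intros; nra.
Defined.

Lemma cont_line (f : R -> R) : @cont line f <-> forall x, continuity_pt f x.
Proof.
  split.
  - intros H x e He; destruct (H x e He) as [d [Hd K]]; exists d; split; [easy|].
    intros y [_ Hy]; apply K, Hy.
  - intros H x e He; destruct (H x e He) as [d [Hd K]]; exists d; split; [easy|].
    intros y Hy; destruct (Req_dec x y) as [<-|E].
    + rewrite Rminus_diag, Rabs_R0; lra.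
    + apply (K y); repeat split; [exact E|exact Hy].
Qed.

Lemma has_der_line (f : R -> R) j (x l : R) :
  @has_der line f j x l <-> derivable_pt_lim f x l.
Proof.
  unfold has_der; simpl; split; intros H e He; destruct (H e He) as [d Hd]; exists d;
    intros h Hh Hh'; specialize (Hd h Hh Hh'); rewrite Rplus_0_l, Rplus_0_r in *; exact Hd.
Qed.

Lemma Sm_line_S k (f f' : R -> R) :
  (forall x, derivable_pt_lim f x (f' x)) -> @poly_bd line f -> @Sm line k f' ->
  @Sm line (S k) f.
Proof.
  intros H Hb Hs; apply (@Sm_intro line k f (fun _ => f')); auto.
  - apply cont_line; intros x; apply derivable_continuous_pt; exists (f' x); apply H.
  - intros j x _; now apply has_der_line.
Qed.

Lemma Sm_line_der k (f : R -> R) :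
  @Sm line (S k) f -> exists f', (forall x, derivable_pt_lim f x (f' x)) /\ @Sm line k f'.
Proof.
  intros [_ H]; destruct (H 0%nat) as [g [Hg Hs]]; [simpl; lia|].
  exists g; split; [|exact Hs]; intros x; now apply (has_der_line f 0).
Qed.

Lemma poly_bd_comp {X : space} (h : R -> R) (f : X -> R) :
  @poly_bd line h -> poly_bd f -> poly_bd (fun x => h (f x)).
Proof.
  intros [A [m [HA H]]] [B [n [HB G]]].
  exists (A * (1 + B ^ 2) ^ m), (2 * n * m)%nat; split.
  { apply Rmult_le_pos; [easy|apply pow_le; nra]. }
  intros x; eapply Rle_trans; [apply H|].
  rewrite Rmult_assoc; apply Rmult_le_compat_l; [easy|].
  rewrite pow_mult, <- Rpow_mult_distr; apply pow_incr; cbn [wt line].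
  assert (H1 := wt_pow_ge1 x n).
  rewrite Nat.mul_comm, pow_mult.
  specialize (G x); assert (H2 := Rabs_pos (f x)).
  replace (f x ^ 2) with (Rabs (f x) ^ 2) by apply pow2_abs.
  split; [nra|].
  assert (H3 : Rabs (f x) ^ 2 <= (B * wt X x ^ n) ^ 2) by (apply pow_incr; lra).
  rewrite Rpow_mult_distr in H3.
  assert (1 <= (wt X x ^ n) ^ 2) by (apply pow_R1_Rle; exact H1).
  lra.
Qed.

Lemma Sm_comp {X : space} k : forall (h : R -> R) (f : X -> R),
  @Sm line k h -> Sm k f -> Sm k (fun x => h (f x)).
Proof.
  induction k as [|k IH]; intros h f Hh Hf.
  - destruct Hh as [[Ch Bh] _]; destruct Hf as [[Cf Bf] _].
    split; [split|exact I]; [apply cont_comp; auto; now apply cont_line|now apply poly_bd_comp].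
  - assert (Hf1 := Sm_pred _ _ Hf).
    destruct (Sm_line_der _ _ Hh) as [h' [Dh Sh]].
    destruct Hh as [[Ch Bh] _]; destruct Hf as [[Cf Bf] Hf].
    split; [split|]; [apply cont_comp; auto; now apply cont_line|now apply poly_bd_comp|].
    intros j Hj; destruct (Hf j Hj) as [f' [Df Sf]].
    exists (fun x => h' (f x) * f' x); split; [intros; now apply has_der_comp|].
    apply Sm_mult; auto.
Qed.

Lemma Sm_line_id k : @Sm line k (fun x => x).
Proof.
  destruct k as [|k].
  - split; [split|exact I].
    + intros x e He; exists e; auto.
    + exists 1, 1%nat; split; [lra|]; intros x; simpl.
      apply Rabs_le; nra.
  - apply Sm_line_S with (fun _ => 1).
    + intros; apply derivable_pt_lim_id.
    + exists 1, 1%nat; split; [lra|]; intros x; simpl; apply Rabs_le; nra.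
    + apply (@Sm_const line).
Qed.

(** * Real coordinates on [C^3] *)

Definition crd (i : nat) (z : C3) : R :=
  match z with ((a, b), (p, q), (u, v)) =>
    match i with 0 => a | 1 => b | 2 => p | 3 => q | 4 => u | _ => v end%nat end.
Definition sq3 (z : C3) : R :=
  crd 0 z ^ 2 + crd 1 z ^ 2 + crd 2 z ^ 2 + crd 3 z ^ 2 + crd 4 z ^ 2 + crd 5 z ^ 2.

Lemma V3norm_sq3 z : V3norm z = sqrt (sq3 z).
Proof.
  destruct z as [[[a b] [p q]] [u v]]; unfold V3norm, sq3, Cnorm; simpl comp; simpl crd.
  rewrite !pow2_sqrt by (simpl; nra); f_equal; simpl; ring.
Qed.

Lemma sq3_nonneg z : 0 <= sq3 z.
Proof. unfold sq3; nra. Qed.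

Lemma V3norm_pow2 z : V3norm z ^ 2 = sq3 z.
Proof. rewrite V3norm_sq3; apply pow2_sqrt, sq3_nonneg. Qed.

Lemma crd_le_V3norm i z : Rabs (crd i z) <= V3norm z.
Proof.
  rewrite V3norm_sq3, <- sqrt_Rsqr_abs; apply sqrt_le_1_alt; unfold Rsqr, sq3.
  destruct z as [[[a b] [p q]] [u v]]; do 6 (destruct i as [|i]; [simpl; nra|]); simpl; nra.
Qed.

Lemma crd_sub i y z : crd i (V3sub y z) = crd i y - crd i z.
Proof.
  destruct z as [[[a b] [p q]] [u v]]; destruct y as [[[a' b'] [p' q']] [u' v']].
  do 6 (destruct i as [|i]; [reflexivity|]); reflexivity.
Qed.

Lemma crd_shift i j z t : (i < 6)%nat -> (j < 6)%nat ->
  crd i (V3add z (V3rscal t (basis j))) = crd i z + (if Nat.eqb i j then t else 0).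
Proof.
  intros Hi Hj; destruct z as [[[a b] [p q]] [u v]].
  do 6 (destruct j as [|j];
    [do 6 (destruct i as [|i]; [simpl; ring|]); exfalso; clear -Hi; lia|]).
  exfalso; clear -Hj; lia.
Qed.

Lemma C3_ext (z w : C3) : (forall i, (i < 6)%nat -> crd i z = crd i w) -> z = w.
Proof.
  intros H; destruct z as [[[a b] [p q]] [u v]]; destruct w as [[[a' b'] [p' q']] [u' v']].
  assert (H0 := H 0%nat); assert (H1 := H 1%nat); assert (H2 := H 2%nat);
  assert (H3 := H 3%nat); assert (H4 := H 4%nat); assert (H5 := H 5%nat).
  simpl in *; rewrite H0, H1, H2, H3, H4, H5 by lia; reflexivity.
Qed.

Definition Cspace : space.
Proof.
  refine (Space C3 (fun y x => V3norm (V3sub y x))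
    (fun z j t => V3add z (V3rscal t (basis j))) (fun z => 1 + sq3 z) 6 _ _).
  - intros [[[a b] [p q]] [u v]] j.
    unfold V3add, V3rscal, V3cscal, Cadd, Cmul; simpl.
    do 6 (destruct j as [|j]; [simpl; repeat f_equal; ring|]); simpl; repeat f_equal; ring.
  - intros z; assert (H := sq3_nonneg z); lra.
Defined.

Lemma Ck_Sm k : forall f : C3 -> R, @Sm Cspace k f -> Ck k f.
Proof.
  induction k as [|k IH]; intros f [[Hc Hb] H]; [exact Hc|].
  intros j Hj; destruct (H j Hj) as [g [Hg Hs]]; exists g; split; [exact Hg|auto].
Qed.

Lemma has_der_crd i j (z : C3) : (i < 6)%nat -> (j < 6)%nat ->
  @has_der Cspace (crd i) j z (if Nat.eqb i j then 1 else 0).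
Proof.
  intros Hi Hj; unfold has_der.
  replace (fun t => crd i (shf Cspace z j t))
    with (fun t : R => crd i z + (if Nat.eqb i j then t else 0)).
  - replace (if Nat.eqb i j then 1 else 0) with (0 + (if Nat.eqb i j then 1 else 0)) by ring.
    apply (derivable_pt_lim_plus (fun _ => crd i z)); [apply derivable_pt_lim_const|].
    destruct (Nat.eqb i j); [apply derivable_pt_lim_id|apply derivable_pt_lim_const].
  - apply functional_extensionality; intros t; symmetry; now apply crd_shift.
Qed.

Lemma Sm_crd i k : (i < 6)%nat -> @Sm Cspace k (crd i).
Proof.
  intros Hi.
  assert (Hc : @cont Cspace (crd i)).
  { intros z e He; exists e; split; [easy|]; intros y Hy; simpl in Hy.
    rewrite <- crd_sub; eapply Rle_lt_trans; [apply crd_le_V3norm|exact Hy]. }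
  assert (Hb : @poly_bd Cspace (crd i)).
  { exists 1, 1%nat; split; [lra|]; intros z; rewrite pow_1, Rmult_1_l.
    eapply Rle_trans; [apply (crd_le_V3norm i z)|]; cbn [wt Cspace].
    rewrite <- V3norm_pow2; nra. }
  destruct k as [|k]; [repeat split; auto|].
  apply (@Sm_intro Cspace k _ (fun j _ => if Nat.eqb i j then 1 else 0)); auto.
  - intros j z Hj; now apply has_der_crd.
  - intros j _; apply (@Sm_const Cspace).
Qed.

(** * Flat functions and the auxiliary functions of one variable *)

(** The powers of [/ t] make the family closed under differentiation up to linear combinations, so
    one induction shows that all members are smooth. *)
Definition flat (n : nat) (t : R) : R :=
  if Rle_dec t 0 then 0 else (/ t) ^ n * exp (- / t).

(** Write [exp (- s)] as the square of [exp (- (s / 2))]: one factor absorbs one power of [s], the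
    other is the induction hypothesis at [s / 2]. *)
Lemma exp_neg_pow_bound n : exists A, 0 <= A /\ forall s, 0 <= s -> s ^ n * exp (- s) <= A.
Proof.
  induction n as [|n [A [HA IH]]].
  - exists 1; split; [lra|]; intros s Hs; simpl; rewrite Rmult_1_l, exp_Ropp.
    rewrite <- Rinv_1; apply Rinv_le_contravar; [lra|].
    assert (H := exp_ineq1_le s); lra.
  - exists (2 * (2 ^ n * A)); split; [assert (0 <= 2 ^ n) by (apply pow_le; lra); nra|].
    intros s Hs; assert (H := IH (s / 2) ltac:(lra)).
    replace (exp (- s)) with (exp (- (s / 2)) * exp (- (s / 2)))
      by (rewrite <- exp_plus; f_equal; field).
    assert (H1 : s / 2 * exp (- (s / 2)) <= 1).
    { rewrite exp_Ropp; assert (H2 := exp_ineq1_le (s / 2)).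
      apply Rmult_le_reg_r with (exp (s / 2)); [apply exp_pos|].
      rewrite Rmult_assoc, Rinv_l by (apply Rgt_not_eq, exp_pos); lra. }
    assert (H2 : 0 <= s / 2 * exp (- (s / 2))) by (apply Rmult_le_pos; [lra|left; apply exp_pos]).
    assert (H3 : 0 <= 2 ^ n * ((s / 2) ^ n * exp (- (s / 2)))).
    { apply Rmult_le_pos; [apply pow_le; lra|]; apply Rmult_le_pos; [apply pow_le; lra|left; apply exp_pos]. }
    assert (E : s ^ n = 2 ^ n * (s / 2) ^ n) by (rewrite <- Rpow_mult_distr; f_equal; field).
    simpl; rewrite E.
    replace (s * (2 ^ n * (s / 2) ^ n) * (exp (- (s / 2)) * exp (- (s / 2))))
      with (2 * (s / 2 * exp (- (s / 2))) * (2 ^ n * ((s / 2) ^ n * exp (- (s / 2))))) by field.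
    assert (H4 : 2 ^ n * ((s / 2) ^ n * exp (- (s / 2))) <= 2 ^ n * A)
      by (apply Rmult_le_compat_l; [apply pow_le; lra|exact H]).
    nra.
Qed.

Lemma flat_nonneg n t : 0 <= flat n t.
Proof.
  unfold flat; destruct (Rle_dec t 0); [lra|].
  apply Rmult_le_pos; [apply pow_le; left; apply Rinv_0_lt_compat; lra|left; apply exp_pos].
Qed.

Lemma flat_eq0 n t : t <= 0 -> flat n t = 0.
Proof. unfold flat; destruct (Rle_dec t 0); lra. Qed.

Lemma flat_pos n t : 0 < t -> 0 < flat n t.
Proof.
  intros H; unfold flat; destruct (Rle_dec t 0); [lra|].
  apply Rmult_lt_0_compat; [apply pow_lt, Rinv_0_lt_compat; lra|apply exp_pos].
Qed.

Lemma flat_bound n : exists A, 0 <= A /\ forall t, flat n t <= A.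
Proof.
  destruct (exp_neg_pow_bound n) as [A [HA H]]; exists A; split; [easy|]; intros t.
  unfold flat; destruct (Rle_dec t 0); [lra|].
  apply H; left; apply Rinv_0_lt_compat; lra.
Qed.

Lemma flat_0_mult n t : flat (S n) t * t = flat n t.
Proof.
  unfold flat; destruct (Rle_dec t 0); [ring|]; simpl; field; lra.
Qed.

Lemma flat_der n t : derivable_pt_lim (flat n) t (flat (S (S n)) t - INR n * flat (S n) t).
Proof.
  destruct (Rtotal_order t 0) as [H|[->|H]].
  - rewrite !flat_eq0 by lra; replace (0 - INR n * 0) with 0 by ring.
    apply is_derive_Reals, is_derive_ext_loc with (fun _ => 0).
    + exists (mkposreal (- t) ltac:(lra)); intros y Hy; symmetry; apply flat_eq0.
      unfold ball in Hy; simpl in Hy; unfold AbsRing_ball, abs, minus, plus, opp in Hy; simpl in Hy.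
      apply Rabs_def2 in Hy; lra.
    + apply @is_derive_const.
  - rewrite !flat_eq0 by lra; replace (0 - INR n * 0) with 0 by ring.
    destruct (flat_bound (S (S n))) as [A [HA HB]].
    intros e He; exists (mkposreal (e / (A + 1)) ltac:(apply Rdiv_lt_0_compat; lra)); simpl.
    intros h Hh Hd; rewrite Rplus_0_l, (flat_eq0 n 0), !Rminus_0_r by lra.
    (* At [0] the difference quotient is a bounded member of the family times [h], hence tends to
       [0]. *)
    assert (E : flat n h / h = flat (S (S n)) h * h).
    { rewrite <- (flat_0_mult n), <- (flat_0_mult (S n)); field; exact Hh. }
    rewrite E, Rabs_mult, (Rabs_pos_eq _ (flat_nonneg _ _)).
    assert (H1 := HB h); assert (H2 := flat_nonneg (S (S n)) h); assert (H3 := Rabs_pos h).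
    apply Rle_lt_trans with ((A + 1) * Rabs h); [nra|].
    apply Rmult_lt_reg_r with (/ (A + 1)); [apply Rinv_0_lt_compat; lra|].
    replace ((A + 1) * Rabs h * / (A + 1)) with (Rabs h) by (field; lra); exact Hd.
  - apply is_derive_Reals, is_derive_ext_loc with (fun t => (/ t) ^ n * exp (- / t)).
    + exists (mkposreal t H); intros y Hy.
      unfold ball in Hy; simpl in Hy; unfold AbsRing_ball, abs, minus, plus, opp in Hy; simpl in Hy.
      apply Rabs_def2 in Hy; unfold flat; destruct (Rle_dec y 0); [lra|reflexivity].
    + unfold flat; destruct (Rle_dec t 0); [lra|].
      destruct n as [|n]; auto_derive; try lra; simpl; try (field; lra).
Qed.

Lemma bounded_poly_bd {X : space} (f : X -> R) A :
  (forall x, Rabs (f x) <= A) -> poly_bd f.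
Proof.
  intros H; exists (Rmax A 0), 0%nat; split; [apply Rmax_r|]; intros x; rewrite pow_O, Rmult_1_r.
  eapply Rle_trans; [apply H|apply Rmax_l].
Qed.

Lemma Sm_minus {X : space} k (f g : X -> R) : Sm k f -> Sm k g -> Sm k (fun x => f x - g x).
Proof.
  intros Hf Hg.
  replace (fun x => f x - g x) with (fun x => f x + (-1) * g x)
    by (apply functional_extensionality; intros; ring).
  apply Sm_plus; [exact Hf|now apply Sm_scal].
Qed.

Lemma Sm_flat k : forall n, @Sm line k (flat n).
Proof.
  assert (HB : forall n, @poly_bd line (flat n)).
  { intros n; destruct (flat_bound n) as [A [_ H]]; apply (@bounded_poly_bd line _ A).
    intros t; rewrite Rabs_pos_eq; [apply H|apply flat_nonneg]. }
  induction k as [|k IH]; intros n.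
  - split; [split; [|auto]|exact I]; apply cont_line; intros x; apply derivable_continuous_pt.
    eexists; apply flat_der.
  - apply Sm_line_S with (1 := flat_der n); [auto|].
    apply (@Sm_minus line); [auto|]; now apply (@Sm_scal line).
Qed.

Lemma Sm_line_affine k (f : R -> R) a b :
  @Sm line k f -> @Sm line k (fun t => f (a * t + b)).
Proof.
  intros H; apply (@Sm_comp line k f (fun t => a * t + b) H).
  apply (@Sm_plus line); [|apply (@Sm_const line)]; apply (@Sm_scal line), Sm_line_id.
Qed.

(** The quotient is well defined because [f] vanishes near the origin, where [/ 0] is junk. *)
Lemma Sm_line_div k : forall f : R -> R, (forall t, t <= / 2 -> f t = 0) ->
  @Sm line k f -> @Sm line k (fun t => f t / t).
Proof.
  assert (HB : forall f : R -> R, (forall t, t <= / 2 -> f t = 0) ->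
    @poly_bd line f -> @poly_bd line (fun t => f t / t)).
  { intros f Hf [A [m [HA H]]]; exists (2 * A), m; split; [lra|]; intros t; specialize (H t).
    assert (H1 := @wt_pow_ge1 line t m).
    destruct (Rle_dec t (/ 2)) as [Ht|Ht].
    - rewrite Hf by easy; unfold Rdiv; rewrite Rmult_0_l, Rabs_R0; nra.
    - unfold Rdiv; rewrite Rabs_mult, (Rabs_pos_eq (/ t)) by (left; apply Rinv_0_lt_compat; lra).
      assert (/ t <= 2) by (rewrite <- (Rinv_inv 2); apply Rinv_le_contravar; lra).
      assert (0 < / t) by (apply Rinv_0_lt_compat; lra).
      assert (H3 := Rabs_pos (f t)); nra. }
  assert (HD : forall f f' : R -> R, (forall t, t <= / 2 -> f t = 0) ->
    (forall t, derivable_pt_lim f t (f' t)) ->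
    (forall t, t <= / 2 -> f' t = 0) /\
    forall t, derivable_pt_lim (fun t => f t / t) t (f' t / t - f t / t / t)).
  { intros f f' Hf Hd.
    assert (Hlt : forall t, t < / 2 -> f' t = 0).
    { intros t Ht; apply (uniqueness_limite f t); [apply Hd|].
      apply is_derive_Reals, is_derive_ext_loc with (fun _ => 0); [|apply @is_derive_const].
      exists (mkposreal (/ 2 - t) ltac:(lra)); intros y Hy; symmetry; apply Hf.
      unfold ball in Hy; simpl in Hy; unfold AbsRing_ball, abs, minus, plus, opp in Hy; simpl in Hy.
      apply Rabs_def2 in Hy; lra. }
    (* At the end point, difference quotients taken from the left are [0], because [f] vanishes
       there. *)
    assert (H2 : f' (/ 2) = 0).
    { destruct (Req_dec (f' (/ 2)) 0) as [E|E]; [exact E|exfalso].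
      destruct (Hd (/ 2) (Rabs (f' (/ 2)) / 2)) as [d H].
      { assert (H := Rabs_pos_lt _ E); lra. }
      assert (Hp := cond_pos d).
      specialize (H (- (d / 2)) ltac:(lra)).
      rewrite !Hf in H by lra.
      replace ((0 - 0) / - (d / 2) - f' (/ 2)) with (- f' (/ 2)) in H by (field; lra).
      rewrite !Rabs_Ropp, (Rabs_pos_eq (d / 2)) in H by lra.
      assert (H3 := Rabs_pos_lt _ E); specialize (H ltac:(lra)); lra. }
    split.
    - intros t [Ht|Ht]; [auto|now rewrite Ht].
    - intros t; destruct (Rlt_dec t (/ 2)) as [Ht|Ht].
      + rewrite Hf, Hlt by lra; unfold Rdiv; rewrite !Rmult_0_l, Rminus_0_r.
        apply is_derive_Reals, is_derive_ext_loc with (fun _ => 0); [|apply @is_derive_const].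
        exists (mkposreal (/ 2 - t) ltac:(lra)); intros y Hy; rewrite Hf; [symmetry; apply Rmult_0_l|].
        unfold ball in Hy; simpl in Hy; unfold AbsRing_ball, abs, minus, plus, opp in Hy; simpl in Hy.
        apply Rabs_def2 in Hy; lra.
      + replace (f' t / t - f t / t / t) with ((f' t * t - 1 * f t) / Rsqr t)
          by (unfold Rsqr; field; lra).
        apply (derivable_pt_lim_div f id); [apply Hd|apply derivable_pt_lim_id|unfold id; lra]. }
  induction k as [|k IH]; intros f Hf Hs.
  - destruct Hs as [[Cf Bf] _]; split; [split; [|auto]|exact I].
    apply cont_line; intros t; destruct (Rlt_dec t (/ 2)) as [Ht|Ht].
    + apply continuity_pt_ext_loc with (fun _ => 0); [|apply continuity_pt_const; now intros ? ?].
      exists (mkposreal (/ 2 - t) ltac:(lra)); intros y Hy; rewrite Hf; [symmetry; apply Rmult_0_l|].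
      unfold ball in Hy; simpl in Hy; unfold AbsRing_ball, abs, minus, plus, opp in Hy; simpl in Hy.
      apply Rabs_def2 in Hy; lra.
    + apply (continuity_pt_div f id); [now apply cont_line|apply derivable_continuous_pt, derivable_pt_id|unfold id; lra].
  - assert (Hs1 := @Sm_pred line _ _ Hs).
    destruct (Sm_line_der _ _ Hs) as [f' [Df Sf]].
    destruct (HD f f' Hf Df) as [Hf' Dq].
    apply Sm_line_S with (1 := Dq).
    + apply HB; [easy|apply Hs].
    + apply (@Sm_minus line); [auto|].
      apply (IH (fun t => f t / t)); [|auto]; intros t Ht; rewrite Hf by easy; unfold Rdiv; ring.
Qed.

Lemma Sm_primitive (f : R -> R) a : (forall k, @Sm line k f) ->
  exists F, F a = 0 /\ (forall t, derivable_pt_lim F t (f t)) /\ forall k, @Sm line k F.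
Proof.
  intros Hs.
  assert (Hc : forall t, continuous f t).
  { intros t; apply continuity_pt_filterlim; apply cont_line, (@Sm_0 line 0), Hs. }
  assert (HI : forall u v, ex_RInt f u v) by (intros; apply (ex_RInt_continuous (V := R_CompleteNormedModule)); intros; apply Hc).
  set (F := fun t => RInt f a t).
  assert (HF : forall t, derivable_pt_lim F t (f t)).
  { intros t; apply is_derive_Reals, (is_derive_RInt f F a t); [|apply Hc].
    exists posreal_one; intros y _; apply (RInt_correct (V := R_CompleteNormedModule)), HI. }
  exists F; split; [exact (RInt_point (V := R_CompleteNormedModule) a f)|]; split; [exact HF|].
  (* By the mean value theorem [F t = f c * (t - a)] with [c] between [a] and [t], so [F] grows with
     one more power of the weight than [f]. *)
  assert (HB : @poly_bd line F).
  { destruct (Sm_0 0 _ (Hs 0%nat)) as [_ [A [m [HA H]]]].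
    exists (A * (1 + Rabs a) * (1 + a ^ 2) ^ m), (S m); split.
    { apply Rmult_le_pos; [apply Rmult_le_pos; [easy|assert (H0 := Rabs_pos a); lra]|apply pow_le; nra]. }
    intros t.
    destruct (Req_dec t a) as [->|Ht].
    { unfold F; rewrite RInt_point; unfold zero; simpl; rewrite Rabs_R0.
      repeat apply Rmult_le_pos; try easy; try (apply pow_le; nra); try nra.
      assert (H0 := Rabs_pos a); lra. }
    assert (Hm : exists c, Rmin a t <= c <= Rmax a t /\ F t = f c * (t - a)).
    { destruct (MVT_gen F a t f) as [c [H1 H2]].
      - intros; now apply is_derive_Reals.
      - intros; apply derivable_continuous_pt; eexists; apply HF.
      - exists c; split; [exact H1|]; rewrite <- H2; replace (F a) with 0; [symmetry; apply Rminus_0_r|].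
        symmetry; exact (RInt_point (V := R_CompleteNormedModule) a f). }
    destruct Hm as [c [Hc1 ->]]; rewrite Rabs_mult.
    assert (Hw : 1 + c ^ 2 <= (1 + a ^ 2) * (1 + t ^ 2)).
    { assert (c ^ 2 <= a ^ 2 \/ c ^ 2 <= t ^ 2).
      { unfold Rmin, Rmax in Hc1; destruct (Rle_dec a t);
        destruct (Rle_dec 0 c); [right|left|left|right]; nra. }
      destruct H0; nra. }
    assert (Hw2 : Rabs (f c) <= A * ((1 + a ^ 2) ^ m * (1 + t ^ 2) ^ m)).
    { eapply Rle_trans; [apply H|]; apply Rmult_le_compat_l; [easy|].
      rewrite <- Rpow_mult_distr; apply pow_incr; cbn [wt line]; split; [nra|exact Hw]. }
    assert (Hw3 : Rabs (t - a) <= (1 + Rabs a) * (1 + t ^ 2)).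
    { eapply Rle_trans; [apply Rabs_triang|]; rewrite Rabs_Ropp.
      assert (Rabs t <= 1 + t ^ 2) by (apply Rabs_le; nra); assert (H1 := Rabs_pos a); nra. }
    cbn [wt line]; replace (A * (1 + Rabs a) * (1 + a ^ 2) ^ m * (1 + t ^ 2) ^ S m)
      with (A * ((1 + a ^ 2) ^ m * (1 + t ^ 2) ^ m) * ((1 + Rabs a) * (1 + t ^ 2))) by (simpl; ring).
    apply Rmult_le_compat; auto using Rabs_pos. }
  intros [|k].
  - apply (@Sm_pred line); now apply Sm_line_S with f.
  - now apply Sm_line_S with f.
Qed.

Lemma derivable_pt_lim_affine (f f' : R -> R) a b t :
  (forall t, derivable_pt_lim f t (f' t)) ->
  derivable_pt_lim (fun t => f (a * t + b)) t (a * f' (a * t + b)).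
Proof.
  intros H; apply is_derive_Reals.
  assert (H1 : is_derive f (a * t + b) (f' (a * t + b))) by now apply is_derive_Reals.
  assert (H2 : is_derive (fun t => a * t + b) t a) by (auto_derive; [auto|ring]).
  exact (is_derive_comp f (fun t => a * t + b) t _ _ H1 H2).
Qed.

Lemma MVT_le (f f' : R -> R) a b m :
  a <= b -> (forall t, derivable_pt_lim f t (f' t)) ->
  (forall t, a <= t <= b -> m <= f' t) -> m * (b - a) <= f b - f a.
Proof.
  intros [H| ->] Hd Hm; [|lra].
  destruct (MVT_cor2 f f' a b H) as [c [E Hc]]; [intros; apply Hd|].
  rewrite E; apply Rmult_le_compat_r; [lra|apply Hm; lra].
Qed.

Lemma derive_zero_const (f f' : R -> R) a b :
  a <= b -> (forall t, derivable_pt_lim f t (f' t)) ->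
  (forall t, a <= t <= b -> f' t = 0) -> f b = f a.
Proof.
  intros H Hd Hm.
  assert (H1 := MVT_le f f' a b 0 H Hd (fun t Ht => Req_le _ _ (eq_sym (Hm t Ht)))).
  assert (H2 := MVT_le (fun t => - f t) (fun t => - f' t) a b 0 H
    (fun t => derivable_pt_lim_opp f t _ (Hd t))
    (fun t Ht => Req_le _ _ (eq_sym (eq_trans (f_equal Ropp (Hm t Ht)) Ropp_0)))).
  simpl in H2; lra.
Qed.

Lemma flat0_le1 t : flat 0 t <= 1.
Proof.
  unfold flat; destruct (Rle_dec t 0); [lra|]; simpl; rewrite Rmult_1_l, <- exp_0.
  left; apply exp_increasing; assert (0 < / t) by (apply Rinv_0_lt_compat; lra); lra.
Qed.

Lemma flat0_der t : derivable_pt_lim (flat 0) t (flat 2 t).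
Proof. replace (flat 2 t) with (flat 2 t - INR 0 * flat 1 t) by (simpl; ring); apply flat_der. Qed.

Lemma flat0_shift_der a t : derivable_pt_lim (fun t => flat 0 (t - a)) t (flat 2 (t - a)).
Proof.
  assert (H := derivable_pt_lim_affine (flat 0) (flat 2) 1 (- a) t flat0_der).
  replace (fun t => flat 0 (t - a)) with (fun t => flat 0 (1 * t + - a))
    by (apply functional_extensionality; intros; f_equal; ring).
  replace (flat 2 (t - a)) with (1 * flat 2 (1 * t + - a)) by (rewrite Rmult_1_l; f_equal; ring).
  exact H.
Qed.

Lemma Sm_flat_shift n a k : @Sm line k (fun t => flat n (t - a)).
Proof.
  replace (fun t : line => flat n (t - a)) with (fun t : line => flat n (1 * t + - a))
    by (apply functional_extensionality; intros; f_equal; ring).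
  apply Sm_line_affine, Sm_flat.
Qed.

(** Take [h1 t = flat 0 (t - / 2) / t]. Then [t * h1 t] is at most [1], which gives logarithmic
    growth, and [h1 + t * h2], the coefficient in the Levi form of [h (|x|^2)], is the derivative of
    [t * h1 t], hence nonnegative. It is bounded below on [[1, 2]], where the cutoff varies. The
    growth is stated with an eighth power because [|s| <= mu^2] on the cusp means
    [|x|^2 = |s|^4 <= mu^8]. *)
Lemma truncated_log_exists : exists h h1 h2 : R -> R,
  (forall k, @Sm line k h) /\
  (forall t, derivable_pt_lim h t (h1 t)) /\ (forall t, derivable_pt_lim h1 t (h2 t)) /\
  (forall t, t <= / 2 -> h t = 0) /\ (forall t, 0 <= h t) /\
  (forall t, 0 <= h1 t + t * h2 t) /\
  (exists e, 0 < e /\ forall t, 1 <= t <= 2 -> e <= h1 t + t * h2 t) /\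
  (forall t s, 0 <= s -> t <= s ^ 8 -> h t <= 16 * s).
Proof.
  set (h1 := fun t => flat 0 (t - / 2) / t).
  assert (H0 : forall t, t <= / 2 -> flat 0 (t - / 2) = 0) by (intros; apply flat_eq0; lra).
  assert (S1 : forall k, @Sm line k h1)
    by (intros; apply Sm_line_div; [easy|apply Sm_flat_shift]).
  destruct (Sm_primitive h1 (/ 2) S1) as [h [Ha [Dh Sh]]].
  destruct (Sm_line_der 0 _ (S1 1%nat)) as [h2 [Dh1 _]].
  assert (Z1 : forall t, t <= / 2 -> h1 t = 0)
    by (intros t Ht; unfold h1; rewrite H0 by easy; unfold Rdiv; ring).
  assert (E1 : forall t, t * h1 t = flat 0 (t - / 2)).
  { intros t; destruct (Req_dec t 0) as [->|Ht]; [rewrite H0; lra|unfold h1; field; easy]. }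
  assert (P1 : forall t, 0 <= h1 t).
  { intros t; destruct (Rle_dec t (/ 2)); [rewrite Z1; lra|].
    unfold h1; apply Rdiv_le_0_compat; [apply flat_nonneg|lra]. }
  assert (Z : forall t, t <= / 2 -> h t = 0).
  { intros t Ht; rewrite <- Ha; symmetry; apply (derive_zero_const h h1); auto; intros; apply Z1; lra. }
  assert (E2 : forall t, h1 t + t * h2 t = flat 2 (t - / 2)).
  { intros t; apply (uniqueness_limite (fun t => t * h1 t) t).
    - replace (h1 t + t * h2 t) with (1 * h1 t + t * h2 t) by ring.
      apply (derivable_pt_lim_mult id h1); [apply derivable_pt_lim_id|apply Dh1].
    - replace (fun t => t * h1 t) with (fun t => flat 0 (t - / 2))
        by (apply functional_extensionality; intros; now rewrite E1).
      apply flat0_shift_der. }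
  exists h, h1, h2; repeat split; auto.
  - intros t; destruct (Rle_dec t (/ 2)); [rewrite Z; lra|].
    assert (H := MVT_le h h1 (/ 2) t 0 ltac:(lra) Dh (fun x _ => P1 x)); lra.
  - intros t; rewrite E2; apply flat_nonneg.
  - exists ((/ 2) ^ 2 * exp (- 2)); split; [apply Rmult_lt_0_compat; [lra|apply exp_pos]|].
    intros t Ht; rewrite E2; unfold flat; destruct (Rle_dec (t - / 2) 0); [lra|].
    assert (/ (t - / 2) <= 2) by (rewrite <- (Rinv_inv 2); apply Rinv_le_contravar; lra).
    assert (/ 2 <= / (t - / 2)) by (apply Rinv_le_contravar; lra).
    apply Rmult_le_compat; [lra|left; apply exp_pos|apply pow_incr; lra|].
    destruct (Req_dec (- 2) (- / (t - / 2))) as [<-|]; [lra|].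
    left; apply exp_increasing; lra.
  - intros t s Hs Ht.
    assert (Hm : h t <= h (s ^ 8)).
    { assert (H := MVT_le h h1 t (s ^ 8) 0 Ht Dh (fun x _ => P1 x)); lra. }
    (* Origin of the constant 16: [s^8 * h1 (s^8) <= 1], and [h1 (s^8)] vanishes unless [s > / 2],
       so [8 * s^7 * h1 (s^8) <= 8 / s < 16]. *)
    assert (D8 : forall s, derivable_pt_lim (fun s => 16 * s - h (s ^ 8)) s (16 - h1 (s ^ 8) * (8 * s ^ 7))).
    { intros x.
      apply (derivable_pt_lim_minus (fun s => 16 * s) (fun s => h (s ^ 8))).
      - apply is_derive_Reals; auto_derive; [auto|ring].
      - apply (derivable_pt_lim_comp (fun s => s ^ 8) h); [|apply Dh].
        apply is_derive_Reals; auto_derive; [auto|ring]. }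
    assert (H := MVT_le _ _ 0 s 0 Hs D8).
    cbv beta in H; rewrite (Z (0 ^ 8)) in H by (simpl; lra).
    enough (forall x, 0 <= x <= s -> 0 <= 16 - h1 (x ^ 8) * (8 * x ^ 7)) by (specialize (H H1); lra).
    intros x [Hx _].
    destruct (Rle_dec (x ^ 8) (/ 2)) as [H8|H8]; [rewrite Z1 by easy; lra|].
    assert (Hx2 : / 2 < x).
    { apply Rnot_le_lt; intros Hx2; apply H8.
      apply Rle_trans with ((/ 2) ^ 8); [apply pow_incr; lra|simpl; lra]. }
    assert (H9 := E1 (x ^ 8)); assert (H10 := flat0_le1 (x ^ 8 - / 2)).
    assert (H11 := P1 (x ^ 8)).
    assert (H12 : 0 <= x ^ 7) by (apply pow_le; lra).
    replace (x ^ 8) with (x * x ^ 7) in H9 at 1 by (simpl; ring).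
    assert (0 <= x ^ 7 * h1 (x ^ 8)) by now apply Rmult_le_pos.
    nra.
Qed.

(** [t * kap t] is a smooth step from [0] to [1] on [[1, 2]]. As [conj x / |x|^2 = 1 / x], the
    product [Re (y * conj x) * kap (|x|^2)] is the cut-off version of [Re (y / x)]. The last two
    clauses concern the first and second derivative of the step, the only quantities that enter its
    Levi form. *)
Lemma smooth_cutoff_exists : exists kap kap1 kap2 : R -> R,
  (forall k, @Sm line k kap) /\
  (forall t, derivable_pt_lim kap t (kap1 t)) /\ (forall t, derivable_pt_lim kap1 t (kap2 t)) /\
  (forall t, t <= 1 -> kap t = 0) /\ (forall t, 2 <= t -> t * kap t = 1) /\
  (forall t, 0 <= t * kap t <= 1) /\
  (forall t, ~ 1 <= t <= 2 -> kap t + t * kap1 t = 0 /\ 2 * kap1 t + t * kap2 t = 0) /\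
  (exists B, 0 <= B /\ forall t, Rabs (kap t + t * kap1 t) <= B /\ Rabs (2 * kap1 t + t * kap2 t) <= B).
Proof.
  (* A bump supported in [[1, 2]]; its primitive divided by its total mass is the step. *)
  set (b := fun t => flat 0 (t - 1) * flat 0 (-1 * t + 2)).
  set (b1 := fun t => flat 2 (t - 1) * flat 0 (-1 * t + 2) + flat 0 (t - 1) * (-1 * flat 2 (-1 * t + 2))).
  assert (Sb : forall k, @Sm line k b).
  { intros k; apply (@Sm_mult line); [apply Sm_flat_shift|apply Sm_line_affine, Sm_flat]. }
  assert (Db : forall t, derivable_pt_lim b t (b1 t)).
  { intros t; apply (derivable_pt_lim_mult (fun t => flat 0 (t - 1)) (fun t => flat 0 (-1 * t + 2))).
    - apply flat0_shift_der.
    - apply (derivable_pt_lim_affine (flat 0) (flat 2)), flat0_der. }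
  assert (Pb : forall t, 0 <= b t) by (intros; apply Rmult_le_pos; apply flat_nonneg).
  assert (Zb : forall t, ~ 1 < t < 2 -> b t = 0 /\ b1 t = 0).
  { intros t Ht; unfold b, b1; destruct (Rle_dec t 1).
    - rewrite !(flat_eq0 _ (t - 1)) by lra; split; ring.
    - rewrite !(flat_eq0 _ (-1 * t + 2)) by lra; split; ring. }
  destruct (Sm_primitive b 1 Sb) as [F [F1 [DF SF]]].
  assert (FI : 0 < F 2).
  { destruct (MVT_cor2 F b 1 2) as [c [E Hc]]; [lra|intros; apply DF|].
    rewrite F1 in E; assert (0 < b c) by (apply Rmult_lt_0_compat; apply flat_pos; lra); lra. }
  set (I := F 2) in *.
  assert (FZ : forall t, t <= 1 -> F t = 0).
  { intros t Ht; rewrite <- F1; symmetry; apply (derive_zero_const F b); auto.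
    intros; apply Zb; lra. }
  assert (FO : forall t, 2 <= t -> F t = I).
  { intros t Ht; apply (derive_zero_const F b); auto; intros; apply Zb; lra. }
  assert (Fm : forall s t, s <= t -> F s <= F t).
  { intros s t Hst; assert (H := MVT_le F b s t 0 Hst DF (fun x _ => Pb x)); lra. }
  assert (Fb : forall t, 0 <= F t <= I).
  { intros t; destruct (Rle_dec t 1); [rewrite FZ; lra|]; destruct (Rle_dec 2 t); [rewrite FO; lra|].
    split; [rewrite <- F1|]; apply Fm; lra. }
  set (c := fun t => / I * F t).
  assert (Sc : forall k, @Sm line k (fun t => c t / t)).
  { intros k; apply Sm_line_div; [|apply (@Sm_scal line), SF].
    intros; unfold c; rewrite FZ by lra; ring. }
  set (kap := fun t => c t / t) in *.
  destruct (Sm_line_der 1 _ (Sc 2%nat)) as [kap1 [D1 S1]].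
  destruct (Sm_line_der 0 _ S1) as [kap2 [D2 _]].
  assert (E : forall t, t * kap t = / I * F t).
  { intros t; unfold kap, c; destruct (Req_dec t 0) as [->|]; [rewrite FZ by lra; ring|field; lra]. }
  assert (E1 : forall t, kap t + t * kap1 t = / I * b t).
  { intros t; apply (uniqueness_limite (fun t => t * kap t) t).
    - replace (kap t + t * kap1 t) with (1 * kap t + t * kap1 t) by ring.
      apply (derivable_pt_lim_mult id kap); [apply derivable_pt_lim_id|apply D1].
    - replace (fun t => t * kap t) with (fun t => / I * F t)
        by (apply functional_extensionality; intros; now rewrite E).
      apply derivable_pt_lim_scal, DF. }
  assert (E2 : forall t, 2 * kap1 t + t * kap2 t = / I * b1 t).
  { intros t; apply (uniqueness_limite (fun t => kap t + t * kap1 t) t).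
    - replace (2 * kap1 t + t * kap2 t) with (kap1 t + (1 * kap1 t + t * kap2 t)) by ring.
      apply (derivable_pt_lim_plus kap (fun t => t * kap1 t)); [apply D1|].
      apply (derivable_pt_lim_mult id kap1); [apply derivable_pt_lim_id|apply D2].
    - replace (fun t => kap t + t * kap1 t) with (fun t => / I * b t)
        by (apply functional_extensionality; intros; now rewrite E1).
      apply derivable_pt_lim_scal, Db. }
  exists kap, kap1, kap2; split; [exact Sc|]; do 2 (split; [assumption|]).
  split; [|split; [|split; [|split]]].
  - intros t Ht; unfold kap, c; rewrite FZ by easy; unfold Rdiv; ring.
  - intros t Ht; rewrite E, FO by easy; field; lra.
  - intros t; rewrite E; destruct (Fb t); split.
    + apply Rmult_le_pos; [left; now apply Rinv_0_lt_compat|easy].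
    + apply Rmult_le_reg_l with I; [easy|]; rewrite <- Rmult_assoc, Rinv_r by lra; lra.
  - intros t Ht; rewrite E1, E2; destruct (Zb t) as [-> ->]; [lra|]; split; ring.
  - destruct (flat_bound 2) as [A [HA HB]]; exists (/ I * (1 + 2 * A)).
    assert (HI : 0 < / I) by now apply Rinv_0_lt_compat.
    split; [apply Rmult_le_pos; lra|]; intros t; rewrite E1, E2, !Rabs_mult, (Rabs_pos_eq (/ I)) by lra.
    assert (Q1 := flat0_le1 (t - 1)); assert (Q2 := flat0_le1 (-1 * t + 2)).
    assert (Q3 := flat_nonneg 0 (t - 1)); assert (Q4 := flat_nonneg 0 (-1 * t + 2)).
    assert (Q5 := flat_nonneg 2 (t - 1)); assert (Q6 := flat_nonneg 2 (-1 * t + 2)).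
    assert (Q7 := HB (t - 1)); assert (Q8 := HB (-1 * t + 2)).
    assert (0 <= flat 2 (t - 1) * flat 0 (-1 * t + 2) <= A) by nra.
    assert (0 <= flat 0 (t - 1) * flat 2 (-1 * t + 2) <= A) by nra.
    assert (0 <= b t <= 1) by (unfold b; nra).
    split; apply Rmult_le_compat_l; try lra; apply Rabs_le; unfold b1; lra.
Qed.

(** [chi] vanishes near [0] so that the discs do not feel it, is convex and increasing so that
    [chi (|z|^2)] is plurisubharmonic, and grows linearly so that the domain is bounded. The
    inequalities between [chi] and [chi1] serve the nonvanishing gradient and connectedness. *)
Lemma convex_growth_exists : exists chi chi1 chi2 : R -> R,
  (forall k, @Sm line k chi) /\
  (forall t, derivable_pt_lim chi t (chi1 t)) /\ (forall t, derivable_pt_lim chi1 t (chi2 t)) /\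
  (forall t, t <= / 4 -> chi t = 0) /\ (forall t, 0 <= chi t) /\
  (forall t, 0 <= chi1 t) /\ (forall t, 0 <= chi2 t) /\
  (forall t, t - 5 / 4 <= chi t) /\
  (forall t, 0 <= t -> chi t <= t * chi1 t) /\
  (forall s t, s <= t -> chi1 s * (t - s) <= chi t - chi s).
Proof.
  (* The factor 3 makes the slope at least [3 * exp (-1) >= 1] from [5 / 4] on, whence
     [t - 5 / 4 <= chi t]. *)
  set (chi1 := fun t => 3 * flat 0 (t - / 4)).
  assert (S1 : forall k, @Sm line k chi1) by (intros; apply (@Sm_scal line), Sm_flat_shift).
  destruct (Sm_primitive chi1 (/ 4) S1) as [chi [Z [D S]]].
  assert (D1 : forall t, derivable_pt_lim chi1 t (3 * flat 2 (t - / 4)))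
    by (intros; apply derivable_pt_lim_scal, flat0_shift_der).
  assert (P1 : forall t, 0 <= chi1 t) by (intros t; assert (H := flat_nonneg 0 (t - / 4)); unfold chi1; lra).
  assert (P2 : forall t, 0 <= 3 * flat 2 (t - / 4)) by (intros t; assert (H := flat_nonneg 2 (t - / 4)); lra).
  assert (Z0 : forall t, t <= / 4 -> chi t = 0).
  { intros t Ht; rewrite <- Z; symmetry; apply (derive_zero_const chi chi1); auto.
    intros x Hx; unfold chi1; rewrite flat_eq0; lra. }
  assert (Cv : forall s t, s <= t -> chi1 s * (t - s) <= chi t - chi s).
  { intros s t Hst; apply (MVT_le chi chi1); auto; intros x Hx.
    assert (H := MVT_le chi1 _ s x 0 (proj1 Hx) D1 (fun y _ => P2 y)); lra. }
  assert (P0 : forall t, 0 <= chi t).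
  { intros t; destruct (Rle_dec t (/ 4)); [rewrite Z0; lra|].
    assert (H := MVT_le chi chi1 (/ 4) t 0 ltac:(lra) D (fun y _ => P1 y)); lra. }
  exists chi, chi1, (fun t => 3 * flat 2 (t - / 4)); repeat (split; [assumption|]); split; [|split; [|exact Cv]].
  - intros t; destruct (Rle_dec t (5 / 4)); [assert (H := P0 t); lra|].
    assert (H := Cv (5 / 4) t ltac:(lra)); assert (H1 := P0 (5 / 4)).
    assert (1 <= chi1 (5 / 4)).
    { unfold chi1, flat; destruct (Rle_dec (5 / 4 - / 4) 0); [lra|].
      replace (5 / 4 - / 4) with 1 by field; rewrite Rinv_1; simpl.
      assert (H2 := exp_le_3); assert (H3 := exp_pos 1); rewrite exp_Ropp.
      assert (/ 3 <= / exp 1) by (apply Rinv_le_contravar; lra); lra. }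
    nra.
  - intros t Ht; destruct (Rle_dec t (/ 4)) as [H|H].
    + rewrite Z0 by easy; now apply Rmult_le_pos.
    + assert (H2 : chi t - chi (/ 4) <= chi1 t * (t - / 4)).
      { assert (H2 := MVT_le (fun x => - chi x) (fun x => - chi1 x) (/ 4) t (- chi1 t) ltac:(lra)
          (fun x => derivable_pt_lim_opp chi x _ (D x))).
        cbv beta in H2; enough (forall x, / 4 <= x <= t -> - chi1 t <= - chi1 x) by (specialize (H2 H0); lra).
        intros x Hx; assert (H3 := MVT_le chi1 _ x t 0 (proj2 Hx) D1 (fun y _ => P2 y)); lra. }
      rewrite Z in H2; assert (H3 := P1 t); nra.
Qed.

(** * Second-order jets and the Levi form *)

(** Value, gradient and Hessian as plain data: derivatives of an explicit function are computed
    algebraically on jets, and its Levi form becomes a matter of [ring] and [field]. *)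
Record jet := Jet { jv : R; jg : nat -> R; jh : nat -> nat -> R }.

Definition is_jet (f : C3 -> R) (J : C3 -> jet) : Prop :=
  (forall z, f z = jv (J z)) /\
  (forall z j, (j < 6)%nat -> has_partial f j z (jg (J z) j)) /\
  (forall z j k, (j < 6)%nat -> (k < 6)%nat ->
     has_partial (fun y => jg (J y) k) j z (jh (J z) j k)).

Definition jconst (c : R) : jet := Jet c (fun _ => 0) (fun _ _ => 0).
Definition jcrd (i : nat) (z : C3) : jet :=
  Jet (crd i z) (fun j => if Nat.eqb i j then 1 else 0) (fun _ _ => 0).
Definition jadd (J K : jet) : jet :=
  Jet (jv J + jv K) (fun j => jg J j + jg K j) (fun j k => jh J j k + jh K j k).
Definition jmul (J K : jet) : jet :=
  Jet (jv J * jv K) (fun j => jg J j * jv K + jv J * jg K j)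
    (fun j k => jh J j k * jv K + jg J k * jg K j + (jg J j * jg K k + jv J * jh K j k)).
Definition jcomp (h h1 h2 : R -> R) (J : jet) : jet :=
  Jet (h (jv J)) (fun j => h1 (jv J) * jg J j)
    (fun j k => h2 (jv J) * jg J j * jg J k + h1 (jv J) * jh J j k).

Lemma is_jet_const c : is_jet (fun _ => c) (fun _ => jconst c).
Proof. split; [|split]; intros; [reflexivity|apply (@has_der_const Cspace c)|apply (@has_der_const Cspace 0)]. Qed.

Lemma is_jet_crd i : (i < 6)%nat -> is_jet (crd i) (jcrd i).
Proof.
  intros Hi; split; [|split]; intros.
  - reflexivity.
  - now apply has_der_crd.
  - exact (@has_der_const Cspace (if Nat.eqb i k then 1 else 0) j z).
Qed.

Lemma is_jet_add f g J K :
  is_jet f J -> is_jet g K -> is_jet (fun z => f z + g z) (fun z => jadd (J z) (K z)).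
Proof.
  intros [Ef [Df Hf]] [Eg [Dg Hg]]; split; [|split]; intros; simpl.
  - now rewrite Ef, Eg.
  - apply (@has_der_plus Cspace); [apply Df|apply Dg]; auto.
  - apply (@has_der_plus Cspace); [apply Hf|apply Hg]; auto.
Qed.

Lemma is_jet_mul f g J K :
  is_jet f J -> is_jet g K -> is_jet (fun z => f z * g z) (fun z => jmul (J z) (K z)).
Proof.
  intros [Ef [Df Hf]] [Eg [Dg Hg]].
  replace f with (fun z => jv (J z)) in * by (apply functional_extensionality; intros; now rewrite Ef).
  replace g with (fun z => jv (K z)) in * by (apply functional_extensionality; intros; now rewrite Eg).
  split; [|split]; intros; simpl.
  - reflexivity.
  - apply (@has_der_mult Cspace); [apply Df|apply Dg]; auto.
  - apply (@has_der_plus Cspace); apply (@has_der_mult Cspace);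
      first [apply Df|apply Dg|apply Hf|apply Hg]; auto.
Qed.

Lemma is_jet_comp (h h1 h2 : R -> R) f J :
  (forall t, derivable_pt_lim h t (h1 t)) -> (forall t, derivable_pt_lim h1 t (h2 t)) ->
  is_jet f J -> is_jet (fun z => h (f z)) (fun z => jcomp h h1 h2 (J z)).
Proof.
  intros D1 D2 [Ef [Df Hf]].
  replace f with (fun z => jv (J z)) in * by (apply functional_extensionality; intros; now rewrite Ef).
  split; [|split]; intros; simpl.
  - reflexivity.
  - apply (@has_der_comp Cspace h); [auto|now apply Df].
  - apply (@has_der_mult Cspace (fun y => h1 (jv (J y))) (fun y => jg (J y) k)); [|now apply Hf].
    apply (@has_der_comp Cspace h1 (fun y => jv (J y))); [auto|now apply Df].
Qed.

Definition lev (d : nat -> nat -> R) (v : C3) : R :=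
  fst (Csum3 (fun j => Csum3 (fun k =>
    Cmul (dzdzbar d j k) (Cmul (comp v j) (Cconj (comp v k)))))).

(** Real and imaginary part of [2 * sum_j (df/dz_j) v_j]. *)
Definition dre (g : nat -> R) (v : C3) : R :=
  g 0%nat * crd 0 v + g 1%nat * crd 1 v + g 2%nat * crd 2 v + g 3%nat * crd 3 v
  + g 4%nat * crd 4 v + g 5%nat * crd 5 v.
Definition dim (g : nat -> R) (v : C3) : R :=
  g 0%nat * crd 1 v - g 1%nat * crd 0 v + g 2%nat * crd 3 v - g 3%nat * crd 2 v
  + g 4%nat * crd 5 v - g 5%nat * crd 4 v.

Ltac lev_ring :=
  intros; match goal with v : C3 |- _ => destruct v as [[[? ?] [? ?]] [? ?]] end;
  unfold lev, dre, dim, dzdzbar, Csum3, Cmul, Cadd, Cconj, jadd, jmul, jcomp; simpl; field.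

Lemma lev_const c v : lev (jh (jconst c)) v = 0.
Proof. lev_ring. Qed.
Lemma lev_crd i z v : lev (jh (jcrd i z)) v = 0.
Proof. lev_ring. Qed.
Lemma lev_add J K v : lev (jh (jadd J K)) v = lev (jh J) v + lev (jh K) v.
Proof. lev_ring. Qed.
(** The mixed term is [2 * Re (df(v) * conj (dg(v)))] for the holomorphic differentials, since [dre]
    and [dim] carry a factor 2; the same factor explains the [/ 4] in [lev_comp]. *)
Lemma lev_mul J K v : lev (jh (jmul J K)) v =
  lev (jh J) v * jv K + jv J * lev (jh K) v
  + / 2 * (dre (jg J) v * dre (jg K) v + dim (jg J) v * dim (jg K) v).
Proof. lev_ring. Qed.
Lemma lev_comp h h1 h2 J v : lev (jh (jcomp h h1 h2 J)) v =
  h1 (jv J) * lev (jh J) v + h2 (jv J) * (/ 4 * (dre (jg J) v ^ 2 + dim (jg J) v ^ 2)).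
Proof. lev_ring. Qed.

Lemma dre_const c v : dre (jg (jconst c)) v = 0.
Proof. unfold dre; simpl; ring. Qed.
Lemma dim_const c v : dim (jg (jconst c)) v = 0.
Proof. unfold dim; simpl; ring. Qed.
Lemma dre_add J K v : dre (jg (jadd J K)) v = dre (jg J) v + dre (jg K) v.
Proof. unfold dre; simpl; ring. Qed.
Lemma dim_add J K v : dim (jg (jadd J K)) v = dim (jg J) v + dim (jg K) v.
Proof. unfold dim; simpl; ring. Qed.
Lemma dre_mul J K v : dre (jg (jmul J K)) v = dre (jg J) v * jv K + jv J * dre (jg K) v.
Proof. unfold dre; simpl; ring. Qed.
Lemma dim_mul J K v : dim (jg (jmul J K)) v = dim (jg J) v * jv K + jv J * dim (jg K) v.
Proof. unfold dim; simpl; ring. Qed.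
Lemma dre_comp h h1 h2 J v : dre (jg (jcomp h h1 h2 J)) v = h1 (jv J) * dre (jg J) v.
Proof. unfold dre; simpl; ring. Qed.
Lemma dim_comp h h1 h2 J v : dim (jg (jcomp h h1 h2 J)) v = h1 (jv J) * dim (jg J) v.
Proof. unfold dim; simpl; ring. Qed.

Lemma lev_ext (d d' : nat -> nat -> R) v :
  (forall j k, (j < 6)%nat -> (k < 6)%nat -> d j k = d' j k) -> lev d v = lev d' v.
Proof.
  intros H; unfold lev, Csum3, dzdzbar; simpl; now rewrite !H by lia.
Qed.

Definition psh_jet (f : C3 -> R) : Prop :=
  exists J, is_jet f J /\ forall z v, 0 <= lev (jh (J z)) v.

Lemma psh_jet_add f g : psh_jet f -> psh_jet g -> psh_jet (fun z => f z + g z).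
Proof.
  intros [J [HJ PJ]] [K [HK PK]]; exists (fun z => jadd (J z) (K z)); split.
  - now apply is_jet_add.
  - intros z v; rewrite lev_add; specialize (PJ z v); specialize (PK z v); lra.
Qed.

(** The first derivative inside [has_second_partial] is existential; uniqueness of limits identifies
    it with the gradient of the jet, so any second partials yield the same Levi form. *)
Lemma psh_jet_second_partials f z (d2 : nat -> nat -> R) v :
  psh_jet f ->
  (forall j k, (j < 6)%nat -> (k < 6)%nat -> has_second_partial f j k z (d2 j k)) ->
  0 <= lev d2 v.
Proof.
  intros [J [[_ [D1 D2]] HP]] H.
  rewrite (lev_ext _ (jh (J z))); [apply HP|]; intros j k Hj Hk.
  destruct (H j k Hj Hk) as [g [Hg Hd]].
  replace g with (fun y => jg (J y) k) in Hd.
  - exact (uniqueness_limite _ _ _ _ Hd (D2 z j k Hj Hk)).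
  - apply functional_extensionality; intros y; exact (uniqueness_limite _ _ _ _ (D1 y k Hk) (Hg y)).
Qed.

(** * The model plurisubharmonic function *)

Definition jx2 (z : C3) : jet := jadd (jmul (jcrd 0 z) (jcrd 0 z)) (jmul (jcrd 1 z) (jcrd 1 z)).
Definition jy2 (z : C3) : jet := jadd (jmul (jcrd 2 z) (jcrd 2 z)) (jmul (jcrd 3 z) (jcrd 3 z)).
(** Real and imaginary part of [y^2 - x^3]. *)
Definition jq1 (z : C3) : jet :=
  jadd (jadd (jmul (jcrd 2 z) (jcrd 2 z)) (jmul (jconst (-1)) (jmul (jcrd 3 z) (jcrd 3 z))))
    (jadd (jmul (jconst (-1)) (jmul (jcrd 0 z) (jmul (jcrd 0 z) (jcrd 0 z))))
       (jmul (jconst 3) (jmul (jcrd 0 z) (jmul (jcrd 1 z) (jcrd 1 z))))).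
Definition jq2 (z : C3) : jet :=
  jadd (jmul (jconst 2) (jmul (jcrd 2 z) (jcrd 3 z)))
    (jadd (jmul (jconst (-3)) (jmul (jcrd 0 z) (jmul (jcrd 0 z) (jcrd 1 z))))
       (jmul (jcrd 1 z) (jmul (jcrd 1 z) (jcrd 1 z)))).
Definition jpen (z : C3) : jet :=
  jmul (jadd (jmul (jq1 z) (jq1 z)) (jmul (jq2 z) (jq2 z)))
    (jadd (jconst 1) (jadd (jx2 z) (jy2 z))).
(** [Re (y * conj x)]. *)
Definition jxy (z : C3) : jet :=
  jadd (jmul (jcrd 2 z) (jcrd 0 z)) (jmul (jcrd 3 z) (jcrd 1 z)).

Ltac is_jet_tac :=
  repeat first [ apply is_jet_const | apply is_jet_crd; lia | apply is_jet_add | apply is_jet_mul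
               | apply is_jet_comp; [assumption|assumption|] ].

Hint Rewrite lev_const lev_crd lev_add lev_mul lev_comp dre_const dim_const dre_add dim_add
  dre_mul dim_mul dre_comp dim_comp : jet.

Lemma dre_crd z v : dre (jg (jcrd 0 z)) v = crd 0 v /\ dre (jg (jcrd 1 z)) v = crd 1 v /\
  dre (jg (jcrd 2 z)) v = crd 2 v /\ dre (jg (jcrd 3 z)) v = crd 3 v.
Proof. unfold dre; simpl jg; repeat split; simpl Nat.eqb; cbv iota; ring. Qed.
Lemma dim_crd z v : dim (jg (jcrd 0 z)) v = crd 1 v /\ dim (jg (jcrd 1 z)) v = - crd 0 v /\
  dim (jg (jcrd 2 z)) v = crd 3 v /\ dim (jg (jcrd 3 z)) v = - crd 2 v.
Proof. unfold dim; simpl jg; repeat split; simpl Nat.eqb; cbv iota; ring. Qed.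

Ltac jet_simpl z v :=
  autorewrite with jet;
  let H := fresh in pose proof (dre_crd z v) as H;
  let H' := fresh in pose proof (dim_crd z v) as H';
  rewrite ?(proj1 H), ?(proj1 (proj2 H)), ?(proj1 (proj2 (proj2 H))), ?(proj2 (proj2 (proj2 H))),
    ?(proj1 H'), ?(proj1 (proj2 H')), ?(proj1 (proj2 (proj2 H'))), ?(proj2 (proj2 (proj2 H')));
  clear H H';
  cbn [jv jconst jadd jmul jcrd jcomp].

(** The differential of [|x|^2] at [v] has squared modulus [|x|^2 * |v_1|^2], which produces the
    factor in front of [h2]. The coefficient is the derivative of [t * h1 t], zero for the
    logarithm. *)
Lemma lev_jx2_comp h h1 h2 z v : lev (jh (jcomp h h1 h2 (jx2 z))) v =
  (h1 (jv (jx2 z)) + jv (jx2 z) * h2 (jv (jx2 z))) * (crd 0 v ^ 2 + crd 1 v ^ 2).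
Proof.
  set (R := jv (jx2 z)); assert (E : R = crd 0 z * crd 0 z + crd 1 z * crd 1 z) by reflexivity.
  rewrite lev_comp; fold R; unfold jx2; jet_simpl z v; rewrite E; field.
Qed.

(** Away from [x = 0] the function is the pluriharmonic [Re (y / x)] times [t * h t] at [t = |x|^2];
    hence only the first and second derivative of [t * h t] appear. *)
Lemma lev_jxy_comp h h1 h2 z v :
  lev (jh (jmul (jxy z) (jcomp h h1 h2 (jx2 z)))) v =
  (h (jv (jx2 z)) + jv (jx2 z) * h1 (jv (jx2 z))) * (crd 2 v * crd 0 v + crd 3 v * crd 1 v)
  + jv (jxy z) * (2 * h1 (jv (jx2 z)) + jv (jx2 z) * h2 (jv (jx2 z))) * (crd 0 v ^ 2 + crd 1 v ^ 2).
Proof.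
  rewrite lev_mul, dre_comp, dim_comp, lev_jx2_comp.
  set (R := jv (jx2 z)); assert (E : R = crd 0 z * crd 0 z + crd 1 z * crd 1 z) by reflexivity.
  change (jv (jcomp h h1 h2 (jx2 z))) with (h R).
  unfold jxy, jx2; jet_simpl z v; rewrite E; field.
Qed.

(** The Levi form of [|F|^2] is [|dF(v)|^2]; here [F] ranges over [Q], [x Q], [y Q]
    with [Q = y^2 - x^3], and [A1 + i A2 = dQ(v)]. *)
Lemma lev_jpen z v :
  let a := crd 0 z in let b := crd 1 z in let p := crd 2 z in let q := crd 3 z in
  let v1 := crd 0 v in let v2 := crd 1 v in let w1 := crd 2 v in let w2 := crd 3 v in
  let Q1 := jv (jq1 z) in let Q2 := jv (jq2 z) in
  let A1 := 2 * (p * w1 - q * w2) - 3 * ((a ^ 2 - b ^ 2) * v1 - 2 * a * b * v2) in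
  let A2 := 2 * (p * w2 + q * w1) - 3 * ((a ^ 2 - b ^ 2) * v2 + 2 * a * b * v1) in
  lev (jh (jpen z)) v = A1 ^ 2 + A2 ^ 2
    + ((a * A1 - b * A2 + (Q1 * v1 - Q2 * v2)) ^ 2 + (a * A2 + b * A1 + (Q1 * v2 + Q2 * v1)) ^ 2)
    + ((p * A1 - q * A2 + (Q1 * w1 - Q2 * w2)) ^ 2 + (p * A2 + q * A1 + (Q1 * w2 + Q2 * w1)) ^ 2).
Proof.
  intros; unfold jpen, jx2, jy2, jq1, jq2; jet_simpl z v.
  subst Q1 Q2 A1 A2; unfold jq1, jq2; cbn [jv jconst jadd jmul jcrd].
  subst a b p q v1 v2 w1 w2; field.
Qed.

Lemma sq_sum_le (x y : R) : (x + y) ^ 2 <= 2 * x ^ 2 + 2 * y ^ 2.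
Proof. assert (H := pow2_ge_0 (x - y)); nra. Qed.

(** [S] is the Levi form of the penalty term; off the curve it controls [v] because
    [Q v = (x dQ(v) + Q v_1, y dQ(v) + Q v_2) - dQ(v) (x, y)], near the curve [|y|] is bounded
    below and [dQ(v) = 2 y v_2 - 3 x^2 v_1] controls [v_2] modulo [v_1]. *)
Lemma penalty_controls_cross_terms (a b p q v1 v2 w1 w2 : R) :
  let Q1 := p ^ 2 - q ^ 2 - (a ^ 3 - 3 * a * b ^ 2) in
  let Q2 := 2 * p * q - (3 * a ^ 2 * b - b ^ 3) in
  let A1 := 2 * (p * w1 - q * w2) - 3 * ((a ^ 2 - b ^ 2) * v1 - 2 * a * b * v2) in
  let A2 := 2 * (p * w2 + q * w1) - 3 * ((a ^ 2 - b ^ 2) * v2 + 2 * a * b * v1) in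
  let S := A1 ^ 2 + A2 ^ 2
    + ((a * A1 - b * A2 + (Q1 * v1 - Q2 * v2)) ^ 2 + (a * A2 + b * A1 + (Q1 * v2 + Q2 * v1)) ^ 2)
    + ((p * A1 - q * A2 + (Q1 * w1 - Q2 * w2)) ^ 2 + (p * A2 + q * A1 + (Q1 * w2 + Q2 * w1)) ^ 2) in
  1 <= a ^ 2 + b ^ 2 <= 2 ->
  Rabs (p * a + q * b) * (v1 ^ 2 + v2 ^ 2) + Rabs (w1 * v1 + w2 * v2)
    <= 25 * (v1 ^ 2 + v2 ^ 2 + S).
Proof.
  intros Q1 Q2 A1 A2 S HR.
  set (n1 := v1 ^ 2 + v2 ^ 2); set (n2 := w1 ^ 2 + w2 ^ 2).
  set (R := a ^ 2 + b ^ 2) in *; set (Y := p ^ 2 + q ^ 2); set (Qn := Q1 ^ 2 + Q2 ^ 2).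
  assert (Hn1 : 0 <= n1) by (unfold n1; nra); assert (Hn2 : 0 <= n2) by (unfold n2; nra).
  assert (HY : 0 <= Y) by (unfold Y; nra).
  assert (HS : A1 ^ 2 + A2 ^ 2 <= S).
  { unfold S.
    set (X1 := a * A1 - b * A2 + (Q1 * v1 - Q2 * v2)); set (X2 := a * A2 + b * A1 + (Q1 * v2 + Q2 * v1)).
    set (X3 := p * A1 - q * A2 + (Q1 * w1 - Q2 * w2)); set (X4 := p * A2 + q * A1 + (Q1 * w2 + Q2 * w1)).
    assert (H1 := pow2_ge_0 X1); assert (H2 := pow2_ge_0 X2);
    assert (H3 := pow2_ge_0 X3); assert (H4 := pow2_ge_0 X4); lra. }
  assert (Ha : Qn * (n1 + n2) <= 2 * (1 + R + Y) * S).
  { unfold S.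
    set (X1 := a * A1 - b * A2 + (Q1 * v1 - Q2 * v2)); set (X2 := a * A2 + b * A1 + (Q1 * v2 + Q2 * v1)).
    set (X3 := p * A1 - q * A2 + (Q1 * w1 - Q2 * w2)); set (X4 := p * A2 + q * A1 + (Q1 * w2 + Q2 * w1)).
    assert (H1 := sq_sum_le X1 (- (a * A1 - b * A2))); assert (H2 := sq_sum_le X2 (- (a * A2 + b * A1))).
    assert (H3 := sq_sum_le X3 (- (p * A1 - q * A2))); assert (H4 := sq_sum_le X4 (- (p * A2 + q * A1))).
    assert (E : Qn * (n1 + n2) = (X1 + - (a * A1 - b * A2)) ^ 2 + (X2 + - (a * A2 + b * A1)) ^ 2
      + (X3 + - (p * A1 - q * A2)) ^ 2 + (X4 + - (p * A2 + q * A1)) ^ 2)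
      by (unfold Qn, n1, n2, X1, X2, X3, X4; ring).
    assert (E2 : (- (a * A1 - b * A2)) ^ 2 + (- (a * A2 + b * A1)) ^ 2
      + (- (p * A1 - q * A2)) ^ 2 + (- (p * A2 + q * A1)) ^ 2 = (R + Y) * (A1 ^ 2 + A2 ^ 2))
      by (unfold R, Y; ring).
    assert (H5 := pow2_ge_0 X1); assert (H6 := pow2_ge_0 X2);
    assert (H7 := pow2_ge_0 X3); assert (H8 := pow2_ge_0 X4).
    assert (H9 := pow2_ge_0 A1); assert (H10 := pow2_ge_0 A2).
    assert (0 <= (R + Y) * (X1 ^ 2 + X2 ^ 2 + X3 ^ 2 + X4 ^ 2)) by (apply Rmult_le_pos; lra).
    nra. }
  assert (Hb : 4 * Y * n2 <= 2 * S + 72 * n1).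
  { set (c1 := 3 * ((a ^ 2 - b ^ 2) * v1 - 2 * a * b * v2)).
    set (c2 := 3 * ((a ^ 2 - b ^ 2) * v2 + 2 * a * b * v1)).
    assert (H1 := sq_sum_le A1 c1); assert (H2 := sq_sum_le A2 c2).
    assert (E1 : 4 * Y * n2 = (A1 + c1) ^ 2 + (A2 + c2) ^ 2) by (unfold Y, n2, A1, A2, c1, c2; ring).
    assert (E2 : c1 ^ 2 + c2 ^ 2 = 9 * R ^ 2 * n1) by (unfold c1, c2, R, n1; ring).
    assert (R ^ 2 <= 4) by nra.
    assert (R ^ 2 * n1 <= 4 * n1) by (apply Rmult_le_compat_r; lra); lra. }
  assert (Hc1 : R ^ 3 <= 2 * Qn + 2 * Y ^ 2).
  { set (y1 := p ^ 2 - q ^ 2); set (y2 := 2 * p * q).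
    assert (H1 := sq_sum_le (- Q1) y1); assert (H2 := sq_sum_le (- Q2) y2).
    replace (R ^ 3) with ((- Q1 + y1) ^ 2 + (- Q2 + y2) ^ 2) by (unfold R, Q1, Q2, y1, y2; ring).
    replace (Y ^ 2) with (y1 ^ 2 + y2 ^ 2) by (unfold Y, y1, y2; ring).
    unfold Qn; nra. }
  assert (Hc2 : Y ^ 2 <= 2 * Qn + 2 * R ^ 3).
  { set (x1 := a ^ 3 - 3 * a * b ^ 2); set (x2 := 3 * a ^ 2 * b - b ^ 3).
    assert (H1 := sq_sum_le Q1 x1); assert (H2 := sq_sum_le Q2 x2).
    replace (Y ^ 2) with ((Q1 + x1) ^ 2 + (Q2 + x2) ^ 2) by (unfold Y, Q1, Q2, x1, x2; ring).
    replace (R ^ 3) with (x1 ^ 2 + x2 ^ 2) by (unfold R, x1, x2; ring).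
    unfold Qn; nra. }
  assert (HR3 : 1 <= R ^ 3 <= 8) by (split; [apply pow_R1_Rle; lra|replace 8 with (2 ^ 3) by ring; apply pow_incr; lra]).
  assert (Hm : (p * a + q * b) ^ 2 <= 2 * Y).
  { assert (H : (p * a + q * b) ^ 2 + (p * b - q * a) ^ 2 = Y * R) by (unfold Y, R; ring).
    assert (H1 := pow2_ge_0 (p * b - q * a)); nra. }
  assert (Hw : Rabs (w1 * v1 + w2 * v2) <= (n1 + n2) / 2).
  { assert (H1 := pow2_ge_0 (w1 - v1)); assert (H2 := pow2_ge_0 (w2 - v2)).
    assert (H3 := pow2_ge_0 (w1 + v1)); assert (H4 := pow2_ge_0 (w2 + v2)).
    apply Rabs_le; unfold n1, n2; split; nra. }
  assert (Hm0 := Rabs_pos (p * a + q * b)).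
  rewrite <- pow2_abs in Hm; set (m := Rabs (p * a + q * b)) in *.
  set (rw := Rabs (w1 * v1 + w2 * v2)) in *.
  assert (S0 : 0 <= S) by (assert (H1 := pow2_ge_0 A1); assert (H2 := pow2_ge_0 A2); lra).
  clearbody rw m S Qn n1 n2 Y R; clear Q1 Q2 A1 A2 v1 v2 w1 w2 a b p q HS.
  (* Since [y^2 = Q + x^3] and [|x|] is of order 1, a very small or very large [|y|] forces [|Q|] to
     be large, and [Ha] controls all of [v]. In the middle range [Y] is bounded on both sides and
     [Hb] applies. *)
  assert (HQ' : (Y <= / 2 -> / 4 <= Qn) /\ (16 <= Y -> Y ^ 2 / 4 <= Qn)) by (split; intros; nra).
  destruct (Rle_dec Y (/ 2)) as [H1|H1]; [|destruct (Rle_dec Y 16) as [H2|H2]].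
  - destruct HQ' as [HQ' _]; specialize (HQ' H1).
    assert (n1 + n2 <= 28 * S) by nra.
    assert (m <= 1) by nra; nra.
  - assert (H3 : n2 <= S + 36 * n1) by nra.
    assert (m <= 6) by nra; nra.
  - destruct HQ' as [_ HQ']; specialize (HQ' ltac:(lra)).
    assert (H4 : Y ^ 2 / 4 * (n1 + n2) <= 4 * Y * S).
    { apply Rle_trans with (Qn * (n1 + n2)); [apply Rmult_le_compat_r; lra|]; nra. }
    assert (H5 : Y * (n1 + n2) <= 16 * S).
    { apply Rmult_le_reg_l with (Y / 4); [lra|]; lra. }
    assert (H6 : m <= Y) by nra.
    assert (m * n1 <= Y * n1) by (apply Rmult_le_compat_r; lra).
    nra.
Qed.

Definition sq2 (z : C3) : R := crd 0 z ^ 2 + crd 1 z ^ 2 + crd 2 z ^ 2 + crd 3 z ^ 2.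
Definition curve (s w : C) : C3 := (Cmul s s, Cmul s (Cmul s s), w).

Lemma Sm_jx2 k : @Sm Cspace k (fun z => jv (jx2 z)).
Proof. apply (@Sm_plus Cspace); apply (@Sm_mult Cspace); apply Sm_crd; lia. Qed.
Lemma Sm_jxy k : @Sm Cspace k (fun z => jv (jxy z)).
Proof. apply (@Sm_plus Cspace); apply (@Sm_mult Cspace); apply Sm_crd; lia. Qed.
Lemma Sm_jpen k : @Sm Cspace k (fun z => jv (jpen z)).
Proof.
  unfold jpen, jq1, jq2, jx2, jy2; cbn [jv jadd jmul jcrd jconst].
  repeat first [apply (@Sm_const Cspace) | apply Sm_crd; lia | apply (@Sm_plus Cspace) | apply (@Sm_mult Cspace)].
Qed.

(** On the cusp the penalty is zero and [Re (y / x) = Re s], so beyond the cutoff region only the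
    logarithmic term and [- Re s] remain. Off the cusp, where the Levi form of the cut-off term is
    negative in some directions, the other two terms compensate. *)
Lemma model_exists : exists (Psi : C3 -> R) (B : R),
  0 <= B /\ (forall k, @Sm Cspace k Psi) /\ psh_jet Psi /\
  (forall j, (j < 6)%nat -> has_partial Psi j (C0, C0, C0) 0) /\
  (forall z, - (1 + sq2 z) <= Psi z) /\
  (forall x y w w', Psi (x, y, w) = Psi (x, y, w')) /\
  (forall s w mu, 1 <= mu -> fst s ^ 2 + snd s ^ 2 <= mu ^ 4 -> Psi (curve s w) <= B * mu - fst s) /\
  (forall s w, (fst s ^ 2 + snd s ^ 2) ^ 2 <= / 2 -> Psi (curve s w) = 0).
Proof.
  destruct truncated_log_exists as [h [h1 [h2 [Sh [Dh [Dh1 [Zh [Ph [Ch [[e [He Ce]] Gh]]]]]]]]]].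
  destruct smooth_cutoff_exists as [kap [kap1 [kap2 [Sk [Dk [Dk1 [Zk [Ok [Bk [Ck [B [HB CB]]]]]]]]]]]].
  (* [B] bounds the two derivatives of the step and 25 is the constant of
     [penalty_controls_cross_terms]. The logarithmic term is divided by [e] because its Levi
     coefficient is only known to be at least [e] on the shell [1 <= |x|^2 <= 2]. *)
  set (J := fun z => jadd (jadd (jmul (jconst (25 * B / e)) (jcomp h h1 h2 (jx2 z)))
      (jmul (jconst (25 * B)) (jpen z)))
    (jmul (jconst (-1)) (jmul (jxy z) (jcomp kap kap1 kap2 (jx2 z))))).
  assert (HJ : is_jet (fun z => jv (J z)) J).
  { unfold J, jpen, jq1, jq2, jxy, jx2, jy2; cbn [jv jadd jmul jcrd jconst jcomp]; is_jet_tac. }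
  assert (EJ : forall z, jv (J z) = 25 * B / e * h (jv (jx2 z)) + 25 * B * jv (jpen z)
    - jv (jxy z) * kap (jv (jx2 z))) by (intros; unfold J; cbn [jv jadd jmul jconst jcomp]; ring).
  assert (Ce0 : 0 <= 25 * B / e) by (apply Rdiv_le_0_compat; lra).
  assert (Ecv : forall s w, jv (J (curve s w)) = 25 * B / e * h ((fst s ^ 2 + snd s ^ 2) ^ 2)
    - fst s * ((fst s ^ 2 + snd s ^ 2) ^ 2 * kap ((fst s ^ 2 + snd s ^ 2) ^ 2))).
  { intros [s t] [w1 w2]; rewrite EJ.
    replace (jv (jx2 (curve (s, t) (w1, w2)))) with ((s ^ 2 + t ^ 2) ^ 2)
      by (unfold jx2, curve, Cmul; simpl; ring).
    replace (jv (jpen (curve (s, t) (w1, w2)))) with 0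
      by (unfold jpen, jq1, jq2, jx2, jy2, curve, Cmul; simpl; ring).
    replace (jv (jxy (curve (s, t) (w1, w2)))) with (s * (s ^ 2 + t ^ 2) ^ 2)
      by (unfold jxy, curve, Cmul; simpl; ring).
    simpl fst; simpl snd; ring. }
  exists (fun z => jv (J z)), (16 * (25 * B / e) + 2).
  split; [lra|]; split; [|split; [|split; [|split; [|split; [|split]]]]].
  - intros k; apply (@Sm_plus Cspace); [apply (@Sm_plus Cspace)|]; apply (@Sm_scal Cspace).
    + apply (@Sm_comp Cspace k h); [auto|apply Sm_jx2].
    + apply Sm_jpen.
    + apply (@Sm_mult Cspace); [apply Sm_jxy|]; apply (@Sm_comp Cspace k kap); [auto|apply Sm_jx2].
  - exists J; split; [exact HJ|]; intros z v; unfold J.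
    rewrite !lev_add, !(lev_mul (jconst _)), !lev_const, !dre_const, !dim_const, lev_jx2_comp, lev_jxy_comp, lev_jpen.
    cbn zeta; change (jv (jconst (25 * B / e))) with (25 * B / e);
      change (jv (jconst (25 * B))) with (25 * B); change (jv (jconst (-1))) with (-1).
    set (a := crd 0 z); set (b := crd 1 z); set (p := crd 2 z); set (q := crd 3 z).
    set (v1 := crd 0 v); set (v2 := crd 1 v); set (w1 := crd 2 v); set (w2 := crd 3 v).
    replace (jv (jq1 z)) with (p ^ 2 - q ^ 2 - (a ^ 3 - 3 * a * b ^ 2))
      by (unfold a, b, p, q; simpl; ring).
    replace (jv (jq2 z)) with (2 * p * q - (3 * a ^ 2 * b - b ^ 3))
      by (unfold a, b, p, q; simpl; ring).
    replace (jv (jx2 z)) with (a ^ 2 + b ^ 2) by (unfold a, b; simpl; ring).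
    replace (jv (jxy z)) with (p * a + q * b) by (unfold a, b, p, q; simpl; ring).
    assert (Hp := penalty_controls_cross_terms a b p q v1 v2 w1 w2); cbv zeta in Hp.
    set (A1 := 2 * (p * w1 - q * w2) - 3 * ((a ^ 2 - b ^ 2) * v1 - 2 * a * b * v2)) in *.
    set (A2 := 2 * (p * w2 + q * w1) - 3 * ((a ^ 2 - b ^ 2) * v2 + 2 * a * b * v1)) in *.
    set (Q1 := p ^ 2 - q ^ 2 - (a ^ 3 - 3 * a * b ^ 2)) in *.
    set (Q2 := 2 * p * q - (3 * a ^ 2 * b - b ^ 3)) in *.
    set (X1 := a * A1 - b * A2 + (Q1 * v1 - Q2 * v2)) in *.
    set (X2 := a * A2 + b * A1 + (Q1 * v2 + Q2 * v1)) in *.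
    set (X3 := p * A1 - q * A2 + (Q1 * w1 - Q2 * w2)) in *.
    set (X4 := p * A2 + q * A1 + (Q1 * w2 + Q2 * w1)) in *.
    set (S := A1 ^ 2 + A2 ^ 2 + (X1 ^ 2 + X2 ^ 2) + (X3 ^ 2 + X4 ^ 2)) in *.
    assert (S0 : 0 <= S).
    { unfold S; assert (G1 := pow2_ge_0 A1); assert (G2 := pow2_ge_0 A2);
      assert (G3 := pow2_ge_0 X1); assert (G4 := pow2_ge_0 X2);
      assert (G5 := pow2_ge_0 X3); assert (G6 := pow2_ge_0 X4); lra. }
    clearbody S; set (R0 := a ^ 2 + b ^ 2) in *.
    set (m := p * a + q * b) in *; set (n := v1 ^ 2 + v2 ^ 2) in *.
    assert (n0 : 0 <= n) by (unfold n; nra).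
    set (rw := w1 * v1 + w2 * v2) in *.
    assert (Hh := Ch R0).
    match goal with |- 0 <= ?X => replace X with (25 * B / e * ((h1 R0 + R0 * h2 R0) * n) + 25 * B * S
      - ((kap R0 + R0 * kap1 R0) * rw + m * (2 * kap1 R0 + R0 * kap2 R0) * n)) by (unfold rw; ring) end.
    assert (P1 : 0 <= 25 * B / e * ((h1 R0 + R0 * h2 R0) * n))
      by (apply Rmult_le_pos; [easy|now apply Rmult_le_pos]).
    assert (P2 : 0 <= 25 * B * S) by (apply Rmult_le_pos; lra).
    (* Outside the shell the step is constant and the Levi form of the third term vanishes; inside,
       the penalty estimate bounds it by the other two. *)
    assert (HR : 1 <= R0 <= 2 \/ ~ 1 <= R0 <= 2) by lra; destruct HR as [HR|HR].
    + specialize (Hp HR); specialize (Ce R0 HR); destruct (CB R0) as [C1 C2].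
      assert (P3 : 25 * B * n <= 25 * B / e * ((h1 R0 + R0 * h2 R0) * n)).
      { replace (25 * B * n) with (25 * B / e * (e * n)) by (field; lra).
        apply Rmult_le_compat_l; [easy|]; now apply Rmult_le_compat_r. }
      assert (P4 : (kap R0 + R0 * kap1 R0) * rw <= B * Rabs rw).
      { eapply Rle_trans; [apply Rle_abs|]; rewrite Rabs_mult; apply Rmult_le_compat_r; [apply Rabs_pos|easy]. }
      assert (P5 : m * (2 * kap1 R0 + R0 * kap2 R0) * n <= B * (Rabs m * n)).
      { rewrite <- Rmult_assoc; apply Rmult_le_compat_r; [easy|].
        eapply Rle_trans; [apply Rle_abs|]; rewrite Rabs_mult, (Rmult_comm B).
        apply Rmult_le_compat_l; [apply Rabs_pos|easy]. }
      assert (P6 : B * (Rabs m * n + Rabs rw) <= B * (25 * (n + S))) by (apply Rmult_le_compat_l; lra).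
      lra.
    + destruct (Ck R0 HR) as [-> ->]; lra.
  - intros j Hj; destruct HJ as [_ [D _]].
    replace 0 with (jg (J (C0, C0, C0)) j); [now apply D|].
    unfold J, jpen, jq1, jq2, jxy, jx2, jy2, C0; simpl; ring.
  - intros z; rewrite EJ.
    set (R0 := jv (jx2 z)); set (m := jv (jxy z)).
    assert (E0 : R0 = crd 0 z ^ 2 + crd 1 z ^ 2) by (unfold R0; simpl; ring).
    assert (Em : m = crd 2 z * crd 0 z + crd 3 z * crd 1 z) by reflexivity.
    assert (H1 : 0 <= 25 * B / e * h R0) by (apply Rmult_le_pos; auto).
    assert (H2 : 0 <= 25 * B * jv (jpen z)).
    { apply Rmult_le_pos; [lra|]; unfold jpen; cbn [jv jmul jadd jconst].
      apply Rmult_le_pos; [nra|]; simpl; nra. }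
    enough (m * kap R0 <= 1 + sq2 z) by lra.
    destruct (Bk R0) as [B1 B2]; unfold sq2.
    assert (H0 : 0 <= kap R0 <= 1).
    { destruct (Rle_dec R0 1) as [H|H]; [rewrite Zk; lra|nra]. }
    rewrite Em; clearbody R0; clear -H0.
    set (a := crd 0 z); set (b := crd 1 z); set (p := crd 2 z); set (q := crd 3 z).
    assert (G1 := pow2_ge_0 (p - a)); assert (G2 := pow2_ge_0 (q - b)).
    assert (G3 := pow2_ge_0 (p + a)); assert (G4 := pow2_ge_0 (q + b)).
    assert (p * a + q * b <= a ^ 2 + b ^ 2 + p ^ 2 + q ^ 2) by lra.
    assert (0 <= a ^ 2 + b ^ 2 + p ^ 2 + q ^ 2) by lra.
    destruct (Rle_dec 0 (p * a + q * b)); nra.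
  - intros [a b] [p q] [u v] [u' v']; rewrite !EJ; reflexivity.
  - intros s w mu Hmu Hs; rewrite Ecv.
    set (r := fst s ^ 2 + snd s ^ 2) in *.
    assert (Hr : 0 <= r) by (unfold r; nra).
    assert (H1 : h (r ^ 2) <= 16 * mu).
    { apply Gh; [lra|]; replace (mu ^ 8) with ((mu ^ 4) ^ 2) by ring; apply pow_incr; lra. }
    assert (H2 : 25 * B / e * h (r ^ 2) <= 25 * B / e * (16 * mu)) by now apply Rmult_le_compat_l.
    (* Where the step has not reached [1] one has [|s|^4 < 2], so [|Re s| <= 2]; the summand 2 in
       the witness for [B] pays for this region. *)
    enough (- (fst s * (r ^ 2 * kap (r ^ 2))) <= 2 - fst s) by nra.
    destruct (Rle_dec 2 (r ^ 2)) as [Hr2|Hr2]; [rewrite Ok by easy; lra|].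
    destruct (Bk (r ^ 2)) as [B1 B2].
    assert (r <= 2) by nra.
    assert (Hf : fst s ^ 2 <= r) by (unfold r; assert (G := pow2_ge_0 (snd s)); lra).
    assert (-2 <= fst s <= 2) by (split; nra).
    set (y := r ^ 2 * kap (r ^ 2)) in *; nra.
  - intros s w Hs; rewrite Ecv, Zh, Zk by lra; ring.
Qed.

(** * Superposition of rescaled copies *)

Lemma geom_series_tail (a : nat -> R) B :
  (forall n, Rabs (a n) <= B * (/ 2) ^ n) ->
  ex_series a /\ Rabs (Series a) <= 2 * B /\
  forall N, Rabs (Series a - sum_f_R0 a N) <= B * (/ 2) ^ N.
Proof.
  intros H.
  assert (Hg : forall m, is_series (fun n => B * (/ 2) ^ (m + n)) (2 * B * (/ 2) ^ m)).
  { intros m; replace (2 * B * (/ 2) ^ m) with ((B * (/ 2) ^ m) * / (1 - / 2)) by field.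
    apply is_series_ext with (fun n => (B * (/ 2) ^ m) * (/ 2) ^ n).
    - intros n; rewrite pow_add; apply Rmult_assoc.
    - apply (is_series_scal (V := R_NormedModule)), is_series_geom; rewrite Rabs_pos_eq; lra. }
  assert (Hb : forall m, ex_series (fun n => Rabs (a (m + n)%nat)) /\
    Rabs (Series (fun n => a (m + n)%nat)) <= 2 * B * (/ 2) ^ m).
  { intros m.
    assert (E : ex_series (fun n => Rabs (a (m + n)%nat))).
    { apply (@ex_series_le R_AbsRing R_CompleteNormedModule) with (fun n => B * (/ 2) ^ (m + n)).
      - intros n; change (Rabs (Rabs (a (m + n)%nat)) <= B * (/ 2) ^ (m + n)); rewrite Rabs_Rabsolu; apply H.
      - eexists; apply Hg. }
    split; [exact E|].
    eapply Rle_trans; [now apply Series_Rabs|]; rewrite <- (is_series_unique _ _ (Hg m)).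
    apply Series_le; [intros n; split; [apply Rabs_pos|apply H]|eexists; apply Hg]. }
  assert (Ha : ex_series a).
  { apply ex_series_Rabs; apply (proj1 (Hb 0%nat)). }
  split; [exact Ha|]; split.
  - assert (H1 := proj2 (Hb 0%nat)); simpl in H1; rewrite Rmult_1_r in H1; exact H1.
  - intros N; rewrite (Series_incr_n a (S N)) by (auto; lia); simpl Nat.pred.
    replace (sum_f_R0 a N + Series (fun k => a (S N + k)%nat) - sum_f_R0 a N)
      with (Series (fun k => a (S N + k)%nat)) by ring.
    eapply Rle_trans; [apply Hb|]; right; simpl; field.
Qed.

(** For a derivative of fixed order the coefficients beat the powers of [lam] only from some index
    on; the finitely many earlier terms go into the constant. *)
Lemma geom_bound_of_eventually (u : nat -> R) B N :
  0 <= B -> (forall n, (N <= n)%nat -> u n <= B * (/ 2) ^ n) ->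
  exists B', 0 <= B' /\ forall n, u n <= B' * (/ 2) ^ n.
Proof.
  revert B; induction N as [|N IH]; intros B HB H; [exists B; split; [easy|]; intros; apply H; lia|].
  assert (HN : 0 < (/ 2) ^ N) by (apply pow_lt; lra).
  apply (IH (Rmax B (u N / (/ 2) ^ N))); [eapply Rle_trans; [exact HB|apply Rmax_l]|].
  intros n Hn; destruct (Nat.eq_dec n N) as [->|E].
  - apply Rle_trans with (u N / (/ 2) ^ N * (/ 2) ^ N); [right; field; lra|].
    apply Rmult_le_compat_r; [lra|apply Rmax_r].
  - eapply Rle_trans; [apply H; lia|]; apply Rmult_le_compat_r; [apply pow_le; lra|apply Rmax_l].
Qed.

Lemma sq3_add_le y z : sq3 y <= 2 * sq3 z + 2 * sq3 (V3sub y z).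
Proof.
  unfold sq3; rewrite !crd_sub.
  assert (E : forall a b, a ^ 2 <= 2 * b ^ 2 + 2 * (a - b) ^ 2)
    by (intros a b; assert (G := pow2_ge_0 (a - 2 * b)); nra).
  assert (H0 := E (crd 0 y) (crd 0 z)); assert (H1 := E (crd 1 y) (crd 1 z));
  assert (H2 := E (crd 2 y) (crd 2 z)); assert (H3 := E (crd 3 y) (crd 3 z));
  assert (H4 := E (crd 4 y) (crd 4 z)); assert (H5 := E (crd 5 y) (crd 5 z)); lra.
Qed.

Lemma wt_ball (x y : Cspace) : V3norm (V3sub y x) < 1 -> wt Cspace y <= 3 * wt Cspace x.
Proof.
  intros H; assert (H1 := sq3_add_le y x); assert (H2 := V3norm_pow2 (V3sub y x)).
  assert (0 <= V3norm (V3sub y x)) by apply sqrt_pos.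
  assert (sq3 (V3sub y x) <= 1) by nra.
  assert (H4 := sq3_nonneg x); cbn [wt Cspace]; lra.
Qed.

Lemma cont_sum_f_R0 {X : space} (f : nat -> X -> R) N :
  (forall n, cont (f n)) -> cont (fun x => sum_f_R0 (fun n => f n x) N).
Proof. intros H; induction N as [|N IH]; simpl; [auto|]; now apply cont_plus. Qed.

Lemma pow_half_small B e : 0 < e -> exists N, B * (/ 2) ^ N < e.
Proof.
  intros He; destruct (pow_lt_1_zero (/ 2) ltac:(rewrite Rabs_pos_eq; lra) (e / (Rabs B + 1))) as [N HN].
  { apply Rdiv_lt_0_compat; [easy|]; assert (H := Rabs_pos B); lra. }
  exists N; specialize (HN N (le_n N)).
  assert (HB := Rabs_pos B); assert (HB2 := Rle_abs B).
  assert (H0 : 0 < (/ 2) ^ N) by (apply pow_lt; lra).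
  rewrite Rabs_pos_eq in HN by lra.
  apply (Rmult_lt_compat_r (Rabs B + 1)) in HN; [|lra].
  replace (e / (Rabs B + 1) * (Rabs B + 1)) with e in HN by (field; lra); nra.
Qed.

(** Convergence is locally uniform: on a unit ball the weight exceeds its value at the centre at
    most by the factor 3. *)
Lemma cont_series (f : nat -> Cspace -> R) B m :
  (forall n, cont (f n)) -> 0 <= B ->
  (forall n z, Rabs (f n z) <= B * (/ 2) ^ n * wt Cspace z ^ m) ->
  cont (fun z => Series (fun n => f n z)).
Proof.
  intros Hc HB Hb x e He.
  set (M := B * (3 * wt Cspace x) ^ m).
  assert (Hx : forall y, V3norm (V3sub y x) < 1 -> forall n, Rabs (f n y) <= M * (/ 2) ^ n).
  { intros y Hy n; eapply Rle_trans; [apply Hb|]; unfold M.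
    replace (B * (3 * wt Cspace x) ^ m * (/ 2) ^ n) with (B * (/ 2) ^ n * (3 * wt Cspace x) ^ m) by ring.
    apply Rmult_le_compat_l; [apply Rmult_le_pos; [easy|apply pow_le; lra]|].
    apply pow_incr; split; [assert (H := wt_ge1 Cspace y); lra|now apply wt_ball]. }
  destruct (pow_half_small M (e / 3)) as [N HN]; [lra|].
  destruct (cont_sum_f_R0 f N Hc x (e / 3)) as [d [Hd Hs]]; [lra|].
  exists (Rmin d 1); split; [apply Rmin_pos; lra|]; intros y Hy.
  assert (Hy1 := Hs y (Rlt_le_trans _ _ _ Hy (Rmin_l _ _))).
  assert (Hy2 := Hx y (Rlt_le_trans _ _ _ Hy (Rmin_r _ _))).
  assert (Hx2 : forall n, Rabs (f n x) <= M * (/ 2) ^ n).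
  { apply Hx; rewrite V3norm_sq3; replace (sq3 (V3sub x x)) with 0; [rewrite sqrt_0; lra|].
    unfold sq3; rewrite !crd_sub; ring. }
  destruct (geom_series_tail _ _ Hy2) as [_ [_ T1]]; destruct (geom_series_tail _ _ Hx2) as [_ [_ T2]].
  specialize (T1 N); specialize (T2 N); cbv beta in Hy1.
  apply Rabs_def2 in Hy1; apply Rabs_le_between in T1, T2; apply Rabs_def1; lra.
Qed.

Lemma V3sub_shift z j s t : (j < 6)%nat ->
  V3norm (V3sub (shf Cspace z j s) (shf Cspace z j t)) = Rabs (s - t).
Proof.
  intros Hj; rewrite V3norm_sq3, <- sqrt_Rsqr_abs; f_equal; unfold sq3, Rsqr; cbn [shf Cspace].
  rewrite !crd_sub, !crd_shift by lia.
  do 6 (destruct j as [|j]; [simpl; ring|]); exfalso; clear -Hj; lia.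
Qed.

(** Termwise differentiation along one coordinate line, by locally uniform convergence of the
    differentiated series. *)
Lemma has_der_series (f g : nat -> Cspace -> R) B m j z : (j < 6)%nat ->
  (forall n, cont (g n)) -> 0 <= B ->
  (forall n z, Rabs (g n z) <= B * (/ 2) ^ n * wt Cspace z ^ m) ->
  (forall z, ex_series (fun n => f n z)) ->
  (forall n z, has_der (f n) j z (g n z)) ->
  has_der (fun z => Series (fun n => f n z)) j z (Series (fun n => g n z)).
Proof.
  intros Hj Hc HB Hb Hf Hd.
  set (sh := fun t => shf Cspace z j t).
  set (G := fun z : Cspace => Series (fun n => g n z)).
  assert (HG : cont G) by now apply (cont_series g B m).
  set (M := B * (3 * wt Cspace z) ^ m).
  assert (Hsh : forall t, Boule 0 posreal_one t -> forall n, Rabs (g n (sh t)) <= M * (/ 2) ^ n).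
  { intros t Ht n; eapply Rle_trans; [apply Hb|]; unfold M.
    replace (B * (3 * wt Cspace z) ^ m * (/ 2) ^ n) with (B * (/ 2) ^ n * (3 * wt Cspace z) ^ m) by ring.
    apply Rmult_le_compat_l; [apply Rmult_le_pos; [easy|apply pow_le; lra]|].
    apply pow_incr; split; [assert (H := wt_ge1 Cspace (sh t)); lra|]; apply wt_ball.
    rewrite <- (shf0 Cspace z j); unfold sh; rewrite V3sub_shift by easy; exact Ht. }
  replace (Series (fun n => g n z)) with (G (sh 0)) by (unfold G, sh; rewrite shf0; reflexivity).
  apply (derivable_pt_lim_CVU (fun N t => sum_f_R0 (fun n => f n (sh t)) N)
    (fun N t => sum_f_R0 (fun n => g n (sh t)) N) (fun t => Series (fun n => f n (sh t)))
    (fun t => G (sh t)) 0 0 posreal_one).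
  - unfold Boule; rewrite Rminus_0_r, Rabs_R0; simpl; lra.
  - intros y N _.
    assert (Hn : forall n, derivable_pt_lim (fun t => f n (sh t)) y (g n (sh y))).
    { intros n; assert (H := Hd n (sh y)); unfold has_der in H; intros e He.
      destruct (H e He) as [d Hd']; exists d; intros h Hh Hh2; specialize (Hd' h Hh Hh2).
      rewrite shf0, Rplus_0_l in Hd'.
      replace (sh (y + h)) with (shf Cspace (sh y) j h); [exact Hd'|].
      apply C3_ext; intros i Hi; unfold sh; cbn [shf Cspace]; rewrite !crd_shift by easy.
      destruct (Nat.eqb i j); ring. }
    induction N as [|N IH]; simpl; [apply Hn|].
    apply (derivable_pt_lim_plus (fun t => sum_f_R0 (fun n => f n (sh t)) N) (fun t => f (S N) (sh t))); auto.
  - intros y _; assert (H := Series_correct _ (Hf (sh y))).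
    apply is_lim_seq_Reals; unfold is_series in H.
    apply (is_lim_seq_ext (sum_n (fun n => f n (sh y)))); [intros n; apply sum_n_Reals|exact H].
  - intros e He; destruct (pow_half_small M e He) as [N HN]; exists N; intros n y Hn Hy.
    destruct (geom_series_tail _ _ (Hsh y Hy)) as [_ [_ T]].
    eapply Rle_lt_trans; [apply T|]; eapply Rle_lt_trans; [|exact HN].
    apply Rmult_le_compat_l; [apply Rmult_le_pos; [easy|apply pow_le; assert (H := wt_ge1 Cspace z); lra]|].
    replace n with (N + (n - N))%nat by lia; rewrite pow_add.
    assert (0 < (/ 2) ^ N) by (apply pow_lt; lra).
    assert ((/ 2) ^ (n - N) <= 1) by (rewrite <- (pow1 (n - N)); apply pow_incr; lra); nra.
  - intros y _ e He; destruct (HG (sh y) e He) as [d [Hd0 H]]; exists d; split; [easy|].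
    intros t [_ Ht]; apply H; unfold sh; cbn [dst Cspace].
    rewrite (V3sub_shift z j t y) by easy; exact Ht.
Qed.

(** The weights are those for which [y^2 = x^3] is homogeneous. *)
Definition scl (l : R) (z : C3) : C3 :=
  match z with ((a, b), (p, q), w) =>
    ((l ^ 2 * a, l ^ 2 * b), (l ^ 3 * p, l ^ 3 * q), w) end.
Definition wj (j : nat) : nat :=
  match j with 0 | 1 => 2 | 2 | 3 => 3 | _ => 0 end%nat.
(** The exponent [n] counts the powers of [lam] produced by differentiation: a partial derivative of
    such a family is again one, for the partial of [Phi] and with [n] raised by the weight of the
    coordinate. This closes the induction on the order of smoothness. *)
Definition fam (c lam : nat -> R) (n : nat) (Phi : C3 -> R) (nu : nat) (z : C3) : R :=
  c nu * lam nu ^ n * Phi (scl (lam nu) z).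
Definition superpos (c lam : nat -> R) (n : nat) (Phi : C3 -> R) (z : C3) : R :=
  Series (fun nu => fam c lam n Phi nu z).

Lemma crd_scl i l z : (i < 6)%nat -> crd i (scl l z) = l ^ wj i * crd i z.
Proof.
  intros Hi; destruct z as [[[a b] [p q]] [u v]].
  do 6 (destruct i as [|i]; [simpl; ring|]); exfalso; clear -Hi; lia.
Qed.

Lemma scl_shift l z j t : (j < 6)%nat ->
  scl l (shf Cspace z j t) = shf Cspace (scl l z) j (l ^ wj j * t).
Proof.
  intros Hj; apply C3_ext; intros i Hi; cbn [shf Cspace].
  rewrite crd_scl, !crd_shift, crd_scl by easy.
  destruct (Nat.eqb_spec i j) as [->|]; ring.
Qed.

Lemma has_der_scl (Phi Phi' : C3 -> R) l j z : (j < 6)%nat ->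
  has_partial Phi j (scl l z) (Phi' (scl l z)) ->
  @has_der Cspace (fun z => Phi (scl l z)) j z (l ^ wj j * Phi' (scl l z)).
Proof.
  intros Hj H; unfold has_der.
  replace (fun t => Phi (scl l (shf Cspace z j t)))
    with (fun t => (fun t => Phi (shf Cspace (scl l z) j t)) (l ^ wj j * t)).
  - rewrite Rmult_comm.
    apply (derivable_pt_lim_comp (fun t => l ^ wj j * t) (fun t => Phi (shf Cspace (scl l z) j t))).
    + assert (E := derivable_pt_lim_scal id (l ^ wj j) 0 1 (derivable_pt_lim_id 0)).
      rewrite Rmult_1_r in E; exact E.
    + rewrite Rmult_0_r; exact H.
  - apply functional_extensionality; intros t; now rewrite scl_shift.
Qed.

Lemma wt_scl l z : 1 <= l -> wt Cspace (scl l z) <= l ^ 6 * wt Cspace z.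
Proof.
  intros Hl; cbn [wt Cspace]; unfold sq3; rewrite !crd_scl by lia; simpl wj.
  assert (E : forall k a, (k <= 3)%nat -> (l ^ k * a) ^ 2 <= l ^ 6 * a ^ 2).
  { intros k a Hk; rewrite Rpow_mult_distr; apply Rmult_le_compat_r; [apply pow2_ge_0|].
    rewrite <- pow_mult; apply Rle_pow; [easy|lia]. }
  assert (H0 := E 2%nat (crd 0 z) ltac:(lia)); assert (H1 := E 2%nat (crd 1 z) ltac:(lia));
  assert (H2 := E 3%nat (crd 2 z) ltac:(lia)); assert (H3 := E 3%nat (crd 3 z) ltac:(lia));
  assert (H4 := E 0%nat (crd 4 z) ltac:(lia)); assert (H5 := E 0%nat (crd 5 z) ltac:(lia)).
  assert (H6 : 1 <= l ^ 6) by now apply pow_R1_Rle.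
  lra.
Qed.

Section Superpos.
Context (c lam : nat -> R) (eta : R) (n0 : nat).
Context (c_nonneg : forall nu, 0 <= c nu) (lam_ge1 : forall nu, 1 <= lam nu) (eta_nonneg : 0 <= eta).
(** The exponent grows with [nu], so every fixed power of [lam] is eventually beaten, as smoothness
    requires. The offset [n0] makes the powers up to [n0] controlled from the first term, with the
    small factor [eta]. *)
Context (c_small : forall nu, c nu * lam nu ^ (nu + n0) <= eta * (/ 2) ^ nu).

Lemma coef_small nu N : (N <= nu + n0)%nat -> c nu * lam nu ^ N <= eta * (/ 2) ^ nu.
Proof.
  intros H; eapply Rle_trans; [|apply c_small]; apply Rmult_le_compat_l; [auto|].
  apply Rle_pow; auto.
Qed.

Lemma fam_le (Phi : C3 -> R) A m n nu z :
  (forall z, Rabs (Phi z) <= A * wt Cspace z ^ m) -> 0 <= A ->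
  Rabs (fam c lam n Phi nu z) <= c nu * lam nu ^ (n + 6 * m) * A * wt Cspace z ^ m.
Proof.
  intros H HA; unfold fam; rewrite Rabs_mult, (Rabs_pos_eq (_ * _)).
  2:{ apply Rmult_le_pos; [auto|apply pow_le; assert (G := lam_ge1 nu); lra]. }
  replace (c nu * lam nu ^ (n + 6 * m) * A * wt Cspace z ^ m)
    with (c nu * lam nu ^ n * ((lam nu ^ 6) ^ m * (A * wt Cspace z ^ m)))
    by (rewrite pow_add, pow_mult; ring).
  apply Rmult_le_compat_l; [apply Rmult_le_pos; [auto|apply pow_le; assert (G := lam_ge1 nu); lra]|].
  eapply Rle_trans; [apply H|].
  replace ((lam nu ^ 6) ^ m * (A * wt Cspace z ^ m)) with (A * (lam nu ^ 6 * wt Cspace z) ^ m)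
    by (rewrite Rpow_mult_distr; ring).
  apply Rmult_le_compat_l; [easy|]; apply pow_incr; split; [|now apply wt_scl].
  assert (G := wt_ge1 Cspace (scl (lam nu) z)); lra.
Qed.

Lemma fam_bound (Phi : C3 -> R) n : @poly_bd Cspace Phi ->
  exists B m, 0 <= B /\ forall nu z, Rabs (fam c lam n Phi nu z) <= B * (/ 2) ^ nu * wt Cspace z ^ m.
Proof.
  intros [A [m [HA H]]].
  destruct (geom_bound_of_eventually (fun nu => c nu * lam nu ^ (n + 6 * m)) eta (n + 6 * m)) as [B [HB Hb]].
  - easy.
  - intros nu Hnu; apply coef_small; lia.
  - exists (B * A), m; split; [now apply Rmult_le_pos|]; intros nu z.
    eapply Rle_trans; [now apply fam_le with (A := A) (m := m)|].
    replace (B * A * (/ 2) ^ nu * wt Cspace z ^ m) with (B * (/ 2) ^ nu * A * wt Cspace z ^ m) by ring.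
    apply Rmult_le_compat_r; [assert (G := @wt_pow_ge1 Cspace z m); lra|].
    now apply Rmult_le_compat_r.
Qed.

(** Within the range covered by [n0] no initial terms are exceptional, so the bound is proportional
    to [eta]; this is what makes [phi] and its gradient as small as needed on a fixed ball. *)
Lemma superpos_small (Phi : C3 -> R) A m n z :
  (forall z, Rabs (Phi z) <= A * wt Cspace z ^ m) -> 0 <= A -> (n + 6 * m <= n0)%nat ->
  Rabs (superpos c lam n Phi z) <= 2 * (eta * A * wt Cspace z ^ m).
Proof.
  intros H HA Hn; apply geom_series_tail; intros nu.
  eapply Rle_trans; [now apply fam_le with (A := A) (m := m)|].
  replace (eta * A * wt Cspace z ^ m * (/ 2) ^ nu) with (eta * (/ 2) ^ nu * A * wt Cspace z ^ m) by ring.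
  apply Rmult_le_compat_r; [assert (G := @wt_pow_ge1 Cspace z m); lra|].
  apply Rmult_le_compat_r; [easy|]; apply coef_small; lia.
Qed.

Lemma ex_series_fam (Phi : C3 -> R) n z : @poly_bd Cspace Phi -> ex_series (fun nu => fam c lam n Phi nu z).
Proof.
  intros H; destruct (fam_bound Phi n H) as [B [m [HB Hb]]].
  apply (geom_series_tail _ (B * wt Cspace z ^ m)); intros nu.
  eapply Rle_trans; [apply Hb|]; right; ring.
Qed.

Lemma cont_fam (Phi : C3 -> R) n nu : @cont Cspace Phi -> @cont Cspace (fam c lam n Phi nu).
Proof.
  intros H; unfold fam; apply (@cont_scal Cspace).
  intros z e He; destruct (H (scl (lam nu) z) e He) as [d [Hd K]].
  assert (H3 : 1 <= lam nu ^ 3) by (apply pow_R1_Rle, lam_ge1).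
  exists (d / lam nu ^ 3); split; [apply Rdiv_lt_0_compat; lra|]; intros y Hy; apply K.
  cbn [dst Cspace] in *.
  apply Rle_lt_trans with (lam nu ^ 3 * V3norm (V3sub y z)).
  - rewrite !V3norm_sq3, <- (sqrt_pow2 (lam nu ^ 3)), <- sqrt_mult_alt by nra.
    apply sqrt_le_1_alt.
    assert (E : V3sub (scl (lam nu) y) (scl (lam nu) z) = scl (lam nu) (V3sub y z)).
    { apply C3_ext; intros i Hi; rewrite crd_sub, !crd_scl, crd_sub by easy; ring. }
    rewrite E; unfold sq3; rewrite !crd_scl by lia; simpl wj.
    assert (G : forall k a, (k <= 3)%nat -> (lam nu ^ k * a) ^ 2 <= (lam nu ^ 3) ^ 2 * a ^ 2).
    { intros k a Hk; rewrite Rpow_mult_distr; apply Rmult_le_compat_r; [apply pow2_ge_0|].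
      apply pow_incr; split; [apply pow_le; assert (G := lam_ge1 nu); lra|]; now apply Rle_pow. }
    set (w := V3sub y z).
    assert (G0 := G 2%nat (crd 0 w) ltac:(lia)); assert (G1 := G 2%nat (crd 1 w) ltac:(lia));
    assert (G2 := G 3%nat (crd 2 w) ltac:(lia)); assert (G3 := G 3%nat (crd 3 w) ltac:(lia));
    assert (G4 := G 0%nat (crd 4 w) ltac:(lia)); assert (G5 := G 0%nat (crd 5 w) ltac:(lia)).
    lra.
  - apply (Rmult_lt_compat_l (lam nu ^ 3)) in Hy; [|lra].
    replace (lam nu ^ 3 * (d / lam nu ^ 3)) with d in Hy by (field; assert (G := lam_ge1 nu); lra); exact Hy.
Qed.

Lemma has_der_superpos (Phi Phi' : C3 -> R) n j z : (j < 6)%nat ->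
  @poly_bd Cspace Phi -> @poly_bd Cspace Phi' -> @cont Cspace Phi' ->
  (forall z, has_partial Phi j z (Phi' z)) ->
  has_partial (superpos c lam n Phi) j z (superpos c lam (n + wj j) Phi' z).
Proof.
  intros Hj Hb Hb' Hc Hd.
  destruct (fam_bound Phi' (n + wj j) Hb') as [B [m [HB Hm]]].
  apply (has_der_series (fam c lam n Phi) (fam c lam (n + wj j) Phi') B m); auto.
  - intros nu; now apply cont_fam.
  - intros y; now apply ex_series_fam.
  - intros nu y.
    replace (fam c lam (n + wj j) Phi' nu y)
      with (0 * Phi (scl (lam nu) y) + c nu * lam nu ^ n * (lam nu ^ wj j * Phi' (scl (lam nu) y)))
      by (unfold fam; rewrite pow_add; ring).
    apply (@has_der_mult Cspace (fun _ => c nu * lam nu ^ n) (fun z => Phi (scl (lam nu) z)) j y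
      0 (lam nu ^ wj j * Phi' (scl (lam nu) y))); [apply (@has_der_const Cspace)|].
    now apply has_der_scl.
Qed.

Lemma Sm_superpos k : forall (Phi : C3 -> R) n, @Sm Cspace k Phi -> @Sm Cspace k (superpos c lam n Phi).
Proof.
  induction k as [|k IH]; intros Phi n HS;
    destruct HS as [[Hc Hb] HS]; destruct (fam_bound Phi n Hb) as [B [m [HB Hm]]];
    (split; [split|]).
  1,4: apply (cont_series (fam c lam n Phi) B m); auto; intros nu; now apply cont_fam.
  1,3: exists (2 * B), m; split; [lra|]; intros z;
    rewrite Rmult_assoc; apply geom_series_tail; intros nu; eapply Rle_trans; [apply Hm|right; ring].
  - exact I.
  - intros j Hj; destruct (HS j Hj) as [g [Hg Sg]].
    exists (superpos c lam (n + wj j) g); split; [|now apply IH].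
    intros z; destruct (Sm_0 _ _ Sg) as [Cg Bg]; now apply has_der_superpos.
Qed.

(** Linearity in the Hessian entries, with Levi forms of elementary matrices as coefficients: in
    this shape the Levi form can be summed term by term. *)
Lemma lev_sum d v : lev d v = sum_n (fun j => sum_n (fun k =>
  d j k * lev (fun j' k' => if (Nat.eqb j' j && Nat.eqb k' k)%bool then 1 else 0) v) 5) 5.
Proof.
  rewrite sum_n_Reals; simpl sum_f_R0; rewrite !sum_n_Reals; simpl sum_f_R0.
  destruct v as [[[? ?] [? ?]] [? ?]].
  unfold lev, dzdzbar, Csum3, Cmul, Cadd, Cconj; simpl; field.
Qed.

Lemma is_series_sum_n (a : nat -> nat -> R) (s : nat -> R) N :
  (forall i, (i <= N)%nat -> is_series (a i) (s i)) ->
  is_series (fun nu => sum_n (fun i => a i nu) N) (sum_n s N).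
Proof.
  induction N as [|N IH]; intros H.
  - rewrite sum_O; apply is_series_ext with (a 0%nat); [intros; now rewrite sum_O|auto].
  - rewrite sum_Sn.
    apply is_series_ext with (fun nu => plus (sum_n (fun i => a i nu) N) (a (S N) nu));
      [intros; now rewrite sum_Sn|].
    apply @is_series_plus; auto.
Qed.

Lemma is_series_lev (u : nat -> nat -> nat -> R) v :
  (forall j k, (j < 6)%nat -> (k < 6)%nat -> ex_series (u j k)) ->
  is_series (fun nu => lev (fun j k => u j k nu) v) (lev (fun j k => Series (u j k)) v).
Proof.
  intros H; rewrite lev_sum.
  eapply is_series_ext; [intros nu; symmetry; apply lev_sum|].
  apply (is_series_sum_n (fun j nu => _)); intros j Hj; cbv beta.
  apply (is_series_sum_n (fun k nu => _)); intros k Hk; cbv beta.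
  apply is_series_scal_r, Series_correct, H; lia.
Qed.

Lemma is_series_nonneg (a : nat -> R) l : (forall n, 0 <= a n) -> is_series a l -> 0 <= l.
Proof.
  intros Ha Hl.
  apply (is_lim_seq_le (fun _ => 0) (sum_n a) 0 l); [|apply is_lim_seq_const|exact Hl].
  intros n; induction n as [|n IH]; [rewrite sum_O; apply Ha|].
  rewrite sum_Sn; apply Rplus_le_le_0_compat; auto.
Qed.

(** The dilation is complex linear, so the Levi form of each term is [c nu] times that of [Phi] at
    the dilated point in the dilated direction; a convergent series of nonnegative terms is
    nonnegative. *)
Lemma psh_superpos (Phi : C3 -> R) :
  psh_jet Phi -> (forall k, @Sm Cspace k Phi) -> psh_jet (superpos c lam 0 Phi).
Proof.
  intros [J [[EJ [D1 D2]] HP]] HS.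
  assert (S1 : forall j, (j < 6)%nat -> @Sm Cspace 1 (fun z => jg (J z) j)).
  { intros j Hj; apply (@Sm_der Cspace 1 Phi j); auto; intros z; now apply D1. }
  assert (S2 : forall j k, (j < 6)%nat -> (k < 6)%nat -> @Sm Cspace 0 (fun z => jh (J z) j k)).
  { intros j k Hj Hk; apply (@Sm_der Cspace 0 (fun z => jg (J z) k) j); auto; intros z; now apply D2. }
  exists (fun z => Jet (superpos c lam 0 Phi z)
    (fun j => superpos c lam (0 + wj j) (fun z => jg (J z) j) z)
    (fun j k => superpos c lam (0 + wj k + wj j) (fun z => jh (J z) j k) z)).
  split; [split; [|split]|]; simpl jv; simpl jg; simpl jh.
  - reflexivity.
  - intros z j Hj.
    destruct (Sm_0 _ _ (HS 0%nat)) as [_ Hb]; destruct (Sm_0 _ _ (S1 j Hj)) as [Hc' Hb'].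
    apply has_der_superpos; auto; intros y; now apply D1.
  - intros z j k Hj Hk.
    destruct (Sm_0 _ _ (S1 k Hk)) as [_ Hb]; destruct (Sm_0 _ _ (S2 j k Hj Hk)) as [Hc' Hb'].
    apply has_der_superpos; auto; intros y; now apply D2.
  - intros z v; unfold superpos.
    apply (is_series_nonneg (fun nu => lev (fun j k =>
      fam c lam (wj k + wj j) (fun z => jh (J z) j k) nu z) v)).
    + intros nu.
      replace (lev _ v) with (c nu * lev (jh (J (scl (lam nu) z))) (scl (lam nu) v)).
      { apply Rmult_le_pos; auto. }
      destruct v as [[[? ?] [? ?]] [? ?]]; unfold fam.
      unfold lev, dzdzbar, Csum3, Cmul, Cadd, Cconj, scl; simpl; field.
    + apply (is_series_lev (fun j k nu => fam c lam (wj k + wj j) (fun z => jh (J z) j k) nu z)).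
      intros j k Hj Hk; apply ex_series_fam, (Sm_0 _ _ (S2 j k Hj Hk)).
Qed.
End Superpos.

(** * Choice of the parameters and construction of [phi] *)

Lemma exp_neg_pow_small A D e : 0 < e ->
  exists l0, forall l, l0 <= l -> exp (- l) * (A * l ^ D) <= e.
Proof.
  intros He; destruct (exp_neg_pow_bound (S D)) as [B [HB H]].
  exists (Rmax 1 (Rabs A * B / e)); intros l Hl.
  assert (H1 : 1 <= l) by (eapply Rle_trans; [apply Rmax_l|exact Hl]).
  assert (H2 : Rabs A * B / e <= l) by (eapply Rle_trans; [apply Rmax_r|exact Hl]).
  specialize (H l ltac:(lra)); simpl in H.
  apply Rmult_le_reg_l with l; [lra|].
  apply Rle_trans with (Rabs A * B).
  - replace (l * (exp (- l) * (A * l ^ D))) with (A * (l * l ^ D * exp (- l))) by ring.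
    assert (0 <= l * l ^ D * exp (- l)).
    { apply Rmult_le_pos; [|left; apply exp_pos]; apply Rmult_le_pos; [lra|apply pow_le; lra]. }
    assert (G := Rle_abs A); assert (G2 := Rabs_pos A); nra.
  - apply (Rmult_le_compat_r e) in H2; [|lra].
    replace (Rabs A * B / e * e) with (Rabs A * B) in H2 by (field; lra); lra.
Qed.

(** With [mu = K * ell^N], the recursion [lam (S k) = 2 * mu^2 * lam k] shrinks each disc to radius
    at most [/ 2] under all earlier dilations. The bound with the extra factor [exp (- ell k)] makes
    later copies negligible on disc [k]; the last one controls [|w|^2]. Given the previous [lam],
    the new one is polynomial in the new [ell], so the exponential wins. *)
Lemma parameters_exist (K eta : R) (N n0 : nat) : 1 <= K -> 0 < eta ->
  exists ell lam : nat -> R, forall k,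
    1 <= ell k /\ ell k + 1 <= ell (S k) /\ 1 <= lam k /\ 2 * (K * ell k ^ N) ^ 2 <= lam k /\
    lam (S k) = 2 * (K * ell (S k) ^ N) ^ 2 * lam k /\
    exp (- ell k) * lam k ^ (k + n0) <= eta * (/ 2) ^ k /\
    exp (- ell (S k)) * lam (S k) ^ (S k + n0) <= eta * (/ 2) ^ S k * exp (- ell k) /\
    exp (- ell k) * (1 + ell k ^ N) ^ 2 <= / 8.
Proof.
  intros HK He.
  set (P := fun (k : nat) (s : R * R) (l : R) =>
    fst s + 1 <= l /\
    exp (- l) * (2 * (K * l ^ N) ^ 2 * snd s) ^ (k + n0) <= eta * (/ 2) ^ k * exp (- fst s) /\
    exp (- l) * (1 + l ^ N) ^ 2 <= / 8).
  (* The premise stands under the quantifier so that the choice function is total in the state. *)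
  assert (HP : forall k s, exists l, 0 <= fst s -> P k s l).
  { intros k [l lam]; simpl fst.
    destruct (exp_neg_pow_small ((2 * K ^ 2 * lam) ^ (k + n0)) (2 * N * (k + n0))
      (eta * (/ 2) ^ k * exp (- l))) as [l1 H1].
    { apply Rmult_lt_0_compat; [|apply exp_pos]; apply Rmult_lt_0_compat; [easy|apply pow_lt; lra]. }
    destruct (exp_neg_pow_small 4 (2 * N) (/ 8)) as [l2 H2]; [lra|].
    exists (Rmax (l + 1) (Rmax l1 l2)); intros Hl.
    set (x := Rmax (l + 1) (Rmax l1 l2)).
    assert (Hx : l + 1 <= x) by apply Rmax_l.
    assert (Hx1 : l1 <= x) by (eapply Rle_trans; [apply Rmax_l|apply Rmax_r]).
    assert (Hx2 : l2 <= x) by (eapply Rle_trans; [apply Rmax_r|apply Rmax_r]).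
    split; [exact Hx|split]; simpl fst; simpl snd.
    - specialize (H1 x Hx1); eapply Rle_trans; [|exact H1]; right; f_equal.
      rewrite pow_mult, <- Rpow_mult_distr; f_equal; rewrite Nat.mul_comm, pow_mult; ring.
    - specialize (H2 x Hx2); eapply Rle_trans; [|exact H2].
      apply Rmult_le_compat_l; [left; apply exp_pos|].
      rewrite Nat.mul_comm, pow_mult; assert (1 <= x ^ N) by (apply pow_R1_Rle; lra); nra. }
  set (F := fun k s => proj1_sig (constructive_indefinite_description _ (HP k s))).
  assert (HF : forall k s, 0 <= fst s -> P k s (F k s))
    by (intros k s; unfold F; now destruct (constructive_indefinite_description _ (HP k s))).
  (* The state [(0, 1)] is a fictitious predecessor with [exp (- 0) = 1]; the sequences are read off
     one index later, so stage [k] of the recursion yields entry [k]. *)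
  set (st := fix st (k : nat) : R * R := match k with
    | O => (0, 1)
    | S k => (F k (st k), 2 * (K * F k (st k) ^ N) ^ 2 * snd (st k)) end).
  assert (Hst : forall k, 0 <= fst (st k) /\ 1 <= snd (st k)).
  { induction k as [|k [I1 I2]]; [simpl; lra|].
    destruct (HF k _ I1) as [H1 _].
    change (0 <= F k (st k) /\ 1 <= 2 * (K * F k (st k) ^ N) ^ 2 * snd (st k)).
    assert (1 <= F k (st k) ^ N) by (apply pow_R1_Rle; lra).
    assert (1 <= K * F k (st k) ^ N) by nra.
    assert (1 <= (K * F k (st k) ^ N) ^ 2) by now apply pow_R1_Rle.
    split; nra. }
  exists (fun k => fst (st (S k))), (fun k => snd (st (S k))); intros k.
  assert (G : forall k, fst (st k) + 1 <= fst (st (S k)) /\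
    snd (st (S k)) = 2 * (K * fst (st (S k)) ^ N) ^ 2 * snd (st k) /\
    exp (- fst (st (S k))) * snd (st (S k)) ^ (k + n0) <= eta * (/ 2) ^ k * exp (- fst (st k)) /\
    exp (- fst (st (S k))) * (1 + fst (st (S k)) ^ N) ^ 2 <= / 8).
  { intros i; destruct (HF i _ (proj1 (Hst i))) as [H1 [H2 H3]].
    split; [exact H1|]; split; [reflexivity|]; split; [exact H2|exact H3]. }
  destruct (G k) as [G1 [G2 [G3 G4]]]; destruct (G (S k)) as [G5 [G6 [G7 _]]].
  destruct (Hst k) as [I1 I2]; destruct (Hst (S k)) as [_ I3].
  split; [lra|]; split; [exact G5|]; split; [exact I3|]; split.
  { rewrite G2; assert (G8 := pow2_ge_0 (K * fst (st (S k)) ^ N)); nra. }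
  split; [exact G6|]; split; [|split; [exact G7|exact G4]].
  eapply Rle_trans; [exact G3|].
  assert (exp (- fst (st k)) <= 1).
  { rewrite <- exp_0; destruct I1 as [I1|I1]; [left; apply exp_increasing; lra|right; f_equal; lra]. }
  assert (0 < eta * (/ 2) ^ k) by (apply Rmult_lt_0_compat; [easy|apply pow_lt; lra]); nra.
Qed.

Lemma Series_le_exceptional (u : nat -> R) k e : 0 <= e -> ex_series u ->
  (forall n, n <> k -> u n <= e * (/ 2) ^ n) -> Series u <= u k + 2 * e.
Proof.
  intros He Hu H.
  assert (Hs : forall n, sum_n u n <= e * (2 - (/ 2) ^ n) + (if le_dec k n then u k else 0)).
  { assert (Hp : forall n, 0 < (/ 2) ^ n) by (intros; apply pow_lt; lra).
    induction n as [|n IH].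
    - rewrite sum_O; destruct (le_dec k 0) as [Hk|Hk]; simpl.
      + replace k with 0%nat by lia; lra.
      + specialize (H 0%nat ltac:(lia)); simpl in H; lra.
    - rewrite sum_Sn; change (plus (sum_n u n) (u (S n))) with (sum_n u n + u (S n)).
      assert (Hn := Hp n); simpl pow.
      destruct (Nat.eq_dec (S n) k) as [E|E].
      + destruct (le_dec k n); [lia|]; destruct (le_dec k (S n)); [|lia]; rewrite E; nra.
      + specialize (H (S n) E); simpl pow in H.
        destruct (le_dec k n); destruct (le_dec k (S n)); try lia; nra. }
  assert (Hl : is_lim_seq (sum_n u) (Series u)) by apply (Series_correct u Hu).
  apply (is_lim_seq_le_loc (sum_n u) (fun _ => u k + 2 * e) (Series u) (u k + 2 * e));
    [|exact Hl|apply is_lim_seq_const].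
  exists k; intros n Hn; specialize (Hs n); destruct (le_dec k n); [|lia].
  assert (0 < (/ 2) ^ n) by (apply pow_lt; lra); nra.
Qed.

Lemma partials_poly_bd (f : C3 -> R) : @Sm Cspace 1 f ->
  exists A m, 0 <= A /\ (forall z, Rabs (f z) <= A * wt Cspace z ^ m) /\
    forall j z l, (j < 6)%nat -> has_partial f j z l -> Rabs l <= A * wt Cspace z ^ m.
Proof.
  intros [[_ [A0 [m0 [HA0 H0]]]] HS].
  assert (G : forall J, (J <= 6)%nat -> exists A m, 0 <= A /\
    (forall z, Rabs (f z) <= A * wt Cspace z ^ m) /\
    forall j z l, (j < J)%nat -> has_partial f j z l -> Rabs l <= A * wt Cspace z ^ m).
  { induction J as [|J IH]; intros HJ.
    - exists A0, m0; split; [easy|]; split; [exact H0|]; intros; lia.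
    - destruct (IH ltac:(lia)) as [A [m [HA [Hf Hd]]]].
      destruct (HS J HJ) as [g [Hg [[_ [A' [m' [HA' Hb]]]] _]]].
      assert (L : forall z, A * wt Cspace z ^ m <= (A + A') * wt Cspace z ^ (m + m') /\
        A' * wt Cspace z ^ m' <= (A + A') * wt Cspace z ^ (m + m')).
      { intros z; rewrite pow_add.
        assert (P := @wt_pow_ge1 Cspace z m); assert (P' := @wt_pow_ge1 Cspace z m').
        set (x := wt Cspace z ^ m) in *; set (y := wt Cspace z ^ m') in *.
        assert (A * x <= A * (x * y)) by (apply Rmult_le_compat_l; nra).
        assert (A' * y <= A' * (x * y)) by (apply Rmult_le_compat_l; nra).
        assert (0 <= A * (x * y)) by (apply Rmult_le_pos; nra).
        assert (0 <= A' * (x * y)) by (apply Rmult_le_pos; nra). lra. }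
      exists (A + A'), (m + m')%nat; split; [lra|]; split.
      + intros z; eapply Rle_trans; [apply Hf|apply L].
      + intros j z l Hj Hl; destruct (Nat.eq_dec j J) as [->|E].
        * rewrite (uniqueness_limite _ _ _ _ Hl (Hg z)); eapply Rle_trans; [apply Hb|apply L].
        * eapply Rle_trans; [apply (Hd j z l); [lia|exact Hl]|apply L]. }
  apply (G 6%nat); lia.
Qed.

Lemma scl_curve l s w : scl l (curve s w) = curve (Cmul (l, 0) s) w.
Proof.
  destruct s as [s t]; destruct w as [u v]; apply C3_ext; intros i Hi.
  do 6 (destruct i as [|i]; [simpl; ring|]); exfalso; clear -Hi; lia.
Qed.

Lemma psh_superposition_exists (N : nat) :
  exists (phi : C3 -> R) (gphi : nat -> C3 -> R) (ell : nat -> R),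
  (forall k, @Sm Cspace k phi) /\ psh_jet phi /\
  (forall j z, (j < 6)%nat -> has_partial phi j z (gphi j z)) /\
  (forall j, (j < 6)%nat -> gphi j (C0, C0, C0) = 0) /\
  (forall z, wt Cspace z <= 5 -> Rabs (phi z) <= / 100 /\
     forall j, (j < 6)%nat -> Rabs (gphi j z) <= / 100) /\
  (forall z, - ((1 + sq2 z) / 16) <= phi z) /\
  (forall x y w w', phi (x, y, w) = phi (x, y, w')) /\
  (forall w, phi (C0, C0, w) = 0) /\
  (forall k, 1 <= ell k /\ ell k + 1 <= ell (S k) /\ exp (- ell k) * (1 + ell k ^ N) ^ 2 <= / 8) /\
  (forall k, exists b, 0 <= b <= / 2 /\ forall zeta w, fst zeta ^ 2 + snd zeta ^ 2 <= 1 ->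
     phi (curve (Cmul (b, 0) zeta) w) <= exp (- ell k) / 2 - exp (- ell k) * ell k ^ N * fst zeta).
Proof.
  destruct model_exists as [Psi [B [HB [SP [PP [GP [LP [IP [UP ZP]]]]]]]]].
  destruct (partials_poly_bd Psi (SP 1%nat)) as [A [m [HA [HPsi HdPsi]]]].
  (* The [6 * m] powers come from dilating the weight; 9 leaves room for the at most 3 powers from a
     first derivative and for the 6 in the lower bound on [phi]. *)
  set (n0 := (9 + 6 * m)%nat).
  set (X := 200 * (A * 5 ^ m)).
  assert (HX : 0 <= X) by (unfold X; assert (0 <= 5 ^ m) by (apply pow_le; lra); nra).
  (* Three demands at once: 48 gives [3 * eta <= / 16] for the lower bound, where the sum is
     estimated by three times its first bound; [X] gives [2 * eta * A * 5^m <= / 100]; [8 * (B + 1)]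
     keeps the later copies below [/ 8]. *)
  set (eta := / (48 + X + 8 * (B + 1))).
  assert (He : 0 < eta) by (apply Rinv_0_lt_compat; lra).
  assert (He1 : eta * (48 + X + 8 * (B + 1)) = 1) by (unfold eta; field; lra).
  assert (HeX : 0 <= eta * X) by (apply Rmult_le_pos; lra).
  assert (HeB : 0 <= eta * B) by (apply Rmult_le_pos; lra).
  (* Ensures [B / K <= / 4], so the loss of the main copy is at most a quarter of
     [exp (- ell k)]. *)
  set (K := 1 + 4 * B).
  destruct (parameters_exist K eta N n0) as [ell [lam HP]]; [unfold K; lra|easy|].
  (* Normalised so that [c k * mu^2 = exp (- ell k) * ell k ^ N] for [mu = K * ell k ^ N]. *)
  set (c := fun k => exp (- ell k) / (K ^ 2 * ell k ^ N)).
  assert (HN : forall k, 1 <= ell k ^ N) by (intros k; apply pow_R1_Rle, HP).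
  assert (HKN : forall k, 1 <= K ^ 2 * ell k ^ N).
  { intros k; specialize (HN k); assert (1 <= K ^ 2) by (apply pow_R1_Rle; unfold K; lra); nra. }
  assert (Hc0 : forall k, 0 < c k).
  { intros k; unfold c; apply Rdiv_lt_0_compat; [apply exp_pos|]; specialize (HKN k); lra. }
  assert (Hc1 : forall k, c k <= exp (- ell k)).
  { intros k; unfold c; assert (E := exp_pos (- ell k)); specialize (HKN k).
    apply Rmult_le_reg_r with (K ^ 2 * ell k ^ N); [lra|].
    unfold Rdiv; rewrite Rmult_assoc, Rinv_l by lra; nra. }
  assert (Hl1 : forall k, 1 <= lam k) by (intros; apply HP).
  assert (Hc2 : forall k i, (i <= k + n0)%nat -> c k * lam k ^ i <= exp (- ell k) * lam k ^ (k + n0)).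
  { intros k i Hi; apply Rmult_le_compat; [left; apply Hc0| |apply Hc1|now apply Rle_pow].
    apply pow_le; specialize (Hl1 k); lra. }
  assert (Hcs : forall k, c k * lam k ^ (k + n0) <= eta * (/ 2) ^ k).
  { intros k; eapply Rle_trans; [apply Hc2; lia|apply HP]. }
  assert (Hlm : forall i k, (i <= k)%nat -> lam i <= lam k).
  { intros i k Hik; induction Hik as [|k Hik IH]; [lra|].
    destruct (HP k) as [_ [_ [_ [_ [-> _]]]]]; specialize (Hl1 k).
    assert (1 <= (K * ell (S k) ^ N) ^ 2).
    { apply pow_R1_Rle; specialize (HN (S k)); unfold K; nra. }
    nra. }
  assert (Hll : forall i k, (i <= k)%nat -> ell i <= ell k).
  { intros i k Hik; induction Hik as [|k Hik IH]; [lra|]; destruct (HP k) as [_ [H _]]; lra. }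
  assert (Hexp : forall i k, (i <= k)%nat -> exp (- ell k) <= exp (- ell i)).
  { intros i k Hik; destruct (Hll i k Hik) as [H|H]; [left; apply exp_increasing; lra|right; now rewrite H]. }
  set (phi := superpos c lam 0 Psi).
  assert (HbP : @poly_bd Cspace Psi) by apply (Sm_0 0 _ (SP 0%nat)).
  assert (Hc0' : forall k, 0 <= c k) by (intros; left; apply Hc0).
  assert (Hex : forall z, ex_series (fun k => fam c lam 0 Psi k z)).
  { intros z; now apply (ex_series_fam c lam eta n0 Hc0' Hl1 (Rlt_le _ _ He) Hcs). }
  destruct PP as [J [[EJ [D1 D2]] HL]].
  set (gphi := fun j => superpos c lam (0 + wj j) (fun z => jg (J z) j)).
  assert (Sg : forall j, (j < 6)%nat -> @Sm Cspace 0 (fun z => jg (J z) j)).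
  { intros j Hj; apply (@Sm_der Cspace 0 Psi j); auto; intros z; now apply D1. }
  exists phi, gphi, ell.
  split; [|split; [|split; [|split; [|split; [|split; [|split; [|split; [|split]]]]]]]].
  - intros k; now apply (Sm_superpos c lam eta n0 Hc0' Hl1 (Rlt_le _ _ He) Hcs).
  - apply (psh_superpos c lam eta n0 Hc0' Hl1 (Rlt_le _ _ He) Hcs); [|exact SP].
    exists J; split; [split; [exact EJ|split; assumption]|exact HL].
  - intros j z Hj; destruct (Sm_0 _ _ (Sg j Hj)) as [Cg Bg].
    apply (has_der_superpos c lam eta n0 Hc0' Hl1 (Rlt_le _ _ He) Hcs Psi); auto; intros y; now apply D1.
  - intros j Hj; unfold gphi, superpos.
    rewrite (Series_ext _ (fun _ => 0 * 0)); [rewrite Series_scal_l; ring|].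
    intros k; unfold fam.
    replace (scl (lam k) (C0, C0, C0)) with (C0, C0, C0)
      by (apply C3_ext; intros i Hi; do 6 (destruct i as [|i]; [simpl; ring|]); exfalso; clear -Hi; lia).
    rewrite (uniqueness_limite _ _ _ _ (D1 (C0, C0, C0) j Hj) (GP j Hj)); ring.
  - intros z Hz.
    assert (HW : eta * A * wt Cspace z ^ m <= / 200).
    { assert (wt Cspace z ^ m <= 5 ^ m) by (apply pow_incr; split; [assert (G := wt_ge1 Cspace z); lra|easy]).
      apply Rle_trans with (eta * A * 5 ^ m); [apply Rmult_le_compat_l; [apply Rmult_le_pos; lra|easy]|].
      unfold X in *; nra. }
    split.
    + eapply Rle_trans; [apply (superpos_small c lam eta n0 Hc0' Hl1 Hcs Psi A m); auto; lia|lra].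
    + intros j Hj.
      eapply Rle_trans; [apply (superpos_small c lam eta n0 Hc0' Hl1 Hcs
        (fun z => jg (J z) j) A m); auto|lra].
      * intros y; apply (HdPsi j y); auto.
      * unfold n0; do 6 (destruct j as [|j]; [simpl; lia|]); lia.
  - intros z.
    assert (HQ : 0 <= sq2 z) by (unfold sq2; nra).
    assert (HF : forall k, - fam c lam 0 Psi k z <= eta * (1 + sq2 z) * (/ 2) ^ k).
    { intros k; unfold fam; rewrite pow_O, Rmult_1_r.
      assert (H1 := LP (scl (lam k) z)).
      assert (H2 : 1 + sq2 (scl (lam k) z) <= lam k ^ 6 * (1 + sq2 z)).
      { assert (E : forall i a, (i <= 3)%nat -> (lam k ^ i * a) ^ 2 <= lam k ^ 6 * a ^ 2).
        { intros i a Hi; rewrite Rpow_mult_distr; apply Rmult_le_compat_r; [apply pow2_ge_0|].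
          rewrite <- pow_mult; apply Rle_pow; [apply Hl1|lia]. }
        unfold sq2; rewrite !crd_scl by lia; simpl wj.
        assert (H0 := E 2%nat (crd 0 z) ltac:(lia)); assert (H2 := E 2%nat (crd 1 z) ltac:(lia));
        assert (H3 := E 3%nat (crd 2 z) ltac:(lia)); assert (H4 := E 3%nat (crd 3 z) ltac:(lia)).
        assert (H6 : 1 <= lam k ^ 6) by (apply pow_R1_Rle, Hl1); lra. }
      assert (H3 : c k * lam k ^ 6 <= eta * (/ 2) ^ k).
      { eapply Rle_trans; [|apply Hcs]; apply Rmult_le_compat_l; [auto|]; apply Rle_pow; [auto|lia]. }
      apply Rle_trans with (c k * (lam k ^ 6 * (1 + sq2 z))).
      - replace (- (c k * Psi (scl (lam k) z))) with (c k * - Psi (scl (lam k) z)) by ring.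
        apply Rmult_le_compat_l; [auto|lra].
      - rewrite <- Rmult_assoc; replace (eta * (1 + sq2 z) * (/ 2) ^ k) with (eta * (/ 2) ^ k * (1 + sq2 z)) by ring.
        apply Rmult_le_compat_r; lra. }
    assert (HS := Series_le_exceptional (fun k => - fam c lam 0 Psi k z) 0 (eta * (1 + sq2 z))).
    rewrite Series_opp in HS.
    assert (HE : 0 <= eta * (1 + sq2 z)) by (apply Rmult_le_pos; lra).
    specialize (HS HE (ex_series_opp _ (Hex z)) (fun k _ => HF k)).
    specialize (HF 0%nat); simpl pow in HF; unfold phi, superpos.
    cbv beta in HS; assert (eta <= / 48) by lra.
    assert (eta * (1 + sq2 z) <= / 48 * (1 + sq2 z)) by (apply Rmult_le_compat_r; lra).
    lra.
  - intros [a b] [p q] w w'; unfold phi, superpos; apply Series_ext; intros k; unfold fam; f_equal; apply IP.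
  - intros w; unfold phi, superpos.
    rewrite (Series_ext _ (fun _ => 0 * 0)); [rewrite Series_scal_l; ring|].
    intros k; unfold fam.
    replace (scl (lam k) (C0, C0, w)) with (curve C0 w)
      by (destruct w as [u v]; apply C3_ext; intros i Hi;
          do 6 (destruct i as [|i]; [simpl; ring|]); exfalso; clear -Hi; lia).
    rewrite ZP by (unfold C0; simpl; lra); ring.
  - intros k; destruct (HP k) as [H1 [H2 [_ [_ [_ [_ [_ H3]]]]]]]; auto.
  - intros k; set (mu := K * ell k ^ N).
    assert (Hmu : 1 <= mu) by (unfold mu; specialize (HN k); unfold K; nra).
    assert (Hlk : 2 * mu ^ 2 <= lam k) by apply HP.
    specialize (Hl1 k) as Hlk1.
    (* The dilation by [lam k] carries [b * zeta] to [mu^2 * zeta], so the k-th copy sees the disc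
       of radius [M = mu^2]. *)
    exists (mu ^ 2 / lam k); set (b := mu ^ 2 / lam k).
    assert (Hb : lam k * b = mu ^ 2) by (unfold b; field; lra).
    assert (Hmu2 : 0 < mu ^ 2) by (apply pow_lt; lra).
    assert (Hb0 : 0 <= b <= / 2) by (split; nra).
    split; [exact Hb0|]; intros [s t] w Hz; simpl fst in *; simpl snd in *.
    assert (HcM : c k * mu ^ 2 = exp (- ell k) * ell k ^ N).
    { unfold c, mu; specialize (HN k); set (x := ell k ^ N) in *; field; split; [lra|unfold K; lra]. }
    assert (HcB : c k * (B * mu) <= exp (- ell k) / 4).
    { unfold c, mu; specialize (HN k); set (x := ell k ^ N) in *.
      replace (exp (- ell k) / (K ^ 2 * x) * (B * (K * x))) with (exp (- ell k) * (B / K))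
        by (field; split; unfold K; lra).
      assert (B / K <= / 4) by (apply Rmult_le_reg_r with K; unfold Rdiv; [unfold K; lra|];
        rewrite Rmult_assoc, Rinv_l by (unfold K; lra); unfold K; lra).
      assert (E := exp_pos (- ell k)); nra. }
    set (z := curve (Cmul (b, 0) (s, t)) w).
    assert (Hfam : forall i, fam c lam 0 Psi i z =
      c i * Psi (curve (lam i * b * s, lam i * b * t) w)).
    { intros i; unfold fam, z; rewrite scl_curve, pow_O, Rmult_1_r; do 3 f_equal.
      unfold Cmul; simpl; f_equal; ring. }
    assert (Hother : forall i, i <> k -> fam c lam 0 Psi i z <= exp (- ell k) / 8 * (/ 2) ^ i).
    { intros i Hi; rewrite Hfam.
      assert (E := exp_pos (- ell k)); assert (Ei : 0 < (/ 2) ^ i) by (apply pow_lt; lra).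
      assert (Li := Hl1 i).
      assert (E2 : (lam i * b * s) ^ 2 + (lam i * b * t) ^ 2 = (lam i * b) ^ 2 * (s ^ 2 + t ^ 2)) by ring.
      assert (Hlb : 0 <= lam i * b) by nra.
      destruct (Nat.lt_ge_cases i k) as [Hik|Hik].
      (* Earlier copies: the recursion for [lam] gives [lam i * b <= / 2], and [Psi] vanishes on
         that part of the cusp. *)
      - rewrite ZP; [rewrite Rmult_0_r; nra|]; simpl fst; simpl snd; rewrite E2.
        assert (lam i * b <= / 2).
        { destruct k as [|k']; [lia|].
          destruct (HP k') as [_ [_ [_ [_ [E3 _]]]]]; fold mu in E3.
          assert (Hik' := Hlm i k' ltac:(lia)); assert (Hk' := Hl1 k').
          assert (E4 : 2 * lam k' * b = 1).
          { apply Rmult_eq_reg_l with (mu ^ 2); [|lra]; rewrite E3 in Hb; clearbody b; lra. }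
          nra. }
        assert (H1 : 0 <= (lam i * b) ^ 2 <= / 4) by (split; nra).
        assert (H2 : 0 <= s ^ 2 + t ^ 2 <= 1) by (split; nra).
        set (x := (lam i * b) ^ 2) in *; set (y := s ^ 2 + t ^ 2) in *.
        assert (0 <= x * y <= / 4) by (split; nra); nra.
      (* Later copies: a crude bound linear in [lam i] suffices, because [c i] was chosen against
         [exp (- ell k)]. *)
      - assert (HU : Psi (curve (lam i * b * s, lam i * b * t) w) <= B * lam i - lam i * b * s).
        { apply UP; [easy|]; simpl fst; simpl snd; rewrite E2.
          assert (H1 : (lam i * b) ^ 2 <= lam i ^ 2) by (apply pow_incr; split; nra).
          assert (H2 : lam i ^ 2 <= lam i ^ 4) by (apply Rle_pow; [easy|lia]).
          assert (0 <= s ^ 2 + t ^ 2) by nra; assert (0 <= (lam i * b) ^ 2) by apply pow2_ge_0; nra. }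
        assert (Hs : -1 <= s <= 1) by (split; nra).
        assert (HU2 : Psi (curve (lam i * b * s, lam i * b * t) w) <= (B + 1) * lam i).
        { assert (lam i * b <= lam i) by nra; nra. }
        assert (Hci : c i * lam i <= eta * (/ 2) ^ i * exp (- ell k)).
        { destruct i as [|i]; [lia|].
          apply Rle_trans with (exp (- ell (S i)) * lam (S i) ^ (S i + n0)).
          - rewrite <- (pow_1 (lam (S i))) at 1; apply Hc2; lia.
          - eapply Rle_trans; [apply HP|]; apply Rmult_le_compat_l; [nra|]; apply Hexp; lia. }
        apply Rle_trans with (c i * ((B + 1) * lam i)); [now apply Rmult_le_compat_l|].
        replace (c i * ((B + 1) * lam i)) with ((B + 1) * (c i * lam i)) by ring.
        apply Rle_trans with ((B + 1) * (eta * (/ 2) ^ i * exp (- ell k))); [apply Rmult_le_compat_l; lra|].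
        assert (HB8 : (B + 1) * eta <= / 8) by lra.
        replace ((B + 1) * (eta * (/ 2) ^ i * exp (- ell k)))
          with ((B + 1) * eta * ((/ 2) ^ i * exp (- ell k))) by ring.
        assert (0 < (/ 2) ^ i * exp (- ell k)) by now apply Rmult_lt_0_compat.
        nra. }
    (* Budget: the other copies add at most [2 * (exp (- ell k) / 8)] and [HcB] gives
       [exp (- ell k) / 4], together [exp (- ell k) / 2]. *)
    assert (HS := Series_le_exceptional (fun i => fam c lam 0 Psi i z) k (exp (- ell k) / 8)).
    assert (E := exp_pos (- ell k)).
    specialize (HS ltac:(lra) (Hex z) Hother); cbv beta in HS; fold (superpos c lam 0 Psi z) in HS.
    rewrite Hfam, Hb in HS.
    assert (HU := UP (mu ^ 2 * s, mu ^ 2 * t) w mu Hmu); simpl fst in HU; simpl snd in HU.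
    assert (HU1 : Psi (curve (mu ^ 2 * s, mu ^ 2 * t) w) <= B * mu - mu ^ 2 * s).
    { apply HU; replace ((mu ^ 2 * s) ^ 2 + (mu ^ 2 * t) ^ 2) with (mu ^ 4 * (s ^ 2 + t ^ 2)) by ring.
      assert (0 <= mu ^ 4) by (apply pow_le; lra); nra. }
    assert (HU2 := Rmult_le_compat_l (c k) _ _ (Hc0' k) HU1).
    replace (c k * (B * mu - mu ^ 2 * s)) with (c k * (B * mu) - (c k * mu ^ 2) * s) in HU2 by ring.
    rewrite HcM in HU2; unfold phi; lra.
Qed.

(** * The domain *)

Definition mk (f : nat -> R) : C3 :=
  ((f 0%nat, f 1%nat), (f 2%nat, f 3%nat), (f 4%nat, f 5%nat)).

Lemma crd_mk i f : (i < 6)%nat -> crd i (mk f) = f i.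
Proof. intros Hi; do 6 (destruct i as [|i]; [reflexivity|]); exfalso; clear -Hi; lia. Qed.

Lemma clamp_lipschitz s t : Rabs (Rmax 0 (Rmin 1 s) - Rmax 0 (Rmin 1 t)) <= Rabs (s - t).
Proof.
  unfold Rmax, Rmin; repeat destruct Rle_dec; unfold Rabs; repeat destruct Rcase_abs; lra.
Qed.

(** Along the segment, membership in [U] is a locally constant function with values [-1] and [1]; a
    change of sign would contradict the intermediate value theorem. Clamping the parameter makes
    this function continuous on the whole line. *)
Lemma segment_stays (U V D : C3 -> Prop) (al be : nat -> R) :
  open_set U -> open_set V -> (forall z, D z -> U z \/ V z) -> (forall z, D z -> U z -> V z -> False) ->
  (forall t, 0 <= t <= 1 -> D (mk (fun i => al i + t * be i))) ->
  U (mk al) -> U (mk (fun i => al i + be i)).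
Proof.
  intros HU HV Hcov Hdis HD H0.
  set (ga := fun t => mk (fun i => al i + t * be i)).
  set (cl := fun t => Rmax 0 (Rmin 1 t)).
  assert (Hcl : forall t, 0 <= cl t <= 1).
  { intros t; unfold cl, Rmax, Rmin; repeat destruct Rle_dec; lra. }
  assert (E0 : ga (cl 0) = mk al).
  { apply C3_ext; intros i Hi; unfold ga; rewrite !crd_mk by easy.
    replace (cl 0) with 0 by (unfold cl, Rmax, Rmin; repeat destruct Rle_dec; lra); ring. }
  assert (E1 : ga (cl 1) = mk (fun i => al i + be i)).
  { apply C3_ext; intros i Hi; unfold ga; rewrite !crd_mk by easy.
    replace (cl 1) with 1 by (unfold cl, Rmax, Rmin; repeat destruct Rle_dec; lra); ring. }
  destruct (excluded_middle_informative (U (mk (fun i => al i + be i)))) as [|HN]; [assumption|exfalso].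
  set (g := fun t => if excluded_middle_informative (U (ga (cl t))) then -1 else 1).
  assert (Hlip : exists L, 0 < L /\ forall s t, V3norm (V3sub (ga (cl s)) (ga (cl t))) <= L * Rabs (s - t)).
  { exists (1 + V3norm (mk be)).
    assert (Hn : 0 <= V3norm (mk be)) by apply sqrt_pos.
    split; [lra|]; intros s t.
    assert (E : V3norm (V3sub (ga (cl s)) (ga (cl t))) = Rabs (cl s - cl t) * V3norm (mk be)).
    { rewrite !V3norm_sq3, <- sqrt_Rsqr_abs, <- sqrt_mult_alt by apply Rle_0_sqr; f_equal.
      unfold sq3, ga, Rsqr; rewrite !crd_sub, !crd_mk by lia; ring. }
    rewrite E; assert (HC := clamp_lipschitz s t : Rabs (cl s - cl t) <= Rabs (s - t)).
    assert (0 <= Rabs (cl s - cl t)) by apply Rabs_pos; nra. }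
  destruct Hlip as [L [HL Hlip]].
  assert (Hloc : forall W : C3 -> Prop, open_set W -> forall t, W (ga (cl t)) ->
    exists d, 0 < d /\ forall s, Rabs (s - t) < d -> W (ga (cl s))).
  { intros W HW t Ht; destruct (HW _ Ht) as [e [He K]]; exists (e / L); split; [now apply Rdiv_lt_0_compat|].
    intros s Hs; apply K; eapply Rle_lt_trans; [apply Hlip|].
    apply (Rmult_lt_compat_l L) in Hs; [|easy]; replace (L * (e / L)) with e in Hs by (field; lra); exact Hs. }
  assert (Hg : continuity g).
  { intros t e He.
    assert (HDt := HD _ (Hcl t)); fold (ga (cl t)) in HDt.
    destruct (excluded_middle_informative (U (ga (cl t)))) as [HUt|HUt].
    - destruct (Hloc U HU t HUt) as [d [Hd K]]; exists d; split; [easy|]; intros s [_ Hs].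
      specialize (K s Hs); unfold g; cbn [dist R_met]; unfold Rdist.
      destruct (excluded_middle_informative (U (ga (cl s)))); [|contradiction].
      destruct (excluded_middle_informative (U (ga (cl t)))); [|contradiction].
      rewrite Rminus_diag, Rabs_R0; lra.
    - destruct (Hcov _ HDt) as [|HVt]; [contradiction|].
      destruct (Hloc V HV t HVt) as [d [Hd K]]; exists d; split; [easy|]; intros s [_ Hs].
      specialize (K s Hs); unfold g; cbn [dist R_met]; unfold Rdist.
      destruct (excluded_middle_informative (U (ga (cl s)))) as [H|H].
      + exfalso; apply (Hdis (ga (cl s))); auto; apply HD, Hcl.
      + destruct (excluded_middle_informative (U (ga (cl t)))); [contradiction|].
        rewrite Rminus_diag, Rabs_R0; lra. }
  destruct (IVT g 0 1 Hg) as [t [_ Ht]]; try lra.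
  - unfold g; rewrite E0; destruct (excluded_middle_informative (U (mk al))); [lra|contradiction].
  - unfold g; rewrite E1; destruct (excluded_middle_informative (U (mk (fun i => al i + be i)))); [contradiction|lra].
  - unfold g in Ht; destruct (excluded_middle_informative (U (ga (cl t)))); lra.
Qed.

Definition jsq2 (z : C3) : jet := jadd (jx2 z) (jy2 z).
Definition jw (z : C3) : jet :=
  jadd (jcrd 4 z) (jadd (jmul (jcrd 4 z) (jcrd 4 z)) (jmul (jcrd 5 z) (jcrd 5 z))).

Section Domain.
Context (phi : C3 -> R) (gphi : nat -> C3 -> R) (chi chi1 chi2 : R -> R).
Context (phi_Sm : forall k, @Sm Cspace k phi) (phi_psh : psh_jet phi)
  (phi_der : forall j z, (j < 6)%nat -> has_partial phi j z (gphi j z))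
  (gphi_0 : forall j, (j < 6)%nat -> gphi j (C0, C0, C0) = 0)
  (phi_small : forall z, wt Cspace z <= 5 -> Rabs (phi z) <= / 100 /\
     forall j, (j < 6)%nat -> Rabs (gphi j z) <= / 100)
  (phi_lower : forall z, - ((1 + sq2 z) / 16) <= phi z)
  (phi_indep : forall x y w w', phi (x, y, w) = phi (x, y, w'))
  (phi_0 : forall w, phi (C0, C0, w) = 0).
Context (chi_Sm : forall k, @Sm line k chi)
  (chi_der : forall t, derivable_pt_lim chi t (chi1 t))
  (chi1_der : forall t, derivable_pt_lim chi1 t (chi2 t))
  (chi_0 : forall t, t <= / 4 -> chi t = 0) (chi_nonneg : forall t, 0 <= chi t)
  (chi1_nonneg : forall t, 0 <= chi1 t) (chi2_nonneg : forall t, 0 <= chi2 t)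
  (chi_lower : forall t, t - 5 / 4 <= chi t)
  (chi_le : forall t, 0 <= t -> chi t <= t * chi1 t)
  (chi_convex : forall s t, s <= t -> chi1 s * (t - s) <= chi t - chi s).

Definition jbase (z : C3) : jet := jadd (jw z) (jcomp chi chi1 chi2 (jsq2 z)).
Definition rho (z : C3) : R := jv (jbase z) + phi z.
Definition dom (z : C3) : Prop := rho z < 0.
Definition grho (j : nat) (z : C3) : R := jg (jbase z) j + gphi j z.

Lemma rhoE z : rho z = crd 4 z + crd 4 z ^ 2 + crd 5 z ^ 2 + chi (sq2 z) + phi z.
Proof.
  unfold rho, jbase, jsq2; cbn [jv jadd jmul jcomp].
  replace (jv (jx2 z) + jv (jy2 z)) with (sq2 z) by (unfold sq2; simpl; ring).
  simpl; ring.
Qed.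

Lemma is_jet_base : is_jet (fun z => jv (jbase z)) jbase.
Proof. unfold jbase, jw, jsq2, jx2, jy2; cbn [jv jadd jmul jcrd jconst jcomp]; is_jet_tac. Qed.

Lemma rho_der j z : (j < 6)%nat -> has_partial rho j z (grho j z).
Proof.
  intros Hj; apply (@has_der_plus Cspace (fun z => jv (jbase z)) phi); [|now apply phi_der].
  now apply is_jet_base.
Qed.

Lemma rho_Sm k : @Sm Cspace k rho.
Proof.
  apply (@Sm_plus Cspace k (fun z => jv (jbase z)) phi); [|auto].
  apply (@Sm_plus Cspace k (fun z => jv (jw z)) (fun z => chi (jv (jsq2 z)))).
  - repeat first [apply Sm_crd; lia | apply (@Sm_plus Cspace) | apply (@Sm_mult Cspace)].
  - apply (@Sm_comp Cspace k chi (fun z => jv (jsq2 z))); [auto|].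
    repeat first [apply Sm_crd; lia | apply (@Sm_plus Cspace) | apply (@Sm_mult Cspace)].
Qed.

Lemma rho_psh : psh_jet rho.
Proof.
  apply (psh_jet_add (fun z => jv (jbase z)) phi); [|exact phi_psh].
  exists jbase; split; [exact is_jet_base|]; intros z v; unfold jbase.
  rewrite lev_add, lev_comp; unfold jsq2.
  set (R0 := jv (jadd (jx2 z) (jy2 z))).
  replace (lev (jh (jw z)) v) with (crd 4 v ^ 2 + crd 5 v ^ 2).
  2:{ unfold jw; autorewrite with jet; unfold dre, dim; simpl; field. }
  replace (lev (jh (jadd (jx2 z) (jy2 z))) v)
    with (crd 0 v ^ 2 + crd 1 v ^ 2 + (crd 2 v ^ 2 + crd 3 v ^ 2)).
  2:{ unfold jx2, jy2; jet_simpl z v; field. }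
  assert (H1 := chi1_nonneg R0); assert (H2 := chi2_nonneg R0).
  assert (0 <= chi1 R0 * (crd 0 v ^ 2 + crd 1 v ^ 2 + (crd 2 v ^ 2 + crd 3 v ^ 2)))
    by (apply Rmult_le_pos; [easy|nra]).
  match goal with |- context [chi2 R0 * ?X] => assert (0 <= chi2 R0 * X) end.
  { apply Rmult_le_pos; [easy|].
    set (x := dre _ _); set (y := dim _ _); nra. }
  assert (G1 := pow2_ge_0 (crd 4 v)); assert (G2 := pow2_ge_0 (crd 5 v)); lra.
Qed.

Lemma dom_open : open_set dom.
Proof.
  intros z Hz; destruct (Sm_0 0 _ (rho_Sm 0)) as [Hc _].
  destruct (Hc z (- rho z)) as [d [Hd K]]; [unfold dom in Hz; lra|].
  exists d; split; [easy|]; intros w Hw; specialize (K w Hw); unfold dom.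
  apply Rabs_def2 in K; lra.
Qed.

(** [Re w + |w|^2 = |w + 1/2|^2 - 1/4] bounds [w], and the slope 1 of [chi] beats the slope [-1/16]
    allowed for [phi]. The ball [wt <= 5] obtained here is the one on which [phi] was made small. *)
Lemma dom_bounds z : rho z <= 0 -> sq2 z <= 2 /\ wt Cspace z <= 5.
Proof.
  rewrite rhoE; intros H.
  assert (H1 := phi_lower z); assert (H2 := chi_lower (sq2 z)); assert (H3 := chi_nonneg (sq2 z)).
  assert (E : wt Cspace z = 1 + sq2 z + (crd 4 z ^ 2 + crd 5 z ^ 2)) by (cbn [wt Cspace]; unfold sq3, sq2; ring).
  set (u := crd 4 z) in *; set (v := crd 5 z) in *.
  assert (G1 := pow2_ge_0 (u + / 2)); assert (G2 := pow2_ge_0 v).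
  assert (Hs : sq2 z <= 2) by nra.
  split; [easy|]; rewrite E.
  assert (Hu : -2 <= u) by nra. lra.
Qed.

Lemma boundary_zero z : boundary_point dom z -> rho z = 0.
Proof.
  intros [H1 H2]; unfold dom in H1; destruct (Rle_lt_dec (rho z) 0) as [H|H]; [lra|exfalso].
  destruct (Sm_0 0 _ (rho_Sm 0)) as [Hc _].
  destruct (Hc z (rho z) H) as [d [Hd K]]; destruct (H2 d Hd) as [w [Hw1 Hw2]].
  specialize (K w Hw2); unfold dom in Hw1; apply Rabs_def2 in K; lra.
Qed.

Lemma crd_le2 j z : wt Cspace z <= 5 -> (j < 6)%nat -> -2 <= crd j z <= 2.
Proof.
  intros Hz Hj; assert (H := crd_le_V3norm j z).
  assert (H2 : V3norm z ^ 2 <= 4) by (rewrite V3norm_pow2; cbn [wt Cspace] in Hz; lra).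
  assert (0 <= V3norm z) by apply sqrt_pos; assert (V3norm z <= 2) by nra.
  apply Rabs_le_between in H; lra.
Qed.

(** The Euler-type field [sum x_j d_j + (u + 1/2) d_u + v d_v] is strictly outward. *)
Lemma gradient_nonzero z : boundary_point dom z -> exists j, (j < 6)%nat /\ grho j z <> 0.
Proof.
  intros Hb; assert (Hr := boundary_zero z Hb); destruct (dom_bounds z ltac:(lra)) as [_ HW].
  destruct (phi_small z HW) as [Hp Hg].
  destruct (Req_dec (grho 0 z) 0) as [E0|]; [|exists 0%nat; split; [lia|easy]].
  destruct (Req_dec (grho 1 z) 0) as [E1|]; [|exists 1%nat; split; [lia|easy]].
  destruct (Req_dec (grho 2 z) 0) as [E2|]; [|exists 2%nat; split; [lia|easy]].
  destruct (Req_dec (grho 3 z) 0) as [E3|]; [|exists 3%nat; split; [lia|easy]].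
  destruct (Req_dec (grho 4 z) 0) as [E4|]; [|exists 4%nat; split; [lia|easy]].
  destruct (Req_dec (grho 5 z) 0) as [E5|]; [|exists 5%nat; split; [lia|easy]].
  exfalso; rewrite rhoE in Hr.
  assert (HR : 0 <= sq2 z) by (unfold sq2; nra).
  assert (Hc := chi_le (sq2 z) HR).
  assert (B : forall j x, (j < 6)%nat -> -3 <= x <= 3 -> - (3 / 100) <= x * gphi j z).
  { intros j x Hj Hx; specialize (Hg j Hj); apply Rabs_le_between in Hg; nra. }
  assert (C0 := crd_le2 0 z HW ltac:(lia)); assert (C1 := crd_le2 1 z HW ltac:(lia)).
  assert (C2 := crd_le2 2 z HW ltac:(lia)); assert (C3 := crd_le2 3 z HW ltac:(lia)).
  assert (C4 := crd_le2 4 z HW ltac:(lia)); assert (C5 := crd_le2 5 z HW ltac:(lia)).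
  assert (B0 := B 0%nat (crd 0 z) ltac:(lia) ltac:(lra)); assert (B1 := B 1%nat (crd 1 z) ltac:(lia) ltac:(lra)).
  assert (B2 := B 2%nat (crd 2 z) ltac:(lia) ltac:(lra)); assert (B3 := B 3%nat (crd 3 z) ltac:(lia) ltac:(lra)).
  assert (B4 := B 4%nat (crd 4 z + / 2) ltac:(lia) ltac:(lra)); assert (B5 := B 5%nat (crd 5 z) ltac:(lia) ltac:(lra)).
  assert (Hsum : crd 0 z * grho 0 z + crd 1 z * grho 1 z + crd 2 z * grho 2 z + crd 3 z * grho 3 z
    + (crd 4 z + / 2) * grho 4 z + crd 5 z * grho 5 z = 0)
    by (rewrite E0, E1, E2, E3, E4, E5; ring).
  assert (Eid : crd 0 z * grho 0 z + crd 1 z * grho 1 z + crd 2 z * grho 2 z + crd 3 z * grho 3 z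
    + (crd 4 z + / 2) * grho 4 z + crd 5 z * grho 5 z =
    2 * (sq2 z * chi1 (sq2 z)) + 2 * ((crd 4 z + / 2) ^ 2 + crd 5 z ^ 2)
    + (crd 0 z * gphi 0 z + crd 1 z * gphi 1 z + crd 2 z * gphi 2 z + crd 3 z * gphi 3 z
       + (crd 4 z + / 2) * gphi 4 z + crd 5 z * gphi 5 z)).
  { unfold grho, jbase, jsq2; cbn [jg jv jadd jcomp].
    replace (jv (jx2 z) + jv (jy2 z)) with (sq2 z) by (unfold sq2; simpl; ring).
    unfold sq2; simpl; field. }
  (* By [chi_le] and [rho z = 0], the sum is at least [2 * (chi + |w + 1/2|^2) - 18/100 = 2 * (1/4 -
     phi) - 18/100], which is positive since [phi <= 1/100]. *)
  apply Rabs_le_between in Hp.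
  nra.
Qed.

Lemma dom_defining : defining_function dom rho.
Proof.
  split; [intros k; apply Ck_Sm, rho_Sm|]; split; [reflexivity|].
  intros z Hz; destruct (gradient_nonzero z Hz) as [j [Hj Hn]].
  exists j, (grho j z); split; [easy|]; split; [now apply rho_der|easy].
Qed.

Lemma dom_pseudoconvex : pseudoconvex dom.
Proof.
  exists rho; split; [exact dom_defining|].
  intros z _ d1 d2 _ H w _; exact (psh_jet_second_partials rho z d2 w rho_psh H).
Qed.

Lemma dom_bounded : bounded_set dom.
Proof.
  exists 2; intros z Hz; destruct (dom_bounds z (Rlt_le _ _ Hz)) as [_ H].
  rewrite V3norm_sq3, <- (sqrt_pow2 2) by lra; apply sqrt_le_1_alt; cbn [wt Cspace] in H; lra.
Qed.

(** One coordinate moves at a time, so a bound on single partials is enough: the displacement is at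
    most [2 * (1 - t)], the partial at most [/ 100], and shrinking does not leave the ball. *)
Lemma shrink_coordinate y j t : (j < 6)%nat -> 0 <= t <= 1 -> wt Cspace y <= 5 ->
  Rabs (phi (shf Cspace y j ((t - 1) * crd j y)) - phi y) <= (1 - t) / 50 /\
  wt Cspace (shf Cspace y j ((t - 1) * crd j y)) <= 5.
Proof.
  intros Hj Ht Hy; set (tau := (t - 1) * crd j y).
  assert (Hw : forall s, wt Cspace (shf Cspace y j s) = wt Cspace y + 2 * s * crd j y + s ^ 2).
  { intros s; cbn [wt shf Cspace]; unfold sq3; rewrite !crd_shift by lia.
    do 6 (destruct j as [|j]; [simpl; ring|]); exfalso; clear -Hj; lia. }
  assert (Hin : forall s, Rmin 0 tau <= s <= Rmax 0 tau -> wt Cspace (shf Cspace y j s) <= 5).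
  { intros s Hs; rewrite Hw; unfold tau, Rmin, Rmax in Hs.
    destruct (Rle_dec 0 ((t - 1) * crd j y)); destruct (Rle_dec 0 (crd j y)); nra. }
  split; [|apply Hin; split; [apply Rmin_r|apply Rmax_r]].
  destruct (MVT_abs (fun s => phi (shf Cspace y j s)) (fun s => gphi j (shf Cspace y j s)) 0 tau)
    as [s [E Hs]].
  - intros s _; assert (H := phi_der j (shf Cspace y j s) Hj); intros e He.
    destruct (H e He) as [d Hd]; exists d; intros h Hh Hh2; specialize (Hd h Hh Hh2).
    change (V3add (shf Cspace y j s) (V3rscal 0 (basis j))) with (shf Cspace (shf Cspace y j s) j 0) in Hd.
    rewrite shf0, Rplus_0_l in Hd.
    replace (shf Cspace y j (s + h)) with (V3add (shf Cspace y j s) (V3rscal h (basis j))); [exact Hd|].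
    apply C3_ext; intros i Hi; cbn [shf Cspace]; rewrite !crd_shift by easy.
    destruct (Nat.eqb i j); ring.
  - rewrite shf0 in E; rewrite E, Rminus_0_r.
    assert (Hg := proj2 (phi_small _ (Hin s Hs)) j Hj).
    assert (Hc := crd_le2 j y Hy Hj).
    assert (Rabs tau <= (1 - t) * 2).
    { unfold tau; rewrite Rabs_mult, Rabs_left1 by lra.
      replace (- (t - 1)) with (1 - t) by ring; apply Rmult_le_compat_l; [lra|]; apply Rabs_le; lra. }
    assert (G1 := Rabs_pos tau); assert (G2 := Rabs_pos (gphi j (shf Cspace y j s))); nra.
Qed.

Lemma phi_radial a b p q u v t : 0 <= t <= 1 -> wt Cspace ((a, b), (p, q), (u, v)) <= 5 ->
  phi ((t * a, t * b), (t * p, t * q), (u, v)) - phi ((a, b), (p, q), (u, v)) <= 4 * ((1 - t) / 50) /\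
  Rabs (phi ((t * a, t * b), (t * p, t * q), (u, v))) <= / 100.
Proof.
  intros Ht H0; set (z := ((a, b), (p, q), (u, v)) : C3) in *.
  set (sh := fun j (y : C3) => shf Cspace y j ((t - 1) * crd j y)).
  destruct (shrink_coordinate z 0 t ltac:(lia) Ht H0) as [B0 H1]; fold (sh 0%nat z) in B0, H1.
  destruct (shrink_coordinate (sh 0%nat z) 1 t ltac:(lia) Ht H1) as [B1 H2].
  fold (sh 1%nat (sh 0%nat z)) in B1, H2.
  destruct (shrink_coordinate (sh 1%nat (sh 0%nat z)) 2 t ltac:(lia) Ht H2) as [B2 H3].
  fold (sh 2%nat (sh 1%nat (sh 0%nat z))) in B2, H3.
  destruct (shrink_coordinate (sh 2%nat (sh 1%nat (sh 0%nat z))) 3 t ltac:(lia) Ht H3) as [B3 H4].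
  fold (sh 3%nat (sh 2%nat (sh 1%nat (sh 0%nat z)))) in B3, H4.
  assert (E : sh 3%nat (sh 2%nat (sh 1%nat (sh 0%nat z))) = ((t * a, t * b), (t * p, t * q), (u, v))).
  { apply C3_ext; intros i Hi; unfold sh; cbn [shf Cspace].
    repeat rewrite crd_shift by lia.
    do 6 (destruct i as [|i]; [simpl; ring|]); exfalso; clear -Hi; lia. }
  rewrite E in *; split; [|exact (proj1 (phi_small _ H4))].
  apply Rabs_le_between in B0, B1, B2, B3; lra.
Qed.

(** The slice over [w = -1/2] is star-shaped. If the shrunk point were outside, [chi] would be at
    least [24/100] there, and by convexity its increase back to the original point would outweigh
    any decrease of [phi], contradicting membership of that point. *)
Lemma dom_radial a b p q t : 0 <= t <= 1 ->
  dom ((a, b), (p, q), (- / 2, 0)) -> dom ((t * a, t * b), (t * p, t * q), (- / 2, 0)).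
Proof.
  intros Ht Hz; destruct (dom_bounds _ (Rlt_le _ _ Hz)) as [_ HW].
  destruct (phi_radial a b p q (- / 2) 0 t Ht HW) as [P1 P2].
  unfold dom in *; rewrite rhoE in *; simpl crd in *.
  set (R0 := sq2 ((a, b), (p, q), (- / 2, 0))) in *.
  assert (HR0 : 0 <= R0) by (unfold R0, sq2; nra).
  replace (sq2 ((t * a, t * b), (t * p, t * q), (- / 2, 0))) with (t ^ 2 * R0) in *
    by (unfold R0, sq2; simpl; ring).
  replace (- / 2 + (- / 2) ^ 2 + 0 ^ 2) with (- / 4) in * by field.
  apply Rnot_le_lt; intros Hn.
  apply Rabs_le_between in P2.
  assert (Ht2 : 0 <= t ^ 2 <= 1) by (split; nra).
  assert (HtR : t ^ 2 * R0 <= R0) by nra.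
  assert (K1 := chi_convex _ _ HtR); assert (K2 := chi_le (t ^ 2 * R0) ltac:(nra)).
  set (X := chi1 (t ^ 2 * R0)) in *.
  assert (HX : 0 <= X) by apply chi1_nonneg.
  (* [1/4] from the [w]-part minus [1/100] for [phi]. It exceeds the [4/50] of [phi_radial], and
     [1 - t^2 >= 1 - t]. *)
  assert (K3 : 24 / 100 <= t ^ 2 * R0 * X) by lra.
  assert (K4 : 24 / 100 * (1 - t ^ 2) <= X * (R0 - t ^ 2 * R0)).
  { apply Rle_trans with (t ^ 2 * R0 * X * (1 - t ^ 2)); [apply Rmult_le_compat_r; lra|].
    replace (X * (R0 - t ^ 2 * R0)) with (R0 * X * (1 - t ^ 2)) by ring.
    apply Rmult_le_compat_r; [lra|]; apply Rmult_le_compat_r; lra. }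
  assert (t ^ 2 <= t) by nra; lra.
Qed.

(** [phi] and [chi] ignore [w], and the remaining sublevel set is a disc centred at [-1/2]. *)
Lemma dom_vertical a b p q u v t : 0 <= t <= 1 ->
  dom ((a, b), (p, q), (u, v)) -> dom ((a, b), (p, q), (u + t * (- / 2 - u), v + t * - v)).
Proof.
  intros Ht; unfold dom; rewrite !rhoE.
  assert (Ep : phi ((a, b), (p, q), (u + t * (- / 2 - u), v + t * - v)) = phi ((a, b), (p, q), (u, v)))
    by apply phi_indep.
  rewrite Ep; unfold sq2; simpl crd; intros H.
  assert (E : forall x y, x + x ^ 2 + y ^ 2 = (x + / 2) ^ 2 + y ^ 2 - / 4) by (intros; field).
  rewrite E in H; rewrite E.
  replace ((u + t * (- / 2 - u) + / 2) ^ 2 + (v + t * - v) ^ 2)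
    with ((1 - t) ^ 2 * ((u + / 2) ^ 2 + v ^ 2)) by field.
  assert (0 <= (u + / 2) ^ 2 + v ^ 2) by (apply Rplus_le_le_0_compat; apply pow2_ge_0).
  assert ((1 - t) ^ 2 <= 1) by (clear -Ht; nra).
  assert ((1 - t) ^ 2 * ((u + / 2) ^ 2 + v ^ 2) <= 1 * ((u + / 2) ^ 2 + v ^ 2))
    by (apply Rmult_le_compat_r; lra).
  lra.
Qed.

Lemma center_in_dom : dom (C0, C0, (- / 2, 0)).
Proof.
  unfold dom; rewrite rhoE, phi_0, chi_0; unfold sq2; simpl; lra.
Qed.

(** Every point is joined to [(0, 0, -1/2)] by a segment in [w] followed by a radial one in [z]. In
    a separation, both open sets would then contain this point. *)
Lemma dom_is_domain : is_domain dom.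
Proof.
  split; [eexists; apply center_in_dom|]; split; [exact dom_open|].
  intros U V HU HV Hcov Hdis [z1 [D1 U1]] [z2 [D2 V2]].
  assert (G : forall U V : C3 -> Prop, open_set U -> open_set V -> (forall z, dom z -> U z \/ V z) ->
    (forall z, dom z -> U z -> V z -> False) -> forall z, dom z -> U z -> U (C0, C0, (- / 2, 0))).
  { clear -phi_Sm phi_der phi_small phi_lower phi_indep phi_0 chi_Sm chi_der chi1_der chi_0 chi_nonneg
      chi1_nonneg chi2_nonneg chi_lower chi_le chi_convex.
    intros U V HU HV Hcov Hdis [[[a b] [p q]] [u v]] Hz HUz.
    assert (S1 : U ((a, b), (p, q), (- / 2, 0))).
    { assert (S := segment_stays U V dom
        (fun i => crd i ((a, b), (p, q), (u, v)))
        (fun i => match i with 4%nat => - / 2 - u | 5%nat => - v | _ => 0 end) HU HV Hcov Hdis).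
      unfold mk in S; simpl crd in S; rewrite !Rplus_0_r in S.
      replace (u + (- / 2 - u)) with (- / 2) in S by ring; rewrite Rplus_opp_r in S.
      apply S; [|exact HUz]; intros t Ht; rewrite !Rmult_0_r, !Rplus_0_r; now apply dom_vertical. }
    assert (D1 : dom ((a, b), (p, q), (- / 2, 0))).
    { assert (H := dom_vertical a b p q u v 1 ltac:(lra) Hz).
      replace (u + 1 * (- / 2 - u)) with (- / 2) in H by ring.
      replace (v + 1 * - v) with 0 in H by ring; exact H. }
    assert (S := segment_stays U V dom
        (fun i => crd i ((a, b), (p, q), (- / 2, 0)))
        (fun i => match i with 0%nat => - a | 1%nat => - b | 2%nat => - p | 3%nat => - q | _ => 0 end) HU HV Hcov Hdis).
    unfold mk in S; simpl crd in S; rewrite !Rplus_opp_r, !Rplus_0_r in S.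
    apply S; [|exact S1]; intros t Ht; rewrite !Rmult_0_r, !Rplus_0_r.
    assert (H := dom_radial a b p q (1 - t) ltac:(lra) D1).
    replace (a + t * - a) with ((1 - t) * a) by ring; replace (b + t * - b) with ((1 - t) * b) by ring.
    replace (p + t * - p) with ((1 - t) * p) by ring; replace (q + t * - q) with ((1 - t) * q) by ring.
    exact H. }
  apply (Hdis (C0, C0, (- / 2, 0)) center_in_dom).
  - exact (G U V HU HV Hcov Hdis z1 D1 U1).
  - apply (G V U HV HU (fun z Hz => proj1 (or_comm _ _) (Hcov z Hz)) (fun z Hz HV' HU' => Hdis z Hz HU' HV') z2 D2 V2).
Qed.

Lemma origin_boundary : boundary_point dom (C0, C0, C0).
Proof.
  split.
  - unfold dom; rewrite rhoE, phi_0, chi_0; unfold sq2; simpl; lra.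
  - intros e He; set (d := Rmin (e / 2) (/ 2)).
    assert (Hd : 0 < d) by (apply Rmin_pos; lra).
    assert (Hd1 : d <= e / 2) by apply Rmin_l; assert (Hd2 : d <= / 2) by apply Rmin_r.
    exists (C0, C0, (- d, 0)); split.
    + unfold dom; rewrite rhoE, phi_0, chi_0; unfold sq2; simpl; nra.
    + rewrite V3norm_sq3; replace (sq3 _) with (d ^ 2) by (unfold sq3; simpl; ring).
      rewrite sqrt_pow2; lra.
Qed.

Lemma origin_normal : unit_outward_normal dom (C0, C0, C0) (C0, C0, (1, 0)).
Proof.
  exists rho, (fun j => grho j (C0, C0, C0)); split; [exact dom_defining|]; split.
  - intros j Hj; now apply rho_der.
  - assert (E : forall j, (j < 6)%nat -> grho j (C0, C0, C0) = if Nat.eqb j 4 then 1 else 0).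
    { intros j Hj; unfold grho; rewrite gphi_0 by easy.
      do 6 (destruct j as [|j]; [simpl; ring|]); exfalso; clear -Hj; lia. }
    cbv zeta; rewrite !E by lia; simpl Nat.eqb; cbv iota.
    replace (0 ^ 2 + 0 ^ 2 + 0 ^ 2 + 0 ^ 2 + 1 ^ 2 + 0 ^ 2) with 1 by ring.
    rewrite sqrt_1, Rinv_1; apply C3_ext; intros i Hi.
    do 6 (destruct i as [|i]; [simpl; ring|]); exfalso; clear -Hi; lia.
Qed.
End Domain.

(** * Analytic discs *)

Definition disc (b d r : R) (zeta : C) : C3 :=
  curve (Cmul (b, 0) zeta) (Cadd (- d, 0) (Cmul (r, 0) zeta)).

Lemma disc_deriv b d r zeta : 0 <= b <= / 2 ->
  C3deriv (disc b d r) zeta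
    (Cmul (2 * b ^ 2, 0) zeta, Cmul (3 * b ^ 3, 0) (Cmul zeta zeta), (r, 0)).
Proof.
  intros Hb e He; destruct zeta as [s t].
  set (L := 3 + 18 * (s ^ 2 + t ^ 2)).
  assert (HL : 3 <= L) by (unfold L; nra).
  exists (Rmin 1 (e / L)); split; [apply Rmin_pos; [lra|apply Rdiv_lt_0_compat; lra]|].
  intros [h k] Hh; set (eta := Cnorm (h, k)) in *.
  assert (He0 : 0 <= eta) by apply sqrt_pos.
  assert (He2 : eta ^ 2 = h ^ 2 + k ^ 2).
  { unfold eta, Cnorm; apply pow2_sqrt; simpl; nra. }
  assert (H1 : eta <= 1) by (left; eapply Rlt_le_trans; [exact Hh|apply Rmin_l]).
  assert (H2 : eta * L <= e).
  { assert (H2 : eta < e / L) by (eapply Rlt_le_trans; [exact Hh|apply Rmin_r]).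
    apply (Rmult_lt_compat_r L) in H2; [|lra].
    replace (e / L * L) with e in H2 by (field; lra); lra. }
  rewrite V3norm_sq3, <- (sqrt_pow2 (e * eta)) by nra; apply sqrt_le_1_alt.
  (* The remainder has components [b^2 * H^2], [b^3 * H^2 * (3 * zeta + H)] and [0], with [H] the
     complex increment [(h, k)]; [L] bounds the resulting bracket for [|H| <= 1]. *)
  match goal with |- sq3 ?X <= _ =>
    replace (sq3 X) with ((h ^ 2 + k ^ 2) ^ 2 * (b ^ 4 + b ^ 6 * ((3 * s + h) ^ 2 + (3 * t + k) ^ 2)))
      by (unfold sq3, disc, curve, V3sub, V3cscal, Cmul, Csub, Cadd; simpl; ring) end.
  rewrite <- He2.
  assert (Hb4 : 0 <= b ^ 4 <= 1) by (split; [apply pow_le; lra|rewrite <- (pow1 4); apply pow_incr; lra]).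
  assert (Hb6 : 0 <= b ^ 6 <= 1) by (split; [apply pow_le; lra|rewrite <- (pow1 6); apply pow_incr; lra]).
  assert (HX : (3 * s + h) ^ 2 + (3 * t + k) ^ 2 <= 18 * (s ^ 2 + t ^ 2) + 2 * eta ^ 2).
  { assert (G1 := sq_sum_le (3 * s) h); assert (G2 := sq_sum_le (3 * t) k); nra. }
  assert (HX0 : 0 <= (3 * s + h) ^ 2 + (3 * t + k) ^ 2)
    by (apply Rplus_le_le_0_compat; apply pow2_ge_0).
  set (x := (3 * s + h) ^ 2 + (3 * t + k) ^ 2) in *.
  assert (He3 : 0 <= eta ^ 2 <= 1) by (split; nra).
  assert (HL2 : b ^ 4 + b ^ 6 * x <= L).
  { assert (b ^ 6 * x <= 1 * x) by (apply Rmult_le_compat_r; lra); unfold L; lra. }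
  apply Rle_trans with ((eta ^ 2) ^ 2 * L ^ 2).
  - apply Rmult_le_compat_l; [apply pow2_ge_0|]; nra.
  - replace ((eta ^ 2) ^ 2 * L ^ 2) with ((eta * L) ^ 2 * eta ^ 2) by ring.
    rewrite (Rpow_mult_distr e eta); apply Rmult_le_compat_r; [lra|]; apply pow_incr; split; [nra|exact H2].
Qed.

Theorem theorem3 (alpha : R) (Halpha : 0 < alpha) :
  exists (D : C3 -> Prop) (P n : C3) (delta : nat -> R),
    is_domain D /\ bounded_set D /\ smooth_boundary D /\ pseudoconvex D /\
    boundary_point D P /\ unit_outward_normal D P n /\
    (forall k, 0 < delta k < 1) /\
    (forall k, delta (S k) < delta k) /\
    Un_cv delta 0 /\
    (forall k, D (V3sub P (V3rscal (delta k) n))) /\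
    (forall k, kobayashi_le D (V3sub P (V3rscal (delta k) n)) n
                 (/ (delta k * Rpower (- ln (delta k)) alpha))).
Proof.
  (* An integer exponent above [alpha] is enough, as [ell k >= 1] makes [ell k ^ N] dominate
     [Rpower (ell k) alpha]. *)
  destruct (INR_unbounded alpha) as [N HN].
  destruct (psh_superposition_exists N) as
    [phi [gphi [ell [PS [PP [PD [PG [PB [PL [PI [PZ [PE PC]]]]]]]]]]]].
  destruct convex_growth_exists as
    [chi [chi1 [chi2 [CS [CD [CD1 [CZ [CN [CN1 [CN2 [CL [CE CC]]]]]]]]]]]].
  set (D := dom phi chi chi1 chi2).
  assert (Hdef : defining_function D (rho phi chi chi1 chi2)).
  { apply (dom_defining phi gphi chi chi1 chi2); assumption. }
  assert (HE : forall k, 1 <= ell k) by (intros; apply PE).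
  assert (Hd : forall k, 0 < exp (- ell k) < 1).
  { intros k; split; [apply exp_pos|]; rewrite <- exp_0; apply exp_increasing; specialize (HE k); lra. }
  (* On the disc the linear part [- d + r * s] of [rho] meets [phi <= d / 2 - r * s], the terms in
     [s] cancel, and [|w|^2] costs at most [d / 8]: the total is negative. *)
  assert (Hdisc : forall k, exists b, 0 <= b <= / 2 /\ forall zeta, Cnorm zeta < 1 ->
    D (disc b (exp (- ell k)) (exp (- ell k) * ell k ^ N) zeta)).
  { intros k; destruct (PC k) as [b [Hb H]]; exists b; split; [exact Hb|]; intros [s t] Hz.
    assert (Hst : s ^ 2 + t ^ 2 <= 1).
    { assert (H2 : 0 <= Cnorm (s, t)) by apply sqrt_pos.
      assert (H3 : Cnorm (s, t) ^ 2 = s ^ 2 + t ^ 2) by (unfold Cnorm; apply pow2_sqrt; simpl; nra).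
      nra. }
    specialize (Hd k); set (d := exp (- ell k)) in *; set (r := d * ell k ^ N).
    assert (Hr : 0 <= r) by (apply Rmult_le_pos; [lra|apply pow_le; specialize (HE k); lra]).
    unfold D, dom; rewrite rhoE.
    specialize (H (s, t) (Cadd (- d, 0) (Cmul (r, 0) (s, t))) Hst); simpl fst in H.
    fold (disc b d r (s, t)) in H; fold r in H.
    (* [b <= / 2] gives [|z|^2 <= 1/16 + 1/64 < 1/4] along the disc, so [chi] vanishes there. *)
    rewrite CZ.
    2:{ replace (sq2 (disc b d r (s, t))) with (b ^ 4 * (s ^ 2 + t ^ 2) ^ 2 + b ^ 6 * (s ^ 2 + t ^ 2) ^ 3)
          by (unfold sq2, disc, curve, Cmul; simpl; ring).
        assert (H4 : 0 <= b ^ 4 <= / 16).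
        { split; [apply pow_le; lra|]; replace (/ 16) with ((/ 2) ^ 4) by field; apply pow_incr; lra. }
        assert (H6 : 0 <= b ^ 6 <= / 64).
        { split; [apply pow_le; lra|]; replace (/ 64) with ((/ 2) ^ 6) by field; apply pow_incr; lra. }
        assert (H0 : 0 <= s ^ 2 + t ^ 2) by nra.
        assert (H7 : 0 <= (s ^ 2 + t ^ 2) ^ 2 <= 1)
          by (split; [apply pow_le; lra|rewrite <- (pow1 2); apply pow_incr; lra]).
        assert (H8 : 0 <= (s ^ 2 + t ^ 2) ^ 3 <= 1)
          by (split; [apply pow_le; lra|rewrite <- (pow1 3); apply pow_incr; lra]).
        nra. }
    replace (crd 4 (disc b d r (s, t))) with (- d + r * s) by (unfold disc, curve, Cmul, Cadd; simpl; ring).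
    replace (crd 5 (disc b d r (s, t))) with (r * t) by (unfold disc, curve, Cmul, Cadd; simpl; ring).
    assert (Hw : (- d + r * s) ^ 2 + (r * t) ^ 2 <= (d + r) ^ 2).
    { replace ((- d + r * s) ^ 2 + (r * t) ^ 2) with (d ^ 2 - 2 * (d * r) * s + r ^ 2 * (s ^ 2 + t ^ 2)) by ring.
      assert (-1 <= s) by nra.
      assert (0 <= d * r) by nra.
      assert (0 <= r ^ 2) by apply pow2_ge_0. nra. }
    assert (Hq : (d + r) ^ 2 <= d / 8).
    { destruct (PE k) as [_ [_ HQ]]; fold d in HQ.
      replace ((d + r) ^ 2) with (d * (d * (1 + ell k ^ N) ^ 2)) by (unfold r; ring).
      unfold Rdiv; apply Rmult_le_compat_l; lra. }
    lra. }
  assert (Hpt : forall k b, disc b (exp (- ell k)) (exp (- ell k) * ell k ^ N) C0 =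
    V3sub (C0, C0, C0) (V3rscal (exp (- ell k)) (C0, C0, (1, 0)))).
  { intros k b; apply C3_ext; intros i Hi.
    do 6 (destruct i as [|i]; [simpl; ring|]); exfalso; clear -Hi; lia. }
  exists D, (C0, C0, C0), (C0, C0, (1, 0)), (fun k => exp (- ell k)).
  split; [apply (dom_is_domain phi gphi chi chi1 chi2); assumption|].
  split; [apply (dom_bounded phi chi chi1 chi2); assumption|].
  split; [exists (rho phi chi chi1 chi2); exact Hdef|].
  split; [apply (dom_pseudoconvex phi gphi chi chi1 chi2); assumption|].
  split; [apply (origin_boundary phi chi chi1 chi2); assumption|].
  split; [apply (origin_normal phi gphi chi chi1 chi2); assumption|].
  split; [exact Hd|].
  split; [intros k; apply exp_increasing; destruct (PE k) as [_ [H _]]; lra|].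
  split; [|split].
  - intros e He.
    assert (Hl : forall k, INR k <= ell k).
    { induction k as [|k IH]; [specialize (HE 0%nat); simpl; lra|].
      rewrite S_INR; destruct (PE k) as [_ [H _]]; lra. }
    destruct (INR_unbounded (/ e)) as [M HM]; exists M; intros k Hk.
    unfold Rdist; rewrite Rminus_0_r, Rabs_pos_eq by (left; apply exp_pos).
    rewrite exp_Ropp, <- (Rinv_inv e); apply Rinv_lt_contravar.
    + apply Rmult_lt_0_compat; [now apply Rinv_0_lt_compat|apply exp_pos].
    + specialize (Hl k); apply le_INR in Hk; assert (H := exp_ineq1_le (ell k)); lra.
  - intros k; destruct (Hdisc k) as [b [Hb H]]; rewrite <- (Hpt k b); apply H.
    unfold Cnorm, C0; simpl; rewrite Rmult_0_l, Rplus_0_r, sqrt_0; lra.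
  - intros k e He; destruct (Hdisc k) as [b [Hb H]].
    specialize (HE k); set (d := exp (- ell k)) in *; set (r := d * ell k ^ N) in *.
    assert (H0 : 0 < d) by apply exp_pos.
    assert (Hr : 0 < r) by (apply Rmult_lt_0_compat; [easy|apply pow_lt; lra]).
    (* The derivative at the centre is [r] times the normal, so [/ r = / (d * ell k ^ N)] is
       admissible, already without the slack [e]. *)
    exists (/ r), (disc b d r), (C0, C0, (r, 0)).
    split; [now apply Rinv_0_lt_compat|]; split; [|split; [|split; [|split]]].
    + enough (/ r <= / (d * Rpower (- ln d) alpha)) by lra.
      replace (- ln d) with (ell k) by (unfold d; rewrite ln_exp; ring).
      apply Rinv_le_contravar; [apply Rmult_lt_0_compat; [easy|apply exp_pos]|].
      apply Rmult_le_compat_l; [lra|]; rewrite <- Rpower_pow by lra.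
      apply Rle_Rpower; lra.
    + intros zeta Hz; split; [now apply H|]; eexists; now apply disc_deriv.
    + apply Hpt.
    + assert (HD := disc_deriv b d r C0 Hb).
      replace (Cmul (2 * b ^ 2, 0) C0) with C0 in HD by (unfold Cmul, C0; simpl; f_equal; ring).
      replace (Cmul (3 * b ^ 3, 0) (Cmul C0 C0)) with C0 in HD by (unfold Cmul, C0; simpl; f_equal; ring).
      exact HD.
    + apply C3_ext; intros i Hi.
      do 6 (destruct i as [|i]; [simpl; field; lra|]); exfalso; clear -Hi; lia.
Qed.
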